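(* Let $d\ge3$ and $\widehat R_0(\lambda)=(\widehat H_0-\lambda)^{-1}$ on $\ell^2(\mathbf Z^d)$. (1) Let $0<s\le1$, and for $\widehat q_1,\widehat q_2\in\ell^2(\mathbf Z)$ put $$\widehat Q_s(n_1,\dots,n_d)=\widehat q_1(n_1)\,\widehat q_2(n_2)\,\widehat\rho_s(n'),\qquad n'=(n_3,\dots,n_d)\in\mathbf Z^{d-2},\quad \widehat\rho_s(n')=(1+|n'|^2)^{-s/2}.$$ Then there exists a constant $C_s>0$ such that $$\|\widehat Q_s\,\widehat R_0(\lambda)\,\widehat Q_s\|\le C_s\|\widehat q_1\|_{\ell^2(\mathbf Z)}^2\|\widehat q_2\|_{\ell^2(\mathbf Z)}^2$$ for all $\lambda\in\mathbf C\setminus[0,d]$ with $|\lambda|<2d$. (2) Moreover, let $\lambda,\lambda_1\in\mathbf C_\pm\cap\{\lambda\in\mathbf C:|\lambda|<2d\}$ (both in $\mathbf C_+$ or both in $\mathbf C_-$), let $g>0$ be small enough and $$\widehat Q_{s,g}(n_1,\dots,n_d)=\widehat\rho_g(n_1)\,\widehat Q_{s+2g}(n_1,\dots,n_d),\qquad n\in\mathbf Z^d.$$ Then there exists a constant $C_{s,g}>0$ such that $$\|\widehat Q_{s,g}\,(\widehat R_0(\lambda)-\widehat R_0(\lambda_1))\,\widehat Q_{s,g}\|\le|\lambda-\lambda_1|^g\,C_{s,g}\,\|\widehat q_1\|_{\ell^2(\mathbf Z)}^2\|\widehat q_2\|_{\ell^2(\mathbf Z)}^2 .$$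
   Context: $(\widehat H_0\widehat f)(n)=\frac d2\widehat f(n)-\frac14\sum_{j=1}^d\{\widehat f(n+e_j)+\widehat f(n-e_j)\}$ on $\ell^2(\mathbf Z^d)$, $e_j$ the standard basis vectors; its spectrum is $[0,d]$. A function on $\mathbf Z^d$ is identified with the operator of multiplication by it on $\ell^2(\mathbf Z^d)$, and $\|\cdot\|$ is the operator norm. $\widehat\rho_g(n_1)=(1+|n_1|^2)^{-g/2}$ for $n_1\in\mathbf Z$, and $\widehat Q_{s+2g}$ is defined by the formula for $\widehat Q_s$ with $s$ replaced by $s+2g$. $\mathbf C_\pm=\{\pm{\rm Im}\,\lambda>0\}$. The constants $C_s$, $C_{s,g}$ do not depend on $\lambda,\lambda_1,\widehat q_1,\widehat q_2$. *)

(* Defs.v *)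
From HB Require Import structures.
From mathcomp Require Import all_boot all_order all_algebra.
From mathcomp Require Import complex.
From mathcomp Require Import all_classical all_reals all_analysis.

Set Implicit Arguments.
Unset Strict Implicit.
Unset Printing Implicit Defensive.

Import Order.TTheory GRing.Theory Num.Theory.
Import ComplexField.Normc.

Local Open Scope classical_set_scope.
Local Open Scope ring_scope.
Local Open Scope complex_scope.

(* A vector of l^2(T) is a function T -> R[i] of finite [l2norm].  An operator
   on l^2(T) is a map on all functions T -> R[i], of which only the restriction
   to l^2(T) matters. *)

Section l2_space.
Context {R : realType} {T : choiceType}.
Implicit Types (f : T -> R[i]) (A : (T -> R[i]) -> T -> R[i]).

Definition l2norm f : \bar R :=
  sqrte (\esum_(x in [set: T]) (normc (f x) ^+ 2)%:E).

Definition l2 : set (T -> R[i]) := [set f | (l2norm f < +oo)%E].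

(* It is +oo as soon as A is unbounded or does not preserve l^2(T). *)
Definition opnorm A : \bar R :=
  ereal_sup [set l2norm (A f) | f in [set f | (l2norm f <= 1)%E]].

Definition mulop (Q : T -> R[i]) f : T -> R[i] := fun x => Q x * f x.

(* When A - z is a bijection of l^2(T), this maps f in l^2(T) to (A - z)^-1 f;
   it returns 0 when f has no preimage. *)
Definition resolvent A (z : R[i]) f : T -> R[i] :=
  xget (fun=> 0) [set u | l2 u /\ (fun x => A u x - z * u x) = f].

End l2_space.

Section lattice.
Context {R : realType} {d : nat}.

Definition H0hat (f : 'rV[int]_d -> R[i]) (n : 'rV[int]_d) : R[i] :=
  d%:R / 2%:R * f n -
  4%:R^-1 * \sum_(j < d) (f (n + delta_mx 0 j) + f (n - delta_mx 0 j)).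

Definition R0hat (z : R[i]) : ('rV[int]_d -> R[i]) -> 'rV[int]_d -> R[i] :=
  resolvent H0hat z.

Definition rhov (s : R) (n : 'rV[int]_d) : R :=
  (1 + \sum_(j < d) (n 0 j)%:~R ^+ 2) `^ (- s / 2%:R).

End lattice.

Definition rho {R : realType} (g : R) (k : int) : R :=
  (1 + (`|k|%:~R) ^+ 2) `^ (- g / 2%:R).

Section weights.
Context {R : realType} {d : nat}.
Context (hd : (3 <= d)%N).

Definition split_ord (i : 'I_(2 + (d - 2))) : 'I_d :=
  cast_ord (subnKC (ltnW hd)) i.

Definition fst_coord (n : 'rV[int]_d) : int :=
  n 0 (split_ord (lshift (d - 2) (@Ordinal 2 0 isT))).

Definition snd_coord (n : 'rV[int]_d) : int :=
  n 0 (split_ord (lshift (d - 2) (@Ordinal 2 1 isT))).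

Definition tail (n : 'rV[int]_d) : 'rV[int]_(d - 2) :=
  \row_(j < d - 2) n 0 (split_ord (rshift 2 j)).

Definition Qs (q1 q2 : int -> R[i]) (s : R) (n : 'rV[int]_d) : R[i] :=
  q1 (fst_coord n) * q2 (snd_coord n) * (rhov s (tail n))%:C.

Definition Qsg (q1 q2 : int -> R[i]) (s g : R) (n : 'rV[int]_d) : R[i] :=
  (rho g (fst_coord n))%:C * Qs q1 q2 (s + 2%:R * g) n.

End weights.

(* Main.v *)
Require Import Defs.
From HB Require Import structures.
From mathcomp Require Import all_boot all_order all_algebra.
From mathcomp Require Import complex.
From mathcomp Require Import all_classical all_reals all_analysis.
From mathcomp Require Import zify ring lra.

Set Implicit Arguments.
Unset Strict Implicit.
Unset Printing Implicit Defensive.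

Import Order.TTheory GRing.Theory Num.Theory.
Import ComplexField.Normc.
Import numFieldNormedType.Exports.

Local Open Scope classical_set_scope.
Local Open Scope ring_scope.
Local Open Scope complex_scope.

(** Let [L f n] be half the sum of [f] over the [2 d] neighbours of [n], so that
    [H0 = (d - L) / 2].  With [Z = 2 z - d] the equation [(H0 - z) u = f] reads
    [L u + Z u = - 2 f], and [Im Z] has the sign of [Im z].  The group
    [exp (i t L)] is convolution with the product over the coordinates of
    [i^n_j J_(n_j)(t)], with [J_k] the Bessel functions, and for [Im Z > 0] the
    resolvent is a multiple of the integral over [t > 0] of
    [exp (i t Z) exp (i t L)].

    The product form of the kernel separates the coordinates.  Cut the operator
    [Q exp (i t L) Q] into blocks indexed by the first two coordinates [a] and
    [a'] of the output and of the input, and put [q a = |q1 a_1| |q2 a_2|].  The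
    norm of a block is at most
    [q a * q a' * |J_(a_1 - a'_1)(t) J_(a_2 - a'_2)(t)| * N t], where [N t] is the
    norm of the evolution in the remaining coordinates between two weights
    [rho_s].  [N t] decays like a small power of [1 + t^2] ([weighted_decay]):
    the sites with a low third coordinate are few and the kernel between them is
    small, and at the other sites the weight is small.  Since
    [2 |J_k J_l| <= J_k^2 + J_l^2], what remains is a bound for the integral of
    [J_k^2 (1 + t^2)^(-e)] that is uniform in [k] ([besselJ_mass]).  The norms of
    the time-integrated blocks are then at most a constant times [q a * q a'], and
    the Cauchy-Schwarz inequality bounds the operator by that constant times the
    sum of the [(q a)^2], which is [||q1||^2 ||q2||^2].  For the
    difference of two resolvents, [exp (i t Z)] is replaced by
    [exp (i t Z) - exp (i t Z1)], which is at most
    [2 |Z - Z1|^g (1 + t^2)^(g / 2)] ([wave_holder]); the growth in [t] is absorbed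
    by the decay of [N t] when [g] is small.

    The uniform bounds on Bessel functions come from Bessel's equation.  Written
    for [w = sqrt t J_k] it is [w'' + (1 - (k^2 - 1/4) / t^2) w = 0], and Sonin's
    function [w'^2 + (1 - (k^2 - 1/4) / t^2) w^2] turns out to decrease with [k] at
    fixed [t], and with [t] for [k = 0]; so it is bounded for [t >= 1] by a constant
    that does not depend on [k] ([sonin_le]).  This controls [J_k (t)] for
    [t >= max (k, 1)].  For [t <= k], [J_k^2] is increasing and an energy that grows at
    least as fast as the integral of [J_k^2] is bounded at [t = k] by Sonin's
    function.

    The time integral enters through its derivative: if [L w + Z w = h] then
    [exp (i t Z) exp (i t L) w] has derivative [i exp (i t Z) exp (i t L) h], tends
    to [0] at infinity and equals [w] at [0].  The matrix coefficients of this
    derivative are compared with the derivative of a function whose total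
    increase is bounded ([apriori_finite]).  That argument takes [w] of finite
    support; a general solution is cut off to a large finite set, and the
    commutator of [L] with the cutoff only sees the part of the solution outside a
    set that carries almost all of its mass ([apriori_form]).  The lower
    half-plane follows by complex conjugation, and a real [z] outside the spectrum
    is a limit of points of the upper half-plane ([real_bound]). *)

(** * Monotonicity from the derivative, and integration over half a period *)

Section calculus.
Context {R : realType}.
Implicit Types (f g F : R -> R).

Lemma is_derive_continuous f df (x : R) : is_derive x 1 f df -> {for x, continuous f}.
Proof. by move=> h; apply/differentiable_continuous/derivable1_diffP; exact: ex_derive. Qed.

Lemma le_of_deriv (f df : R -> R) (a b : R) : a <= b ->
  (forall x, a < x < b -> is_derive x 1 f (df x)) ->
  {within `[a, b], continuous f} ->
  (forall x, a < x < b -> 0 <= df x) -> f a <= f b.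
Proof.
move=> ab; have [->//|neq] := eqVneq a b; have {neq} lt_ab : a < b by rewrite lt_neqAle neq.
move=> dF cf df0.
have dF' x : x \in `]a, b[ -> is_derive x 1 f (df x).
  by rewrite in_itv/=; exact: dF.
have [c cab e] := MVT lt_ab dF' cf.
rewrite -subr_ge0 e mulr_ge0 ?subr_ge0//.
by apply: df0; rewrite in_itv in cab.
Qed.

Lemma le_of_deriv_closed (f df : R -> R) (a b : R) : a <= b ->
  (forall x, a <= x <= b -> is_derive x 1 f (df x)) ->
  (forall x, a < x < b -> 0 <= df x) -> f a <= f b.
Proof.
move=> ab dF; apply: le_of_deriv => // [x /andP[ax xb]|].
  by apply: dF; rewrite !ltW.
apply: derivable_within_continuous => x xab; apply: ex_derive.
by apply: dF; rewrite in_itv in xab.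
Qed.

Definition Ipi f : R := \int[lebesgue_measure]_(x in `[0, pi]) f x.

Lemma integrable_pi f : continuous f ->
  (@lebesgue_measure R).-integrable `[0, pi] (EFin \o f).
Proof.
move=> cf; apply: continuous_compact_integrable; first exact: segment_compact.
exact: continuous_subspaceT.
Qed.

Lemma IpiB f g : continuous f -> continuous g ->
  Ipi (fun x => f x - g x) = Ipi f - Ipi g.
Proof. by move=> cf cg; rewrite /Ipi RintegralB//; exact: integrable_pi. Qed.

Lemma IpiD f g : continuous f -> continuous g ->
  Ipi (fun x => f x + g x) = Ipi f + Ipi g.
Proof. by move=> cf cg; rewrite /Ipi RintegralD//; exact: integrable_pi. Qed.

Lemma IpiZ c f : continuous f -> Ipi (fun x => c * f x) = c * Ipi f.
Proof. by move=> cf; rewrite /Ipi RintegralZl//; exact: integrable_pi. Qed.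

Lemma Ipi_cst c : Ipi (fun=> c) = c * pi.
Proof.
rewrite /Ipi Rintegral_cst//= lebesgue_measure_itv/= lte_fin pi_gt0/=.
by rewrite subr0.
Qed.

Lemma Ipi_FTC f F : continuous f -> (forall x : R, is_derive x 1 F (f x)) ->
  Ipi f = F pi - F 0.
Proof.
move=> cf dF; rewrite /Ipi /Rintegral (continuous_FTC2 (F := F)) ?pi_gt0//.
- exact: continuous_subspaceT.
- split.
  + by move=> x _; exact: ex_derive.
  + by apply: cvg_at_right_filter; apply: (is_derive_continuous (dF _)).
  + by apply: cvg_at_left_filter; apply: (is_derive_continuous (dF _)).
- by move=> x _; rewrite derive1E; exact: derive_val.
Qed.

Lemma Ipi_norm f : continuous f -> (forall x, `|f x| <= 1) -> `|Ipi f| <= pi.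
Proof.
move=> cf f1; rewrite /Ipi; apply: (le_trans (le_normr_Rintegral _ _)) => //.
  exact: integrable_pi.
rewrite -[leRHS]mul1r -(Ipi_cst 1) /Ipi; apply: le_Rintegral => //.
- apply: integrable_pi => x /=.
  by apply: continuous_comp; [exact: cf | exact: norm_continuous].
- by apply: integrable_pi => x; exact: cvg_cst.
Qed.

End calculus.

(** * Bessel functions of integer order *)

Section bessel.
Context {R : realType}.

(** Bessel's integral. *)
Definition besselJ (k : int) (t : R) : R :=
  pi^-1 * Ipi (fun x => cos (t * sin x - k%:~R * x)).

Lemma phase_deriv (t c x : R) :
  is_derive x 1 (fun y : R => t * sin y - c * y) (t * cos x - c).
Proof. by apply: is_derive_eq; rewrite /GRing.scale/=; ring. Qed.

Lemma cos_deriv_comp (g : R -> R) (x dg : R) : is_derive x 1 g dg ->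
  is_derive x 1 (fun y : R => cos (g y)) (- sin (g x) * dg).
Proof. by move=> h; apply: (is_derive1_comp (f := cos)). Qed.

Lemma sin_deriv_comp (g : R -> R) (x dg : R) : is_derive x 1 g dg ->
  is_derive x 1 (fun y : R => sin (g y)) (cos (g x) * dg).
Proof. by move=> h; apply: (is_derive1_comp (f := sin)). Qed.

Lemma cont_cosphase (t c : R) : continuous (fun x : R => cos (t * sin x - c * x)).
Proof.
by move=> x; apply: (is_derive_continuous (cos_deriv_comp (phase_deriv t c x))).
Qed.

Lemma sin_intpi (k : int) : sin (k%:~R * pi : R) = 0.
Proof.
have sin_npi (n : nat) : sin (n%:R * pi : R) = 0.
  by elim: n => [|n ih]; rewrite ?mul0r ?sin0// -addn1 natrD mulrDl mul1r sinDpi ih oppr0.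
case: k => n; first exact: sin_npi.
by rewrite NegzE mulrNz mulNr sinN sin_npi oppr0.
Qed.

Lemma besselJ_le1 k t : `|besselJ k t| <= 1.
Proof.
rewrite /besselJ normrM gtr0_norm ?invr_gt0 ?pi_gt0// -ler_pdivlMl ?invr_gt0 ?pi_gt0//.
rewrite invrK mulr1; apply: Ipi_norm => [|x]; first exact: cont_cosphase.
exact: cos_max.
Qed.

Lemma besselJ0 k : besselJ k 0 = (k == 0)%:R.
Proof.
rewrite /besselJ; have [->|k0] := eqVneq k 0.
  under [X in Ipi X]eq_fun do rewrite !mul0r subr0 cos0.
  by rewrite Ipi_cst mul1r mulVf// gt_eqF// pi_gt0.
have k0' : k%:~R != 0 :> R by rewrite intr_eq0.
have dF (x : R) : is_derive x 1 (fun x : R => (k%:~R)^-1 * sin (k%:~R * x))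
    (cos (0 * sin x - k%:~R * x)).
  rewrite mul0r sub0r cosN.
  have h : is_derive x 1 (fun y : R => k%:~R * y) (k%:~R : R).
    by apply: is_derive_eq; rewrite /GRing.scale/= mulr1.
  have h2 := sin_deriv_comp h.
  by apply: is_derive_eq; rewrite /GRing.scale/=; field.
rewrite (Ipi_FTC (@cont_cosphase _ _) dF).
by rewrite sin_intpi !mulr0 sin0 mulr0 subr0 mulr0.
Qed.

Lemma cosphase_shift (k : int) (t x : R) :
  cos (t * sin x - (k - 1)%:~R * x) =
  cos (t * sin x - k%:~R * x) * cos x - sin (t * sin x - k%:~R * x) * sin x
  /\ cos (t * sin x - (k + 1)%:~R * x) =
  cos (t * sin x - k%:~R * x) * cos x + sin (t * sin x - k%:~R * x) * sin x.
Proof.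
rewrite -cosD -cosB; split; congr (cos _); rewrite ?intrD ?intrB ?mulrNz; ring.
Qed.

Lemma cont_mul (f g : R -> R) : continuous f -> continuous g ->
  continuous (fun x => f x * g x).
Proof. by move=> cf cg x; apply: continuousM; [exact: cf|exact: cg]. Qed.

Lemma cont_sub (f g : R -> R) : continuous f -> continuous g ->
  continuous (fun x => f x - g x).
Proof. by move=> cf cg x; apply: cvgB; [exact: cf|exact: cg]. Qed.

(** Up to a factor, the difference of the two sides is the integral of the
    derivative of [sin (t sin x - k x)], which vanishes at both ends. *)
Lemma besselJ_rec k t :
  t * (besselJ (k - 1) t + besselJ (k + 1) t) = 2 * k%:~R * besselJ k t.
Proof.
have c1 := @cont_cosphase; have c2 := @continuous_cos R.
rewrite /besselJ -mulrDr -IpiD; [|exact: c1..].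
have -> : (fun x => cos (t * sin x - (k - 1)%:~R * x) + cos (t * sin x - (k + 1)%:~R * x))
   = (fun x => 2 * (cos (t * sin x - k%:~R * x) * cos x)).
  by apply/funext => x; have [-> ->] := cosphase_shift k t x; ring.
have cc : continuous (fun x => cos (t * sin x - k%:~R * x) * cos x).
  by apply: cont_mul.
rewrite IpiZ//.
have ck (c : R) : continuous (fun _ : R => c) by move=> ?; exact: cvg_cst.
have dF (x : R) : is_derive x 1 (fun x : R => sin (t * sin x - k%:~R * x))
    (t * (cos (t * sin x - k%:~R * x) * cos x)
              - k%:~R * cos (t * sin x - k%:~R * x)).
  have h := sin_deriv_comp (phase_deriv t k%:~R x).
  by apply: is_derive_eq; ring.
have : Ipi (fun x => t * (cos (t * sin x - k%:~R * x) * cos x)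
              - k%:~R * cos (t * sin x - k%:~R * x)) = 0.
  rewrite (Ipi_FTC _ dF).
  - by rewrite sinpi sin0 !mulr0 subr0 sin0 subr0 sub0r sinN sin_intpi oppr0.
  - apply: cont_sub; apply: cont_mul => //; exact: cont_mul.
rewrite IpiB ?IpiZ//; [|by apply: cont_mul..].
by move=> /eqP; rewrite subr_eq0 => /eqP h; rewrite [LHS](_ : _ = 2 * pi^-1 * 
  (t * Ipi (fun x => cos (t * sin x - k%:~R * x) * cos x))); [rewrite h|]; ring.
Qed.

(** Differentiation under the integral sign, the derivative of the integrand being
    bounded by [1]. *)
Lemma besselJ_deriv k (t : R) :
  is_derive t 1 (besselJ k) ((besselJ (k - 1) t - besselJ (k + 1) t) / 2).
Proof.
have c1 := @cont_cosphase; have c2 := @continuous_sin R.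
have d1 (x t0 : R) : is_derive t0 1 (fun t1 : R => cos (t1 * sin x - k%:~R * x))
    (- sin (t0 * sin x - k%:~R * x) * sin x).
  apply: cos_deriv_comp.
  by apply: is_derive_eq; rewrite /GRing.scale/=; ring.
pose f (t0 x : R) := cos (t0 * sin x - k%:~R * x).
have It : `](t - 1), (t + 1)[%classic t.
  by rewrite /= in_itv/= ltrBlDr ltrDl ltr01.
have i1 x : (@lebesgue_measure R).-integrable `[0, pi] (EFin \o f x).
  by apply: integrable_pi; exact: c1.
have i2 : (@lebesgue_measure R).-integrable `[0, pi] (EFin \o (fun _ : R => 1 : R)).
  by apply: integrable_pi; move=> ?; exact: cvg_cst.
have d2 (x y : R) : `](t - 1), (t + 1)[%classic x -> `[0, pi]%classic y ->
    derivable (f^~ y) x 1 by move=> _ _; apply: ex_derive.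
have d3 (x y : R) : partial1of2 f x y = - sin (x * sin y - k%:~R * y) * sin y.
  by rewrite /partial1of2 derive1E; exact: derive_val.
have b (x y : R) : `](t - 1), (t + 1)[%classic x -> `[0, pi]%classic y ->
    `|partial1of2 f x y| <= 1.
  move=> _ _; rewrite d3 normrM normrN mulr_ile1 ?sin_max//.
have m : measurable `[0, (pi : R)]%classic by [].
have dd := @derivable_under_integral R _ _ (@lebesgue_measure R) f _ m _ _ _ It
  (fun x _ => i1 x) d2 _ (fun=> ler01) i2 b.
have de := @differentiation_under_integral R _ _ (@lebesgue_measure R) f _ m _ _ _ It
  (fun x _ => i1 x) d2 _ (fun=> ler01) i2 b.
have dI : is_derive t 1 (fun t0 => Ipi (f t0))
    (Ipi (fun x => - sin (t * sin x - k%:~R * x) * sin x)).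
  apply: DeriveDef => //; rewrite -derive1E de /Ipi.
  by apply: eq_Rintegral => x _; rewrite d3.
rewrite /besselJ; apply: is_derive_eq.
rewrite /GRing.scale/= -mulrBr -IpiB; [|exact: c1..].
rewrite -mulrA; congr (_ * _).
rewrite [RHS]mulrC -IpiZ; last by apply: cont_sub; exact: c1.
congr Ipi; apply/funext => x; have [-> ->] := cosphase_shift k t x.
by field.
Qed.

End bessel.

(** * Sonin's function and bounds beyond the turning point *)

Section bessel_family.
Context {R : realType}.

(** The relations shared by the two families [J_k] and [(-1)^k J_(-k)], [k >= 0]:
    what follows uses nothing else, so that it applies to all integer orders. *)
Record bessel_family (a : nat -> R -> R) := BesselFamily {
  bf_le1 : forall k t, `|a k t| <= 1 ;
  bf_at0 : forall k, a k.+1 0 = 0 ;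
  bf_deriv : forall k (t : R), is_derive t 1 (a k.+1) ((a k t - a k.+2 t) / 2) ;
  bf_deriv0 : forall t : R, is_derive t 1 (a 0) (- a 1 t) ;
  bf_rec : forall k t, t * (a k t + a k.+2 t) = 2 * k.+1%:R * a k.+1 t }.

Variable a : nat -> R -> R.
Hypothesis ha : bessel_family a.

Let recE k t : t != 0 -> a k.+2 t = 2 * k.+1%:R * a k.+1 t / t - a k t.
Proof. by move=> t0; rewrite -(bf_rec ha); field. Qed.

Lemma bf_deriv_down k (t : R) : t != 0 ->
  is_derive t 1 (a k) (k%:R * a k t / t - a k.+1 t).
Proof.
move=> t0; case: k => [|k].
  have h := bf_deriv0 ha t; apply: is_derive_eq.
  by rewrite mul0r mul0r sub0r.
have h := bf_deriv ha k t; apply: is_derive_eq.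
by rewrite recE//; field.
Qed.

Lemma bf_deriv_up k (t : R) : t != 0 ->
  is_derive t 1 (a k.+1) (a k t - k.+1%:R * a k.+1 t / t).
Proof.
move=> t0; have h := bf_deriv ha k t; apply: is_derive_eq.
by rewrite recE//; field.
Qed.

(** This is [w'^2 + (1 - (k^2 - 1/4) / t^2) w^2] for [w = sqrt t (a k)], with the
    derivative of [a k] expressed by [a k] and [a k.+1] (see [soninE]).  In this
    form it can be compared between consecutive orders. *)
Definition sonin k t := t * (a k t ^+ 2 + a k.+1 t ^+ 2)
  - (2 * k%:R + 1) * (a k t * a k.+1 t) + (k%:R + 2^-1) * a k t ^+ 2 / t.

Lemma soninS k t : 0 < t ->
  sonin k.+1 t = sonin k t - (k%:R + 2^-1) * (a k t ^+ 2 + a k.+1 t ^+ 2) / t.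
Proof.
move=> t0; rewrite /sonin recE ?gt_eqF// -natr1; field.
by rewrite gt_eqF.
Qed.

Lemma sonin0_deriv (t : R) : 0 < t ->
  is_derive t 1 (sonin 0) (- (2^-1 * a 0 t ^+ 2 / t ^+ 2)).
Proof.
move=> t0; have tn0 : t != 0 by rewrite gt_eqF.
have h0 := bf_deriv0 ha t; have h1 := bf_deriv_up 0 tn0.
have hV : is_derive t 1 (fun y : R => y^-1) (- t ^- 2).
  have := @is_deriveV R id t 1 1 tn0 _; rewrite /GRing.scale/= mulr1; exact.
have -> : sonin 0 = (fun t => t * (a 0 t * a 0 t + a 1 t * a 1 t)
  - a 0 t * a 1 t + 2^-1 * (a 0 t * a 0 t) * t^-1).
  by apply/funext => x; rewrite /sonin; ring.
by apply: is_derive_eq; rewrite /GRing.scale/=; field.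
Qed.

(** The value that [|a_0 1| <= 1] and [|a_1 1| <= 1] give for [sonin 0 1]. *)
Definition sonin_bound : R := 7 / 2.

Lemma sonin_bound_ge0 : 0 <= sonin_bound.
Proof. by rewrite /sonin_bound; lra. Qed.

(** The function decreases with the order by [soninS], and with time at order
    [0] by [sonin0_deriv], so its value is at most [sonin 0 1].  The point is that
    the bound is uniform in [k]. *)
Lemma sonin_le k t : 1 <= t -> sonin k t <= sonin_bound.
Proof.
move=> t1; have t0 : 0 < t := lt_le_trans ltr01 t1.
elim: k => [|k]; last first.
  apply: le_trans; rewrite soninS// gerBl.
  by rewrite !mulr_ge0 ?addr_ge0 ?invr_ge0 ?sqr_ge0// ltW.
have le1 : sonin 0 t <= sonin 0 1.
  rewrite -lerN2; apply: (@le_of_deriv_closed R (fun t => - sonin 0 t)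
    (fun t => 2^-1 * a 0 t ^+ 2 / t ^+ 2)) => // [x /andP[x1 _]|x /andP[x1 _]].
    have h := sonin0_deriv (lt_le_trans ltr01 x1).
    by apply: is_derive_eq; rewrite opprK.
  by rewrite mulr_ge0 ?invr_ge0 ?sqr_ge0// mulr_ge0 ?invr_ge0 ?sqr_ge0.
apply: (le_trans le1); rewrite /sonin /sonin_bound.
have := bf_le1 ha 0 1; have := bf_le1 ha 1 1; rewrite !ler_norml => /andP[? ?] /andP[? ?].
by rewrite invr1; nra.
Qed.

Let da k t := k%:R * a k t / t - a k.+1 t.

Lemma soninE k t : 0 < t -> sonin k t =
  t * (da k t + a k t / (2 * t)) ^+ 2 + (t - (k%:R ^+ 2 - 4^-1) / t) * a k t ^+ 2.
Proof. by move=> t0; rewrite /sonin /da; field; rewrite gt_eqF. Qed.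

(** The second term of [soninE] alone.  The [1/4] coming from the equation for
    [sqrt t (a k)] keeps the denominator positive at the turning point [t = k]. *)
Lemma bf_sqr_le k t : 1 <= t -> k%:R <= t ->
  a k t ^+ 2 <= sonin_bound * t / (t ^+ 2 - k%:R ^+ 2 + 4^-1).
Proof.
move=> t1 kt; have t0 : 0 < t := lt_le_trans ltr01 t1.
have kk : k%:R ^+ 2 <= t ^+ 2 by rewrite ler_pXn2r ?nnegrE// ltW.
have den : 0 < t ^+ 2 - k%:R ^+ 2 + 4^-1 by rewrite ltr_wpDl ?subr_ge0// invr_gt0.
rewrite ler_pdivlMr// -ler_pdivrMr//.
rewrite (le_trans _ (sonin_le k t1))// soninE//.
rewrite [leLHS](_ : _ = (t - (k%:R ^+ 2 - 4^-1) / t) * a k t ^+ 2); last first.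
  by field; rewrite gt_eqF.
by rewrite lerDr mulr_ge0 ?sqr_ge0// ltW.
Qed.

(** The first term of [soninE] alone bounds [da k t + a k t / (2 t)]; the
    correction is of order [1 / t]. *)
Lemma bf_da_le k t : 1 <= t -> k%:R <= t -> `|da k t| <= 3 / Num.sqrt t.
Proof.
move=> t1 kt; have t0 : 0 < t := lt_le_trans ltr01 t1.
have kk : k%:R ^+ 2 <= t ^+ 2 by rewrite ler_pXn2r ?nnegrE// ltW.
set r := Num.sqrt t; have r1 : 1 <= r by rewrite -sqrtr1 ler_wsqrtr.
have r0 : 0 < r := lt_le_trans ltr01 r1.
have rr : t = r ^+ 2 by rewrite sqr_sqrtr// ltW.
set x := da k t + a k t / (2 * t).
have hx : (r * x) ^+ 2 <= sonin_bound.
  rewrite exprMn -rr (le_trans _ (sonin_le k t1))// soninE// lerDl.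
  rewrite mulr_ge0 ?sqr_ge0// subr_ge0 ler_pdivrMr// -expr2.
  by rewrite (le_trans _ kk)// gerBl.
have hx2 : `|r * x| <= 2.
  rewrite -(@ler_pXn2r _ 2)// ?nnegrE// -normrX ger0_norm ?sqr_ge0//.
  by apply: (le_trans hx); rewrite /sonin_bound; lra.
have e : da k t = x - a k t / (2 * t) by rewrite /x addrK.
rewrite ler_pdivlMr// -[r in X in X <= _]gtr0_norm// -normrM mulrC e mulrBr.
apply: (le_trans (ler_normB _ _)).
have : `|r * (a k t / (2 * t))| <= 1.
  have e2 A : r * (A / (2 * t)) = A / (2 * r) by rewrite rr; field; rewrite gt_eqF.
  rewrite e2.
  rewrite normrM (gtr0_norm (x := _^-1)) ?invr_gt0 ?mulr_gt0//.
  rewrite mulr_ile1 ?bf_le1// ?invr_ge0 ?mulr_ge0 ?ltW//.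
  by rewrite invf_cp1 ?mulr_gt0//; nra.
lra.
Qed.

End bessel_family.

(** * Bounds around the turning point *)

Section bessel_family_bounds.
Context {R : realType}.
Variable a : nat -> R -> R.
Hypothesis ha : bessel_family a.
Local Notation C0 := (@sonin_bound R).

Lemma bf_derivable k (t : R) : derivable (a k) t 1.
Proof.
case: k => [|k]; first by have h := bf_deriv0 ha t; exact: ex_derive.
by have h := bf_deriv ha k t; exact: ex_derive.
Qed.

Lemma bf_cont k : continuous (a k).
Proof. by move=> t; apply/differentiable_continuous/derivable1_diffP; exact: bf_derivable. Qed.

(** [b k t] is [t] times the derivative of [a k]. *)
Let b k t := k%:R * a k t - t * a k.+1 t.
(** The derivative of [b^2 + (t^2 - k^2) a^2] is [2 t a^2] by Bessel's equation;
    adding [a b], whose derivative is [b^2 / t + (k^2 / t - t) a^2], and dividing by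
    [2 k], makes the derivative at least [a^2] for all [t > 0]. *)
Let E k t := (b k t * b k t + a k t * b k t + (t * t - k%:R * k%:R) * (a k t * a k t)) / (2 * k%:R).

Let E_derivable k (t : R) : derivable (E k) t 1.
Proof.
have h0 := DeriveDef (@bf_derivable k t) erefl.
have h1 := DeriveDef (@bf_derivable k.+1 t) erefl.
by rewrite /E /b; apply: ex_derive.
Qed.

Let ab_deriv k (t : R) : t != 0 -> is_derive t 1 (fun t => a k t * b k t)
  (b k t ^+ 2 / t + (k%:R ^+ 2 / t - t) * a k t ^+ 2).
Proof.
move=> t0; have h0 := bf_deriv_down ha k t0; have h1 := bf_deriv_up ha k t0.
rewrite /E /b; apply: is_derive_eq; rewrite /GRing.scale/= -natr1; field; exact: t0.
Qed.

Let E_deriv k (t : R) : t != 0 -> is_derive t 1 (E k)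
  ((b k t ^+ 2 / t + (k%:R ^+ 2 / t + t) * a k t ^+ 2) / (2 * k%:R)).
Proof.
move=> t0; have h0 := bf_deriv_down ha k t0; have h1 := bf_deriv_up ha k t0.
rewrite /E /b; apply: is_derive_eq; rewrite /GRing.scale/= -natr1.
by move: (2 * k%:R)^-1 => c; field.
Qed.

(** [E' >= a^2] by the arithmetic-geometric inequality [k^2 / t + t >= 2 k], and
    [E] vanishes at [0]. *)
Lemma bf_early_mass k (F f : R -> R) (T : R) :
  (forall t : R, 0 <= t -> is_derive t 1 F (f t)) -> (forall t, f t <= a k.+1 t ^+ 2) ->
  0 <= T <= k.+1%:R -> F T - F 0 <= E k.+1 T.
Proof.
move=> dF fa /andP[T0 Tk].
have E0 : E k.+1 0 = 0 by rewrite /E /b (bf_at0 ha); field.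
have k0 : 0 < k.+1%:R :> R by rewrite ltr0n.
suff : E k.+1 0 - F 0 <= E k.+1 T - F T by rewrite E0; lra.
apply: (@le_of_deriv R (fun t => E k.+1 t - F t) (fun t =>
  ((b k.+1 t ^+ 2 / t + (k.+1%:R ^+ 2 / t + t) * a k.+1 t ^+ 2) / (2 * k.+1%:R)) - f t) _ _ T0).
- move=> x /andP[x0 xT]; have xn : x != 0 by rewrite gt_eqF.
  have h1 := E_deriv k.+1 xn; have h2 := dF x (ltW x0).
  exact: is_deriveB.
- apply: derivable_within_continuous => x; rewrite in_itv/= => /andP[x0 _].
  apply: derivableB; first exact: E_derivable.
  by have h := dF x x0; exact: ex_derive.
- move=> x /andP[x0 xT]; rewrite subr_ge0 (le_trans (fa x))//.
  rewrite ler_pdivlMr ?mulr_gt0//.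
  have : 2 * k.+1%:R <= k.+1%:R ^+ 2 / x + x.
    rewrite -subr_ge0 [leRHS](_ : _ = (k.+1%:R - x) ^+ 2 / x); last by field; rewrite gt_eqF.
    by rewrite divr_ge0 ?sqr_ge0// ltW.
  have : 0 <= b k.+1 x ^+ 2 / x by rewrite divr_ge0 ?sqr_ge0// ltW.
  by move=> B0 S; rewrite -[leLHS]add0r lerD// mulrC ler_wpM2r// sqr_ge0.
Qed.

(** At [t = k] the energy is [sonin / 2] up to a nonpositive term. *)
Lemma bf_early_end k : E k.+1 k.+1%:R <= C0 / 2.
Proof.
have k0 : 0 < k.+1%:R :> R by rewrite ltr0n.
have k1 : 1 <= k.+1%:R :> R by rewrite ler1n.
have := sonin_le ha k.+1 k1; rewrite /sonin /E /b.
set K := k.+1%:R; set A := a k.+1 K; set B := a k.+2 K => h.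
have e : (K * A - K * B) * (K * A - K * B) + A * (K * A - K * B) + (K * K - K * K) * (A * A)
   = K * (K * (A ^+ 2 + B ^+ 2) - (2 * K + 1) * (A * B) + (K + 2^-1) * A ^+ 2 / K) - 2^-1 * A ^+ 2.
  by field; rewrite gt_eqF.
rewrite ler_pdivrMr ?mulr_gt0// e.
rewrite (_ : C0 / 2 * (2 * K) = K * C0); last by field.
rewrite lerBlDr (le_trans (ler_wpM2l (ltW k0) h))// lerDl.
by rewrite mulr_ge0 ?invr_ge0 ?sqr_ge0.
Qed.

(** Before the turning point [a b] is nondecreasing from [0], hence nonnegative,
    and it is [t / 2] times the derivative of [a^2]. *)
Lemma bf_sqr_homo k (s t : R) : 0 <= s -> s <= t -> t <= k.+1%:R ->
  a k.+1 s ^+ 2 <= a k.+1 t ^+ 2.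
Proof.
move=> s0 st tk.
have ab0 x : 0 < x -> x <= k.+1%:R -> 0 <= a k.+1 x * b k.+1 x.
  move=> x0 xk; have -> : 0 = a k.+1 0 * b k.+1 0 by rewrite (bf_at0 ha) mul0r.
  apply: (@le_of_deriv R (fun t => a k.+1 t * b k.+1 t) _ _ _ (ltW x0)) => [y /andP[y0 _]||].
  - by apply: ab_deriv; rewrite gt_eqF.
  - apply: continuous_subspaceT; apply: cont_mul; first exact: bf_cont.
    by apply: cont_sub; apply: cont_mul; try exact: bf_cont; move=> ?; [exact: cvg_cst|exact: cvg_id].
  - move=> y /andP[y0 yx]; have yk := lt_le_trans yx xk.
    have y2 : y ^+ 2 <= k.+1%:R ^+ 2 by rewrite ler_pXn2r ?nnegrE ?ltW.
    apply: addr_ge0; first by rewrite divr_ge0 ?sqr_ge0// ltW.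
    by apply: mulr_ge0; rewrite ?sqr_ge0// subr_ge0 ler_pdivlMr// -expr2.
apply: (@le_of_deriv R (fun t => a k.+1 t ^+ 2) (fun x => 2 * (a k.+1 x * b k.+1 x) / x) _ _ st).
- move=> x /andP[sx xt]; have x0 := le_lt_trans s0 sx; have xn : x != 0 by rewrite gt_eqF.
  have h0 := bf_deriv_down ha k.+1 xn.
  rewrite /b; apply: is_derive_eq; rewrite /GRing.scale/=; field; exact: xn.
- apply: continuous_subspaceT.
  have -> : (fun t => a k.+1 t ^+ 2) = (fun t => a k.+1 t * a k.+1 t).
    by apply/funext => x; rewrite expr2.
  by apply: cont_mul; exact: bf_cont.
- move=> x /andP[sx xt]; have x0 := le_lt_trans s0 sx.
  have h := ab0 x x0 (ltW (lt_le_trans xt tk)).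
  by rewrite divr_ge0 ?(ltW x0)//; apply: mulr_ge0.
Qed.

(** [bf_sqr_le] degenerates at [t = k]: it is applied at distance [e] beyond [t],
    and the way back is paid by [bf_da_le]. *)
Lemma bf_decay_late k (t e : R) : 1 <= t -> k%:R <= t -> 0 < e ->
  `|a k t| <= 2 / Num.sqrt e + 3 * e / Num.sqrt t.
Proof.
move=> t1 kt e0; have t0 : 0 < t := lt_le_trans ltr01 t1.
have te : t <= t + e by rewrite lerDl ltW.
have kt' := le_trans kt te; have t1' := le_trans t1 te.
have late : `|a k (t + e)| <= 2 / Num.sqrt e.
  have se : 0 < Num.sqrt e by rewrite sqrtr_gt0.
  rewrite -(@ler_pXn2r _ 2)// ?nnegrE ?divr_ge0 ?(ltW se)// -normrX ger0_norm ?sqr_ge0//.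
  apply: (le_trans (bf_sqr_le ha t1' kt')).
  rewrite exprMn exprVn sqr_sqrtr ?(ltW e0)//.
  have kk : k%:R ^+ 2 <= t ^+ 2 by rewrite ler_pXn2r ?nnegrE// ltW.
  have den : e * (t + e) <= (t + e) ^+ 2 - k%:R ^+ 2 + 4^-1 by nra.
  have p : 0 < e * (t + e) by rewrite mulr_gt0// addr_gt0.
  rewrite ler_pdivrMr ?(lt_le_trans p)//.
  apply: (@le_trans _ _ (2 ^+ 2 / e * (e * (t + e)))); last first.
    by rewrite ler_wpM2l// divr_ge0 ?sqr_ge0// ltW.
  by rewrite mulrA divfK ?gt_eqF// ler_wpM2r ?addr_ge0 ?ltW//; rewrite /C0; lra.
(* The derivative is integrated back from [t + e] to [t]. *)
have dk x : t <= x -> is_derive x 1 (a k) (k%:R * a k x / x - a k.+1 x).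
  by move=> tx; apply: bf_deriv_down => //; rewrite gt_eqF// (lt_le_trans t0).
have [c cab ec] := @MVT_segment R (a k) _ _ _ te (fun x => fun h => dk x (ltac:(move: h; rewrite in_itv/= => /andP[/ltW h _]; exact: h))) (continuous_subspaceT (@bf_cont k)).
have {cab} tc : t <= c by move: cab; rewrite in_itv/= => /andP[].
have := bf_da_le ha (le_trans t1 tc) (le_trans kt tc).
have st : 0 < Num.sqrt t by rewrite sqrtr_gt0.
have sc : Num.sqrt t <= Num.sqrt c by rewrite ler_wsqrtr.
move=> dc; have {}dc : `|k%:R * a k c / c - a k.+1 c| <= 3 / Num.sqrt t.
  by apply: (le_trans dc); rewrite ler_pM2l// lef_pV2 ?posrE// (lt_le_trans st).
have -> : a k t = a k (t + e) - (a k (t + e) - a k t) by rewrite subKr.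
apply: (le_trans (ler_normB _ _)); apply: lerD => //.
rewrite ec addrAC subrr add0r normrM (gtr0_norm e0) [leRHS]mulrAC.
by rewrite ler_pM2r.
Qed.

End bessel_family_bounds.

(** * Decay and weighted mass in time, uniform in the order *)

Section bessel_family_time.
Context {R : realType}.
Variable a : nat -> R -> R.
Hypothesis ha : bessel_family a.
Local Notation C0 := (@sonin_bound R).

Lemma powR_invnK (n : nat) (x : R) : 0 < x -> (x `^ (n.+1%:R^-1)) ^+ n.+1 = x.
Proof.
by move=> x0; rewrite -powR_mulrn ?powR_ge0// -powRrM mulVf ?pnatr_eq0// powRr1// ltW.
Qed.

(** For [t >= k], [bf_decay_late] with [e = t^(1/3)] balances its two terms and
    gives [5 t^(-1/6)]; for [t <= k] the value at [k] dominates, by monotonicity. *)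
Lemma bf_decay k (t : R) : 0 <= t -> `|a k t| <= 10 * (1 + t ^+ 2) `^ (- 12^-1).
Proof.
move=> t0; have th1 : 1 <= 1 + t ^+ 2 by rewrite lerDl sqr_ge0.
have th0 : 0 < 1 + t ^+ 2 := lt_le_trans ltr01 th1.
rewrite powRN; set p := (1 + t ^+ 2) `^ 12^-1.
have p0 : 0 < p by rewrite powR_gt0.
have p12 : p ^+ 12 = 1 + t ^+ 2 by exact: powR_invnK.
rewrite ler_pdivlMr//.
have [t1|t1] := leP t 1.
  have p2 : p <= 2.
    rewrite -(@ler_pXn2r _ 12)// ?nnegrE ?(ltW p0)// p12.
    have : (2 : R) <= 2 ^+ 12 by rewrite -[leLHS]expr1 ler_weXn2l// ler1n.
    nra.
  by apply: (le_trans (ler_pM _ _ (bf_le1 ha k t) p2)) => //; rewrite ?(ltW p0)//; lra.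
(* Powers are compared through twelfth powers, [p^12 = 1 + t^2] and
   [r^12 = t^2], to stay with integer exponents. *)
set r := t `^ 6^-1.
have tgt0 : 0 < t := lt_trans ltr01 t1.
have r0 : 0 < r by rewrite powR_gt0.
have late j (x : R) : 1 <= x -> j%:R <= x -> `|a j x| <= 5 / x `^ 6^-1.
  move=> x1 jx; have x0 : 0 < x := lt_le_trans ltr01 x1.
  set y := x `^ 6^-1; have y0 : 0 < y by rewrite powR_gt0.
  have y6 : x = y ^+ 6 by rewrite powR_invnK.
  have := bf_decay_late ha x1 jx (exprn_gt0 2 y0).
  have -> : Num.sqrt (y ^+ 2) = y by rewrite sqrtr_sqr gtr0_norm.
  have -> : Num.sqrt x = y ^+ 3.
    by rewrite y6 (exprM y 3 2) sqrtr_sqr gtr0_norm// exprn_gt0.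
  suff -> : 2 / y + 3 * y ^+ 2 / y ^+ 3 = 5 / y by [].
  by field; rewrite gt_eqF.
have ar : `|a k t| <= 5 / r.
  have [kt|tk] := leP k%:R t; first exact: late (ltW t1) kt.
  case: k tk => [|k] tk; first by move: tk; rewrite ltNge ltW.
  have k1 : 1 <= k.+1%:R :> R by rewrite ler1n.
  apply: (@le_trans _ _ `|a k.+1 k.+1%:R|).
    rewrite -(@ler_pXn2r _ 2)// ?nnegrE// -!normrX !ger0_norm ?sqr_ge0//.
    by apply: (bf_sqr_homo ha) => //; exact: ltW.
  apply: (le_trans (late _ _ k1 (lexx _))).
  rewrite ler_pM2l// lef_pV2 ?posrE ?powR_gt0//.
  by apply: ge0_ler_powR; rewrite ?nnegrE// ltW.
have pr : p <= 2 * r.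
  rewrite -(@ler_pXn2r _ 12)// ?nnegrE ?(ltW p0) ?mulr_ge0 ?(ltW r0)// p12.
  rewrite exprMn (exprM r 6 2) powR_invnK//.
  have : (2 : R) <= 2 ^+ 12 by rewrite -[leLHS]expr1 ler_weXn2l// ler1n.
  nra.
apply: (le_trans (ler_pM _ _ ar pr)) => //; rewrite ?(ltW p0)//.
by rewrite [leLHS](_ : _ = 10)//; field; rewrite gt_eqF.
Qed.

(** Contributions of the times before the turning point, of [0 <= t <= 1] when
    [k = 0], and of the times after the turning point. *)
Definition mass_bound (e : R) : R := C0 / 2 + 1 + C0 / (2 * e) * 4^-1 `^ (- e).

Lemma mass_bound_ge0 (e : R) : 0 <= e -> 0 <= mass_bound e.
Proof.
move=> e0; rewrite /mass_bound !addr_ge0 ?divr_ge0 ?sonin_bound_ge0//.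
by rewrite mulr_ge0 ?powR_ge0// divr_ge0 ?sonin_bound_ge0 ?mulr_ge0.
Qed.

(** Before the turning point [bf_early_mass] bounds the increase of [F].  After it,
    with
    [D t = t^2 - k^2 + 1/4 <= 1 + t^2], the integrand is at most
    [sonin_bound * t * (D t)^(-1 - e)], an exact derivative whose integral is bounded
    uniformly in [k]. *)
Lemma bf_mass k (e : R) (F : R -> R) (T : R) : 0 < e -> 0 <= T ->
  (forall t : R, 0 <= t -> is_derive t 1 F (a k t ^+ 2 * (1 + t ^+ 2) `^ (- e))) ->
  F T - F 0 <= mass_bound e.
Proof.
move=> e0 T0 dF.
have th1 (t : R) : 1 <= 1 + t ^+ 2 by rewrite lerDl sqr_ge0.
have w_ge0 t : 0 <= a k t ^+ 2 * (1 + t ^+ 2) `^ (- e).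
  by rewrite mulr_ge0 ?sqr_ge0 ?powR_ge0.
have w_le t : a k t ^+ 2 * (1 + t ^+ 2) `^ (- e) <= a k t ^+ 2.
  rewrite ler_piMr ?sqr_ge0//.
  by rewrite -[leRHS](powRr0 (1 + t ^+ 2)) ler_powR// oppr_le0 ltW.
have F_homo x y : 0 <= x -> x <= y -> F x <= F y.
  move=> x0 xy; apply: (@le_of_deriv_closed R F (fun t => a k t ^+ 2 * (1 + t ^+ 2) `^ (- e)) x y xy)
    => [z /andP[xz _]|z _]; last exact: w_ge0.
  exact: dF (le_trans x0 xz).
(* For [k = 0] the turning point is [0], where the late bound is not
   available; it is replaced by [1]. *)
pose m : R := if k is 0%N then 1 else k%:R.
have m1 : 1 <= m by rewrite /m; case: (k) => // n; rewrite ler1n.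
have km : k%:R <= m by rewrite /m; case: (k) => //.
have early : F m - F 0 <= C0 / 2 + 1.
  have C02 : 0 <= C0 / 2 by rewrite /C0; lra.
  rewrite /m; case: (k) dF w_le => [|n] dF' w_le.
    suff : F 1 - F 0 <= 1 by lra.
    suff : 0 - F 0 <= 1 - F 1 by lra.
    apply: (@le_of_deriv_closed R (fun t : R => t - F t) (fun t => 1 - (a 0 t ^+ 2 * (1 + t ^+ 2) `^ (- e)))).
    - exact: ler01.
    - move=> x /andP[x0 _]; exact: is_deriveB (is_derive_id x (1 : R)) (dF' x x0).
    - move=> x _; rewrite subr_ge0 (le_trans (w_le x))//.
      by have := bf_le1 ha 0 x; rewrite ler_norml => /andP[? ?]; nra.
  apply: (le_trans (bf_early_mass ha dF' w_le _)); first by rewrite lexx ler0n.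
  by apply: (le_trans (bf_early_end ha n)); lra.
have q4 (t : R) : m <= t -> 4^-1 <= t ^+ 2 - k%:R ^+ 2 + 4^-1.
  move=> mt; rewrite lerDr subr_ge0 ler_pXn2r ?nnegrE//; first exact: le_trans mt.
  by apply: le_trans mt; rewrite (le_trans ler01).
have q_gt0 (t : R) : m <= t -> 0 < t ^+ 2 - k%:R ^+ 2 + 4^-1.
  by move=> /q4; apply: lt_le_trans; rewrite invr_gt0.
have late : F (Num.max m T) - F m <= C0 / (2 * e) * 4^-1 `^ (- e).
  pose G (t : R) := - (C0 / (2 * e)) * (t ^+ 2 - k%:R ^+ 2 + 4^-1) `^ (- e).
  have mM : m <= Num.max m T by rewrite le_max lexx.
  have dG (t : R) : m <= t -> is_derive t 1 G (C0 * t * (t ^+ 2 - k%:R ^+ 2 + 4^-1) `^ (- e - 1)).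
    move=> mt.
    have h1 : is_derive t 1 (fun t : R => t ^+ 2 - k%:R ^+ 2 + 4^-1) (2 * t).
      by apply: is_derive_eq; rewrite /GRing.scale/=; ring.
    have h2 := @is_derive1_comp R (fun x => x `^ (- e)) (fun t : R => t ^+ 2 - k%:R ^+ 2 + 4^-1)
      t _ _ (is_derive1_powR (- e) (q_gt0 t mt)) h1.
    have h3 := is_deriveZ (- (C0 / (2 * e))) h2; apply: (is_derive_eq h3).
    by rewrite /GRing.scale/=; field; rewrite gt_eqF.
  have : G m - F m <= G (Num.max m T) - F (Num.max m T).
    apply: (@le_of_deriv_closed R (fun t => G t - F t) (fun t =>
      C0 * t * (t ^+ 2 - k%:R ^+ 2 + 4^-1) `^ (- e - 1) - a k t ^+ 2 * (1 + t ^+ 2) `^ (- e))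
      m (Num.max m T) mM).
      move=> x /andP[mx _]; have h1 := dG x mx; have h2 := dF x (le_trans ler01 (le_trans m1 mx)).
      exact: is_deriveB.
    move=> x /andP[mx _] /=; have {}mx := ltW mx.
    have x1 := le_trans m1 mx; have kx := le_trans km mx.
    have x0 : 0 < x := lt_le_trans ltr01 x1.
    have qx := q_gt0 x mx.
    rewrite subr_ge0 powRB; last by rewrite (gt_eqF qx) implybT.
    rewrite powRr1 ?(ltW qx)//.
    rewrite [leRHS]mulrA [leRHS]mulrAC; apply: ler_pM; [exact: sqr_ge0|exact: powR_ge0| |].
      exact: (bf_sqr_le ha).
    have px : 0 < 1 + x ^+ 2 := lt_le_trans ltr01 (th1 x).
    rewrite !powRN lef_pV2 ?posrE ?powR_gt0//.
    apply: ge0_ler_powR; rewrite ?nnegrE ?(ltW e0) ?(ltW qx) ?(ltW px)//.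
    rewrite -addrA [leRHS]addrC lerD2l (@le_trans _ _ 4^-1)//; last by lra.
    by rewrite gerDr oppr_le0 sqr_ge0.
  have G0 : G (Num.max m T) <= 0.
    by rewrite /G mulNr oppr_le0 mulr_ge0 ?powR_ge0// divr_ge0 ?sonin_bound_ge0// mulr_ge0 ?(ltW e0).
  have Gm : - G m <= C0 / (2 * e) * 4^-1 `^ (- e).
    rewrite /G mulNr opprK ler_wpM2l//.
      by rewrite divr_ge0 ?sonin_bound_ge0// mulr_ge0 ?(ltW e0).
    rewrite !powRN lef_pV2 ?posrE ?powR_gt0 ?q_gt0 ?invr_gt0//.
    by apply: ge0_ler_powR; rewrite ?nnegrE ?(ltW e0) ?(ltW (q_gt0 _ (lexx m))) ?invr_ge0 ?q4.
  lra.
have := F_homo T (Num.max m T) T0; rewrite le_max lexx orbT => /(_ isT).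
rewrite /mass_bound; lra.
Qed.

End bessel_family_time.

(** * Uniform bounds for all integer orders *)

Section besselJ_bounds.
Context {R : realType}.
Local Notation J := (@besselJ R).

Lemma besselJN1 (t : R) : J (-1) t = - J 1 t.
Proof.
have [->|t0] := eqVneq t 0; first by rewrite !besselJ0 oppr0.
have := besselJ_rec 0 t; rewrite mulr0 mul0r sub0r add0r => /eqP.
by rewrite mulf_eq0 (negbTE t0)/= addr_eq0 => /eqP.
Qed.

Lemma bessel_family_pos : bessel_family (fun n : nat => J n).
Proof.
split=> [k t|k|k t|t|k t].
- exact: besselJ_le1.
- by rewrite besselJ0.
- have e1 : k.+1%:Z - 1 = k by lia.
  have e2 : k.+1%:Z + 1 = k.+2 by lia.
  by have := @besselJ_deriv R k.+1 t; rewrite e1 e2.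
- have h := @besselJ_deriv R 0 t; apply: (is_derive_eq h).
  by rewrite sub0r add0r besselJN1; field.
- have e1 : k.+1%:Z - 1 = k by lia.
  have e2 : k.+1%:Z + 1 = k.+2 by lia.
  by have := besselJ_rec k.+1 t; rewrite e1 e2.
Qed.

Lemma bessel_family_neg : bessel_family (fun n t => (-1) ^+ n * J (- n%:Z) t).
Proof.
split=> [k t|k|k t|t|k t].
- by rewrite normrM normrX normrN1 expr1n mul1r besselJ_le1.
- by rewrite besselJ0 mulr0.
- have e1 : - k.+1%:Z - 1 = - k.+2%:Z by lia.
  have e2 : - k.+1%:Z + 1 = - k%:Z by lia.
  have := @besselJ_deriv R (- k.+1%:Z) t; rewrite e1 e2.
  move=> h; have h2 := is_deriveZ ((-1) ^+ k.+1) h; apply: (is_derive_eq h2).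
  by rewrite /GRing.scale/= !exprS; field.
- have h := @besselJ_deriv R 0 t.
  rewrite (_ : (fun _ => _) = J 0); last by apply/funext => x; rewrite expr0 mul1r oppr0.
  by apply: (is_derive_eq h); rewrite sub0r add0r besselJN1 expr1; field.
- have e1 : - k.+1%:Z - 1 = - k.+2%:Z by lia.
  have e2 : - k.+1%:Z + 1 = - k%:Z by lia.
  have := besselJ_rec (- k.+1%:Z) t; rewrite e1 e2.
  rewrite mulrNz -pmulrn => h; rewrite !exprS.
  transitivity ((-1) ^+ k * (t * (J (- k.+2%:Z) t + J (- k%:Z) t))); first by ring.
  by rewrite h; ring.
Qed.

Lemma besselJ_decay k (t : R) : 0 <= t -> `|J k t| <= 10 * (1 + t ^+ 2) `^ (- 12^-1).
Proof.
move=> t0; case: k => n; first exact: (bf_decay bessel_family_pos).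
have := bf_decay bessel_family_neg n.+1 t0.
by rewrite normrM normrX normrN1 expr1n mul1r NegzE.
Qed.

Lemma besselJ_mass k (e : R) (F : R -> R) (T : R) : 0 < e -> 0 <= T ->
  (forall t : R, 0 <= t -> is_derive t 1 F (J k t ^+ 2 * (1 + t ^+ 2) `^ (- e))) ->
  F T - F 0 <= mass_bound e.
Proof.
move=> e0 T0; case: k => n dF; first exact: (bf_mass bessel_family_pos e0 T0 dF).
apply: (@bf_mass R _ bessel_family_neg n.+1 e F T e0 T0) => t t0.
rewrite exprMn -exprM mulnC exprM sqrrN expr1n expr1n mul1r -NegzE; exact: dF.
Qed.

Lemma besselJ_cont k : continuous (J k).
Proof. by move=> t; apply: (is_derive_continuous (besselJ_deriv k t)). Qed.

Lemma antiderivative_ge0 (f : R -> R) : continuous f ->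
  exists F : R -> R, forall t : R, 0 <= t -> is_derive t 1 F (f t).
Proof.
move=> cf; exists (fun x => \int[lebesgue_measure]_(t in `[-1, x]) f t) => t t0.
have lt : t < t + 1 by rewrite ltrDl.
have ig : (@lebesgue_measure R).-integrable `[-1, t + 1] (EFin \o f).
  apply: continuous_compact_integrable; first exact: segment_compact.
  exact: continuous_subspaceT.
have m1t : -1 < t by apply: lt_le_trans t0; rewrite oppr_lt0.
have [d e] := continuous_FTC1_closed lt ig m1t (cf t).
by apply: DeriveDef => //; rewrite -derive1E.
Qed.

Definition Jmass (e : R) k (t : R) := J k t ^+ 2 * (1 + t ^+ 2) `^ (- e).

Lemma Jmass_cont e k : continuous (Jmass e k).
Proof.
have ck := @besselJ_cont k.
have -> : Jmass e k = (fun t => (J k t * J k t) * (1 + t ^+ 2) `^ (- e)).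
  by apply/funext => t; rewrite /Jmass expr2.
apply: cont_mul; first exact: cont_mul.
move=> t; have h : is_derive t 1 (fun t : R => 1 + t ^+ 2) (2 * t).
  by apply: is_derive_eq; rewrite /GRing.scale/=; ring.
have p : 0 < 1 + t ^+ 2 by rewrite ltr_wpDr ?sqr_ge0.
exact: (is_derive_continuous (@is_derive1_comp R (fun x => x `^ (- e)) (fun t : R => 1 + t ^+ 2)
      t _ _ (is_derive1_powR (- e) p) h)).
Qed.

(** All time integrals below are carried by these antiderivatives, so that the
    comparison of operators only needs comparisons of derivatives. *)
Lemma Jmass_prim (e : R) : 0 < e -> exists F : int -> R -> R,
  (forall k (t : R), 0 <= t -> is_derive t 1 (F k) (Jmass e k t)) /\
  (forall k T, 0 <= T -> F k T - F k 0 <= mass_bound e).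
Proof.
move=> e0; have /choice[F dF] : forall k, exists F : R -> R,
    forall t : R, 0 <= t -> is_derive t 1 F (Jmass e k t).
  by move=> k; apply: antiderivative_ge0; exact: Jmass_cont.
exists F; split => // k T T0; exact: besselJ_mass e0 T0 (dF k).
Qed.

End besselJ_bounds.

(** * Square-summability through finite partial sums *)

Section finite_l2.
Context {R : realType}.

(** Lagrange's identity. *)
Lemma sum_cauchy_schwarz (I : Type) (s : seq I) (a b : I -> R) :
  \sum_(i <- s) a i * b i <=
  Num.sqrt (\sum_(i <- s) a i ^+ 2) * Num.sqrt (\sum_(i <- s) b i ^+ 2).
Proof.
set A := \sum_(i <- s) a i ^+ 2; set B := \sum_(i <- s) b i ^+ 2.
set C := \sum_(i <- s) a i * b i.
have A0 : 0 <= A by apply: sumr_ge0 => i _; exact: sqr_ge0.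
have B0 : 0 <= B by apply: sumr_ge0 => i _; exact: sqr_ge0.
have : 0 <= \sum_(i <- s) \sum_(j <- s) (a i * b j - a j * b i) ^+ 2.
  by apply: sumr_ge0 => i _; apply: sumr_ge0 => j _; exact: sqr_ge0.
have -> : \sum_(i <- s) \sum_(j <- s) (a i * b j - a j * b i) ^+ 2 =
    2 * (A * B - C ^+ 2).
  transitivity (\sum_(i <- s) (a i ^+ 2 * B + b i ^+ 2 * A - 2 * C * (a i * b i))).
    apply: eq_bigr => i _; rewrite /A /B /C !mulr_sumr mulr_suml -big_split/= -sumrB.
    by apply: eq_bigr => j _; ring.
  by rewrite sumrB big_split/= -!mulr_suml -mulr_sumr -/A -/B -/C; ring.
rewrite pmulr_rge0// subr_ge0 => h.
rewrite -sqrtrM//; apply: (le_trans (ler_norm C)).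
by rewrite -sqrtr_sqr ler_wsqrtr.
Qed.

Lemma normc_ge0 (z : R[i]) : 0 <= normc z.
Proof. by case: z => x y; rewrite /normc sqrtr_ge0. Qed.

Lemma normc_sqr (z : R[i]) : normc z ^+ 2 = complex.Re z ^+ 2 + complex.Im z ^+ 2.
Proof. by case: z => x y; rewrite /normc sqr_sqrtr// addr_ge0 ?sqr_ge0. Qed.

Lemma normc_sum (I : Type) (s : seq I) (f : I -> R[i]) :
  normc (\sum_(i <- s) f i) <= \sum_(i <- s) normc (f i).
Proof.
elim: s => [|x s ih]; first by rewrite !big_nil normc0.
by rewrite !big_cons (le_trans (le_normcD _ _))// lerD2l.
Qed.

Lemma normcR (x : R) : normc x%:C = `|x|.
Proof. by rewrite /normc/= expr0n/= addr0 sqrtr_sqr. Qed.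

Variable T : eqType.
Implicit Types (s : seq T) (f g : T -> R[i]).

Definition nq s f : R := \sum_(x <- s) normc (f x) ^+ 2.
Definition nrm s f : R := Num.sqrt (nq s f).

Lemma nq_ge0 s f : 0 <= nq s f.
Proof. by apply: sumr_ge0 => x _; exact: sqr_ge0. Qed.

Lemma nrm_ge0 s f : 0 <= nrm s f.
Proof. exact: sqrtr_ge0. Qed.

Lemma nrm_sqr s f : nrm s f ^+ 2 = nq s f.
Proof. by rewrite sqr_sqrtr// nq_ge0. Qed.

Lemma nq_le s f g : (forall x, x \in s -> normc (f x) <= normc (g x)) -> nq s f <= nq s g.
Proof.
move=> h; rewrite /nq big_seq [leRHS]big_seq; apply: ler_sum => x xs.
by rewrite ler_pXn2r ?nnegrE ?normc_ge0 ?h.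
Qed.

Lemma nrm_le s f g : (forall x, x \in s -> normc (f x) <= normc (g x)) -> nrm s f <= nrm s g.
Proof. by move=> h; rewrite ler_wsqrtr// nq_le. Qed.

Lemma sum_sub_le (s s' : seq T) (F : T -> R) : uniq s -> uniq s' -> {subset s <= s'} ->
  (forall x, 0 <= F x) -> \sum_(x <- s) F x <= \sum_(x <- s') F x.
Proof.
move=> us us' ss F0.
have pe : perm_eq s [seq x <- s' | x \in s].
  apply: uniq_perm => //; first by rewrite filter_uniq.
  by move=> x; rewrite mem_filter; case: (boolP (x \in s)) => //= /ss ->.
rewrite (perm_big _ pe) big_filter/= big_mkcond/=; apply: ler_sum => x _.
by case: ifP.
Qed.

Lemma nq_sub s s' f : uniq s -> uniq s' -> {subset s <= s'} -> nq s f <= nq s' f.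
Proof. by move=> us us' ss; apply: sum_sub_le => // x; exact: sqr_ge0. Qed.

Lemma sum_normc_mul_le s f g :
  \sum_(x <- s) normc (f x) * normc (g x) <= nrm s f * nrm s g.
Proof. exact: sum_cauchy_schwarz. Qed.

Lemma bilin_le s f g : normc (\sum_(x <- s) f x * g x) <= nrm s f * nrm s g.
Proof.
apply: (le_trans (normc_sum _ _)); rewrite (le_trans _ (sum_normc_mul_le s f g))//.
by apply: ler_sum => x _; rewrite normcM.
Qed.

Lemma nrmD s f g : nrm s (fun x => f x + g x) <= nrm s f + nrm s g.
Proof.
rewrite -(@ler_pXn2r _ 2)// ?nnegrE ?addr_ge0 ?nrm_ge0//.
rewrite sqrrD !nrm_sqr.
apply: (@le_trans _ _ (\sum_(x <- s) (normc (f x) ^+ 2 + normc (g x) ^+ 2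
  + 2 * (normc (f x) * normc (g x))))).
  apply: ler_sum => x _; apply: (@le_trans _ _ ((normc (f x) + normc (g x)) ^+ 2)).
    by rewrite ler_pXn2r ?nnegrE ?addr_ge0 ?normc_ge0// le_normcD.
  by rewrite sqrrD; lra.
rewrite !big_split/= -mulr_sumr -/(nq s f) -/(nq s g).
by have := sum_normc_mul_le s f g; lra.
Qed.

Lemma nrmZ s (c : R[i]) f : nrm s (fun x => c * f x) = normc c * nrm s f.
Proof.
rewrite /nrm /nq; under eq_bigr do rewrite normcM exprMn.
by rewrite -mulr_sumr sqrtrM ?sqr_ge0// sqrtr_sqr ger0_norm ?normc_ge0.
Qed.

(** [f] is in l^2 with squared norm at most [c]. *)
Definition sqb f (c : R) : Prop := forall s, uniq s -> nq s f <= c.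

Lemma sqb_ge0 f c : sqb f c -> 0 <= c.
Proof. by move=> /(_ [::] isT); apply: le_trans; exact: nq_ge0. Qed.

Lemma sqb_nrm f c s : sqb f c -> uniq s -> nrm s f <= Num.sqrt c.
Proof. by move=> h us; rewrite ler_wsqrtr// h. Qed.

Lemma sqb_of_nrm f c : 0 <= c -> (forall s, uniq s -> nrm s f <= c) -> sqb f (c ^+ 2).
Proof.
by move=> c0 h s us; rewrite -nrm_sqr ler_pXn2r ?nnegrE ?nrm_ge0// h.
Qed.

End finite_l2.

Section laplacian.
Context {R : realType} {D : nat}.
Local Notation T := 'rV[int]_D.
Implicit Types (f : T -> R[i]) (n : T).

Definition Lap f n : R[i] :=
  2^-1 * \sum_(j < D) (f (n + delta_mx 0 j) + f (n - delta_mx 0 j)).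

Lemma sqb_shift f c e (s : seq T) : sqb f c -> uniq s -> nq s (fun n => f (n + e)) <= c.
Proof.
move=> fc us; have := fc [seq n + e | n <- s]; rewrite /nq big_map; apply.
by rewrite map_inj_uniq//; exact: addIr.
Qed.

(** Pairing the direction [e] with [- e] makes the estimate local: at each edge
    the two cross terms, which contain the factor ['i], cancel each other. *)
Lemma nq_pair f c (a b : R) e (s : seq T) : sqb f c -> uniq s ->
  nq s (fun n => a%:C * f n + 'i * b%:C * f (n + e))
  + nq s (fun n => a%:C * f n + 'i * b%:C * f (n - e)) <= 2 * (a ^+ 2 + b ^+ 2) * c.
Proof.
(* A finite set on which the sum over [s] for [e] and the translated sum
   for [- e] can be added term by term. *)
move=> fc us; pose U := undup (s ++ [seq n - e | n <- s]).
have uU : uniq U by exact: undup_uniq.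
have le1 : nq s (fun n => a%:C * f n + 'i * b%:C * f (n + e))
    <= nq U (fun n => a%:C * f n + 'i * b%:C * f (n + e)).
  by apply: nq_sub => // x xs; rewrite mem_undup mem_cat xs.
have le2 : nq s (fun n => a%:C * f n + 'i * b%:C * f (n - e))
    <= nq U (fun n => a%:C * f (n + e) + 'i * b%:C * f n).
  apply: (@le_trans _ _ (nq [seq n - e | n <- s] (fun n => a%:C * f (n + e) + 'i * b%:C * f n))).
    by rewrite /nq big_map; apply: ler_sum => x _; rewrite subrK.
  apply: nq_sub => //; first by rewrite map_inj_uniq//; exact: addIr.
  by move=> x xs; rewrite mem_undup mem_cat xs orbT.
apply: (le_trans (lerD le1 le2)); rewrite /nq -big_split/=.
apply: (@le_trans _ _ (\sum_(n <- U) (a ^+ 2 + b ^+ 2) * (normc (f n) ^+ 2 + normc (f (n + e)) ^+ 2))).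
  (* Here the cross terms cancel. *)
  apply: ler_sum => n _; rewrite !normc_sqr.
  case: (f n) => x y; case: (f (n + e)) => u v /=; lra.
rewrite -mulr_sumr [leRHS](_ : _ = (a ^+ 2 + b ^+ 2) * (c + c)); last by ring.
rewrite ler_wpM2l ?addr_ge0 ?sqr_ge0//.
rewrite big_split/=; apply: lerD; first exact: fc.
exact: sqb_shift.
Qed.

Lemma normc_sum_sqr (I : Type) (s : seq I) (F : I -> R[i]) :
  normc (\sum_(i <- s) F i) ^+ 2 <= (size s)%:R * \sum_(i <- s) normc (F i) ^+ 2.
Proof.
have N0 : 0 <= \sum_(i <- s) normc (F i) ^+ 2 by apply: sumr_ge0 => i _; exact: sqr_ge0.
have := @sum_cauchy_schwarz R _ s (fun=> 1) (fun i => normc (F i)).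
rewrite (eq_bigr (fun i => normc (F i))); last by move=> i _; rewrite mul1r.
rewrite -sqrtrM; last by apply: sumr_ge0 => i _; exact: sqr_ge0.
have -> : \sum_(i <- s) (1 : R) ^+ 2 = (size s)%:R.
  by rewrite expr1n big_const_seq count_predT iter_addr addr0.
move=> h; have h2 := le_trans (normc_sum s F) h.
have sN0 : 0 <= (size s)%:R * \sum_(i <- s) normc (F i) ^+ 2 by rewrite mulr_ge0 ?ler0n.
by rewrite -[leRHS]sqr_sqrtr// ler_pXn2r ?nnegrE ?normc_ge0 ?sqrtr_ge0.
Qed.

(** This is [||a f + i b L f||^2 = a^2 ||f||^2 + b^2 ||L f||^2] for the self-adjoint
    [L], together with [||L|| <= D].  To stay with finite sums the operator is
    written as the mean over [j] of two-point operators; convexity reduces to one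
    [j], and the parallelogram inequality to [nq_pair]. *)
Lemma sqb_schrodinger f c (a b : R) : sqb f c ->
  sqb (fun n => a%:C * f n + 'i * b%:C * Lap f n) ((a ^+ 2 + b ^+ 2 * D%:R ^+ 2) * c).
Proof.
move=> fc s us; have c0 := sqb_ge0 fc.
have [D0|D0] := eqVneq D 0%N.
  apply: (@le_trans _ _ (a ^+ 2 * c)); last first.
    by rewrite ler_wpM2r// lerDl mulr_ge0 ?sqr_ge0.
  rewrite (le_trans _ (ler_wpM2l (sqr_ge0 a) (fc s us)))// /nq mulr_sumr.
  apply: ler_sum => n _; rewrite /Lap big1 ?mulr0 ?addr0; last first.
    by case=> m mD; exfalso; rewrite D0 in mD.
  by rewrite normcM normcR exprMn -normrX ger0_norm// sqr_ge0.
have Dp : 0 < D%:R :> R by rewrite ltr0n lt0n.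
(* With these coefficients the mean over [j] of the sums of the two operators
   [a' + i b' (shift)] is [a + i b L]. *)
pose a' := a / 2; pose b' := b * D%:R / 2.
pose z e n := a'%:C * f n + 'i * b'%:C * f (n + e).
have pw n : normc (a%:C * f n + 'i * b%:C * Lap f n) ^+ 2 <=
    2 / D%:R * \sum_(j < D) (normc (z (delta_mx 0 j) n) ^+ 2 + normc (z (- delta_mx 0 j) n) ^+ 2).
  have -> : a%:C * f n + 'i * b%:C * Lap f n =
     (D%:R^-1)%:C * \sum_(j < D) (z (delta_mx 0 j) n + z (- delta_mx 0 j) n).
    rewrite (eq_bigr (fun j => a%:C * f n + 'i * b'%:C * (f (n + delta_mx 0 j) + f (n - delta_mx 0 j)))); last first.
      move=> j _; rewrite /z (_ : a%:C = a'%:C + a'%:C); first by ring.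
      by rewrite -rmorphD/= /a' -splitr.
    rewrite big_split/= sumr_const card_ord -mulr_sumr mulrDr; congr (_ + _).
      have -> : a%:C * f n *+ D = (D%:R : R)%:C * (a%:C * f n) by rewrite rmorph_nat mulr_natl.
      by rewrite [RHS]mulrA -rmorphM/= mulVf ?gt_eqF// mul1r.
    rewrite /Lap !mulrA; congr (_ * _).
    have -> : (2^-1 : R[i]) = (2^-1 : R)%:C by rewrite fmorphV rmorph_nat.
    rewrite /b' [RHS]mulrAC [RHS]mulrC -!mulrA; congr ('i * _).
    by rewrite -!rmorphM/=; congr (_%:C); field; rewrite gt_eqF.
  rewrite normcM normcR exprMn -normrX ger0_norm ?sqr_ge0//.
  apply: (@le_trans _ _ (D%:R^-1 ^+ 2 * (D%:R * \sum_(j < D) normc (z (delta_mx 0 j) n + z (- delta_mx 0 j) n) ^+ 2))).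
    rewrite ler_wpM2l ?sqr_ge0//; have := @normc_sum_sqr _ (index_enum 'I_D) (fun j => z (delta_mx 0 j) n + z (- delta_mx 0 j) n).
    by rewrite /index_enum -enumT size_enum_ord.
  rewrite mulrA [X in X * _](_ : _ = D%:R^-1); last by field; rewrite gt_eqF.
  rewrite [2 / _]mulrC -mulrA ler_wpM2l ?invr_ge0 ?ler0n// mulr_sumr; apply: ler_sum => j _.
  move: (z _ n) (z _ n) => [x y] [u v]; rewrite !normc_sqr/=.
  have := sqr_ge0 (x - u); have := sqr_ge0 (y - v); lra.
apply: (le_trans (ler_sum _ (fun n _ => pw n))).
rewrite -mulr_sumr exchange_big/=.
apply: (@le_trans _ _ (2 / D%:R * \sum_(j < D) (2 * (a' ^+ 2 + b' ^+ 2) * c))).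
  rewrite ler_wpM2l ?divr_ge0 ?ler0n//; apply: ler_sum => j _.
  by rewrite big_split/=; exact: nq_pair.
have -> K : \sum_(j < D) K = D%:R * K :> R by rewrite sumr_const card_ord mulr_natl.
rewrite [leLHS](_ : _ = (a ^+ 2 + b ^+ 2 * D%:R ^+ 2) * c)//.
by rewrite /a' /b'; field; rewrite gt_eqF.
Qed.

End laplacian.

(** * Complex-valued functions of time, and the kernel of the evolution *)

Section complex_derivative.
Context {R : realType}.
Implicit Types (F G : R -> R[i]) (t : R).

Definition cder F t (d : R[i]) : Prop :=
  is_derive t 1 (fun x => complex.Re (F x)) (complex.Re d) /\
  is_derive t 1 (fun x => complex.Im (F x)) (complex.Im d).

Lemma cder_eq F t d d' : cder F t d -> d = d' -> cder F t d'.
Proof. by move=> h <-. Qed.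

Lemma ReM (x y : R[i]) : complex.Re (x * y) =
  complex.Re x * complex.Re y - complex.Im x * complex.Im y.
Proof. by case: x y => [? ?] [? ?]. Qed.

Lemma ImM (x y : R[i]) : complex.Im (x * y) =
  complex.Re x * complex.Im y + complex.Im x * complex.Re y.
Proof. by case: x y => [a b] [c d] /=; ring. Qed.

Lemma ReD (x y : R[i]) : complex.Re (x + y) = complex.Re x + complex.Re y.
Proof. by case: x y => [? ?] [? ?]. Qed.

Lemma ImD (x y : R[i]) : complex.Im (x + y) = complex.Im x + complex.Im y.
Proof. by case: x y => [? ?] [? ?]. Qed.

Lemma cder_cst c t : cder (fun=> c) t 0.
Proof. by split; exact: is_derive_cst. Qed.

Lemma cderD F G t d e : cder F t d -> cder G t e -> cder (fun x => F x + G x) t (d + e).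
Proof.
move=> [f1 f2] [g1 g2]; split.
  by under eq_fun do rewrite ReD; rewrite ReD; exact: is_deriveD.
by under eq_fun do rewrite ImD; rewrite ImD; exact: is_deriveD.
Qed.

Lemma cderM F G t d e : cder F t d -> cder G t e ->
  cder (fun x => F x * G x) t (d * G t + F t * e).
Proof.
move=> [f1 f2] [g1 g2]; split.
  under eq_fun do rewrite ReM; apply: is_derive_eq.
  by rewrite ReD !ReM /GRing.scale/=; ring.
under eq_fun do rewrite ImM; apply: is_derive_eq.
by rewrite ImD !ImM /GRing.scale/=; ring.
Qed.

Lemma cderZ (c : R[i]) F t d : cder F t d -> cder (fun x => c * F x) t (c * d).
Proof. by move=> h; apply: (cder_eq (cderM (cder_cst c t) h)); rewrite mul0r add0r. Qed.

Lemma cder_sum (I : Type) (s : seq I) (F : I -> R -> R[i]) t (d : I -> R[i]) :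
  (forall i, cder (F i) t (d i)) ->
  cder (fun x => \sum_(i <- s) F i x) t (\sum_(i <- s) d i).
Proof.
move=> h; elim: s => [|i s ih].
  by rewrite big_nil; under eq_fun do rewrite big_nil; exact: cder_cst.
by rewrite big_cons; under eq_fun do rewrite big_cons; exact: cderD.
Qed.

Lemma cder_prod (I : eqType) (s : seq I) (F : I -> R -> R[i]) t (d : I -> R[i]) :
  uniq s -> (forall i, cder (F i) t (d i)) ->
  cder (fun x => \prod_(i <- s) F i x) t
    (\sum_(j <- s) \prod_(i <- s) (if i == j then d i else F i t)).
Proof.
move=> us h; elim: s us => [|x s ih] /=.
  by rewrite big_nil; under eq_fun do rewrite big_nil; move=> _; exact: cder_cst.
move=> /andP[xs us]; under eq_fun do rewrite big_cons.
apply: (cder_eq (cderM (h x) (ih us))); rewrite big_cons; congr (_ + _).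
  rewrite big_cons eqxx; congr (_ * _); rewrite big_seq [RHS]big_seq; apply: eq_bigr => i is_.
  by case: eqP => // e; rewrite -e is_ in xs.
rewrite big_distrr/= big_seq [RHS]big_seq; apply: eq_bigr => j js.
rewrite big_cons; case: eqP => // e; by rewrite e js in xs.
Qed.

(** The scalar mean value inequality for the projection of [F] on the direction
    of the increment [F b - F a]. *)
Lemma cder_mvt F (dF : R -> R[i]) (m dm : R -> R) (a b : R) : a <= b ->
  (forall x, a <= x <= b -> cder F x (dF x)) ->
  (forall x, a <= x <= b -> is_derive x 1 m (dm x)) ->
  (forall x, a <= x <= b -> normc (dF x) <= dm x) ->
  normc (F b - F a) <= m b - m a.
Proof.
move=> ab hF hm le; set z := F b - F a; set r := normc z.
pose h x := complex.Re z * complex.Re (F x) + complex.Im z * complex.Im (F x).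
have hr : h b - h a = r * r.
  rewrite -expr2 /r normc_sqr /h /z; case: (F a) => x y; case: (F b) => u v /=; ring.
(* [h] is [r] times the projection on the direction of [z]. *)
have [r0|r0] := eqVneq r 0.
  rewrite r0 subr_ge0; apply: (le_of_deriv_closed ab hm) => x /andP[ax xb].
  by apply: le_trans (le x _); rewrite ?normc_ge0// !ltW.
have rp : 0 < r by rewrite lt_neqAle eq_sym r0 normc_ge0.
rewrite -(ler_pM2l rp) -hr.
suff : r * m a - h a <= r * m b - h b by rewrite mulrBr; lra.
apply: (@le_of_deriv_closed R (fun x => r * m x - h x) (fun x => r * dm x -
  (complex.Re z * complex.Re (dF x) + complex.Im z * complex.Im (dF x))) a b ab).
  move=> x xab; have [f1 f2] := hF x xab; have f3 := hm x xab.
  by rewrite /h; apply: is_derive_eq.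
move=> x /andP[ax xb]; rewrite subr_ge0.
have xab : a <= x <= b by rewrite !ltW.
apply: (le_trans _ (ler_wpM2l (ltW rp) (le x xab))); rewrite /r.
apply: (le_trans (ler_norm _)).
rewrite -(@ler_pXn2r _ 2)// ?nnegrE ?mulr_ge0 ?normc_ge0// exprMn !normc_sqr.
rewrite -normrX ger0_norm ?sqr_ge0//.
case: (z) => u v; case: (dF x) => p q /=.
by rewrite -subr_ge0 [leRHS](_ : _ = (u * q - v * p) ^+ 2) ?sqr_ge0//; ring.
Qed.

End complex_derivative.

Section evolution_kernel.
Context {R : realType}.
Local Notation J := (@besselJ R).

Definition propagator1 (k : int) (t : R) : R[i] := 'i ^ k * (J k t)%:C.

Lemma i_neq0 : 'i != 0 :> R[i].
Proof. by rewrite eq_complex/= oner_eq0 andbF. Qed.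

Lemma i_sqr : 'i * 'i = -1 :> R[i].
Proof. by rewrite -expr2 sqr_i. Qed.

Lemma normc_iexp (k : int) : normc ('i ^ k : R[i]) = 1.
Proof.
have i1 : normc ('i : R[i]) = 1 by rewrite /normc/= expr0n/= add0r expr1n sqrtr1.
have iX n : normc ('i ^+ n : R[i]) = 1.
  by elim: n => [|n ih]; rewrite ?expr0 ?normc1// exprS normcM i1 ih mulr1.
by case: k => n; rewrite ?NegzE -?exprnP ?exprnN -?exprnN//= ?normcV iX ?invr1.
Qed.

Lemma normc_iM (z : R[i]) : normc ('i * z) = normc z.
Proof. by rewrite normcM -(expr1z 'i) normc_iexp mul1r. Qed.

Lemma propagator1_norm k t : normc (propagator1 k t) = `|J k t|.
Proof. by rewrite normcM normc_iexp mul1r normcR. Qed.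

(** The factors [i^k] turn the difference in [besselJ_deriv] into a sum of
    neighbours, that is, into [i L] in dimension one. *)
Lemma propagator1_deriv k (t : R) :
  cder (propagator1 k) t ('i * 2^-1 * (propagator1 (k + 1) t + propagator1 (k - 1) t)).
Proof.
have h : cder (fun t => (J k t)%:C) t ((J (k - 1) t - J (k + 1) t) / 2)%:C.
  by split => /=; [exact: besselJ_deriv | exact: is_derive_cst].
apply: (cder_eq (cderZ ('i ^ k) h)).
have halfC (a b : R) : ((a - b) / 2)%:C = (a%:C - b%:C) / 2 :> R[i].
  by rewrite rmorphM rmorphB fmorphV rmorph_nat.
rewrite /propagator1 !expfzDr ?i_neq0// expr1z halfC.
have -> : ('i : R[i]) ^ (-1) = - 'i.
  have -> : ('i : R[i]) ^ (-1) = 'i^-1 by [].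
  by apply: (mulfI i_neq0); rewrite divff ?i_neq0// mulrN i_sqr opprK.
have i2 := i_sqr; move: ('i ^ k) (J _ _)%:C (J _ _)%:C (2^-1 : R[i]) => u y x h2.
transitivity (h2 * u * (x - y)); first ring.
transitivity (h2 * u * (('i * 'i) * y - ('i * 'i) * x)); last ring.
by rewrite i2; ring.
Qed.

Lemma propagator1_0 k : propagator1 k 0 = (k == 0)%:R.
Proof. by rewrite /propagator1 besselJ0; case: eqP => [->|_]; rewrite ?mulr0// expr0z mul1r. Qed.

(** The kernel of [exp (i t L)]. *)
Definition propagator D (t : R) (n : 'rV[int]_D) : R[i] := \prod_(j < D) propagator1 (n 0 j) t.

(** [L] is the sum of the one-dimensional operators, so the product of the
    one-dimensional kernels solves the equation. *)
Lemma propagator_deriv D (n : 'rV[int]_D) (t : R) :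
  cder (fun t => propagator t n) t ('i * Lap (propagator t) n).
Proof.
have h := @cder_prod R _ (index_enum 'I_D) (fun j => propagator1 (n 0 j)) t _
  (index_enum_uniq _) (fun j => propagator1_deriv (n 0 j) t).
apply: (cder_eq h); rewrite /Lap mulrA mulr_sumr; apply: eq_bigr => j _.
have others (F G : 'I_D -> R[i]) : (forall i, i != j -> F i = G i) ->
    \prod_(i < D | i != j) F i = \prod_(i < D | i != j) G i.
  by move=> FG; exact: eq_bigr.
have eP : propagator t (n + delta_mx 0 j) = propagator1 (n 0 j + 1) t * \prod_(i < D | i != j) propagator1 (n 0 i) t.
  rewrite /propagator (bigD1 j)//= !mxE !eqxx; congr (_ * _); apply: others => i /negbTE ij.
  by rewrite !mxE ij andbF addr0.
have eM : propagator t (n - delta_mx 0 j) = propagator1 (n 0 j - 1) t * \prod_(i < D | i != j) propagator1 (n 0 i) t.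
  rewrite /propagator (bigD1 j)//= !mxE !eqxx; congr (_ * _); apply: others => i /negbTE ij.
  by rewrite !mxE ij andbF subr0.
rewrite eP eM (bigD1 j)//= eqxx (others _ (fun i => propagator1 (n 0 i) t)); last first.
  by move=> i /negbTE ->.
by rewrite -mulrDl mulrA.
Qed.

Lemma propagator_le1 D (n : 'rV[int]_D) (t : R) : normc (propagator t n) <= 1.
Proof.
rewrite /propagator; elim: (index_enum _) => [|j s ih]; first by rewrite big_nil normc1.
by rewrite big_cons normcM mulr_ile1 ?normc_ge0// propagator1_norm besselJ_le1.
Qed.

Lemma propagator_0 D (n : 'rV[int]_D) : propagator 0 n = (n == 0)%:R.
Proof.
rewrite /propagator; have [->|n0] := eqVneq n 0.
  by rewrite big1// => j _; rewrite propagator1_0 mxE eqxx.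
have [j nj] : exists j, n 0 j != 0.
  apply/existsP; apply: contraNT n0; rewrite negb_exists => /forallP h.
  by apply/eqP/rowP => j; rewrite !mxE; apply/eqP; rewrite -[_ == _]negbK h.
by rewrite (bigD1 j)//= propagator1_0 (negbTE nj) mul0r.
Qed.

Lemma propagator_row_mx p q (a : 'rV[int]_p) (b : 'rV[int]_q) (t : R) :
  propagator t (row_mx a b) = propagator t a * propagator t b.
Proof.
rewrite /propagator big_split_ord; congr (_ * _); apply: eq_bigr => j _.
  by rewrite row_mxEl.
by rewrite row_mxEr.
Qed.

End evolution_kernel.

(** * The evolution is a contraction *)

Section unitarity.
Context {R : realType} {D : nat}.
Local Notation T := 'rV[int]_D.

Lemma Lap_bound (f : T -> R[i]) (M : R) : (forall n, normc (f n) <= M) ->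
  forall n, normc (Lap f n) <= D%:R * M.
Proof.
move=> fM n; rewrite /Lap normcM.
have -> : normc (2^-1 : R[i]) = 2^-1.
  have -> : (2^-1 : R[i]) = (2^-1 : R)%:C by rewrite fmorphV rmorph_nat.
  by rewrite normcR gtr0_norm// invr_gt0.
rewrite ler_pdivrMl//; apply: (le_trans (normc_sum _ _)).
have -> : 2 * (D%:R * M) = \sum_(j < D) (2 * M).
  by rewrite sumr_const card_ord -mulr_natl; ring.
by apply: ler_sum => j _; apply: (le_trans (le_normcD _ _)); rewrite mulr_natl mulr2n lerD.
Qed.

Lemma LapD (f g : T -> R[i]) n : Lap (fun m => f m + g m) n = Lap f n + Lap g n.
Proof.
by rewrite /Lap -mulrDr -big_split/=; congr (2^-1 * _); apply: eq_bigr => j _; ring.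
Qed.

Lemma LapZ (c : R[i]) (f : T -> R[i]) n : Lap (fun m => c * f m) n = c * Lap f n.
Proof.
rewrite /Lap [RHS]mulrCA [c * _]mulr_sumr; congr (2^-1 * _); apply: eq_bigr => j _; by rewrite mulrDr.
Qed.

Lemma Lap_sum (I : Type) (s : seq I) (F : I -> T -> R[i]) n :
  Lap (fun m => \sum_(i <- s) F i m) n = \sum_(i <- s) Lap (F i) n.
Proof.
elim: s => [|i s ih].
  rewrite big_nil; under eq_fun do rewrite big_nil.
  by rewrite /Lap big1 ?mulr0// => j _; rewrite addr0.
by rewrite big_cons -ih -LapD; congr Lap; apply/funext => m; rewrite big_cons.
Qed.

Lemma Lap_translate (f : T -> R[i]) a n : Lap (fun m => f (m - a)) n = Lap f (n - a).
Proof.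
rewrite /Lap; congr (2^-1 * _); apply: eq_bigr => j _.
by rewrite addrAC [n - _ - a]addrAC.
Qed.

Lemma cder_lap (v : R -> T -> R[i]) (dv : T -> R[i]) (t : R) n :
  (forall n, cder (v ^~ n) t (dv n)) -> cder (fun t => Lap (v t) n) t (Lap dv n).
Proof.
move=> h; apply: cderZ; apply: cder_sum => j; exact: cderD.
Qed.

Variable v : R -> T -> R[i].
Hypothesis v_deriv : forall (t : R) n, cder (v ^~ n) t ('i * Lap (v t) n).
Variable M : R.
Hypothesis v_bound : forall t n, normc (v t n) <= M.

Let M_ge0 : 0 <= M.
Proof. exact: le_trans (normc_ge0 _) (v_bound 0 0). Qed.

(** [v'' = - L (L v)] is bounded by [D^2 M]. *)
Let taylor t tau n : 0 <= tau ->
  normc (v (t + tau) n - (v t n + 'i * tau%:C * Lap (v t) n)) <= D%:R ^+ 2 * M * tau ^+ 2.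
Proof.
move=> tau0.
have lip (s : R) : t <= s <= t + tau ->
    normc ('i * Lap (v s) n - 'i * Lap (v t) n) <= D%:R ^+ 2 * M * tau.
  move=> /andP[ts st].
  have := @cder_mvt R (fun s => 'i * Lap (v s) n)
    (fun s => 'i * Lap (fun m => 'i * Lap (v s) m) n)
    (fun s => D%:R ^+ 2 * M * s) (fun=> D%:R ^+ 2 * M) t s ts.
  move=> h; apply: (le_trans (h _ _ _)).
  - by move=> x _; apply: cderZ; exact: cder_lap.
  - by move=> x _; apply: is_derive_eq; rewrite /GRing.scale/= mulr1.
  - move=> x _; rewrite normc_iM expr2 -mulrA; apply: Lap_bound => m.
    by rewrite normc_iM; exact: Lap_bound.
  - rewrite -mulrBr ler_wpM2l ?mulr_ge0 ?sqr_ge0//; lra.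
have tt : t <= t + tau by rewrite lerDl.
have := @cder_mvt R (fun s => v s n - s%:C * ('i * Lap (v t) n))
    (fun s => 'i * Lap (v s) n - 'i * Lap (v t) n)
    (fun s => D%:R ^+ 2 * M * tau * s) (fun=> D%:R ^+ 2 * M * tau) t (t + tau) tt.
move=> h; rewrite [X in normc X](_ : _ = v (t + tau) n - (t + tau)%:C * ('i * Lap (v t) n) -
   (v t n - t%:C * ('i * Lap (v t) n))); last by rewrite rmorphD; ring.
apply: (le_trans (h _ _ _)).
- move=> x _.
  have hx : cder (fun s => s%:C) x 1.
    by split => /=; [exact: is_derive_id|exact: is_derive_cst].
  have h1 := cderD (v_deriv x n) (cderZ (-1) (cderM hx (cder_cst ('i * Lap (v t) n) x))).
  have -> : (fun s => v s n - s%:C * ('i * Lap (v t) n)) =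
     (fun s => v s n + -1 * (s%:C * ('i * Lap (v t) n))).
    by apply/funext => s; rewrite mulN1r.
  by apply: (cder_eq h1); rewrite mul1r mulr0 addr0 mulN1r.
- by move=> x _; apply: is_derive_eq; rewrite /GRing.scale/= mulr1.
- exact: lip.
- by rewrite -mulrBr [_ - t]addrAC subrr add0r expr2 !mulrA.
Qed.

Let euler (tau : R) (j : nat) : T -> R[i] :=
  iter j (fun f n => f n + 'i * tau%:C * Lap f n) (v 0).

Let euler_err tau j : 0 <= tau -> forall n,
  normc (euler tau j n - v (j%:R * tau) n) <=
  j%:R * (D%:R ^+ 2 * M * tau ^+ 2) * (1 + tau * D%:R) ^+ j.
Proof.
move=> tau0; set K := D%:R ^+ 2 * M * tau ^+ 2.
have K0 : 0 <= K by rewrite !mulr_ge0 ?sqr_ge0 ?M_ge0.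
set r := 1 + tau * D%:R; have r1 : 1 <= r by rewrite lerDl mulr_ge0.
elim: j => [|j ih] n; first by rewrite /euler/= !mul0r subrr normc0.
have -> : j.+1%:R * tau = j%:R * tau + tau by rewrite -natr1 mulrDl mul1r.
rewrite /euler iterS -/(euler tau j).
set f := euler tau j; set u := v (j%:R * tau).
pose e m := f m + -1 * u m.
have -> : f n + 'i * tau%:C * Lap f n - v (j%:R * tau + tau) n =
   e n + 'i * (tau%:C * Lap e n) - (v (j%:R * tau + tau) n - (u n + 'i * tau%:C * Lap u n)).
  by rewrite /e LapD LapZ; ring.
have eb m : normc (e m) <= j%:R * K * r ^+ j by rewrite /e mulN1r; exact: ih.
apply: (le_trans (le_normcD _ _)); rewrite normcN.
apply: (@le_trans _ _ ((j%:R * K * r ^+ j) * r + K)).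
  apply: lerD; last exact: taylor.
  apply: (le_trans (le_normcD _ _)); rewrite normc_iM normcM normcR ger0_norm//.
  rewrite /r mulrDr mulr1 lerD//.
  rewrite [leRHS](_ : _ = tau * (D%:R * (j%:R * K * r ^+ j))); last by rewrite /r; ring.
  by rewrite ler_wpM2l//; exact: Lap_bound.
have rj : 1 <= r ^+ j.+1 by exact: exprn_ege1.
rewrite -mulrA -exprSr -natr1 [X in _ <= X * _]mulrDl mul1r mulrDl lerD2l.
by rewrite ler_peMr.
Qed.

Let euler_sqb tau j c : sqb (v 0) c -> sqb (euler tau j) ((1 + tau ^+ 2 * D%:R ^+ 2) ^+ j * c).
Proof.
move=> h; elim: j => [|j ih]; first by rewrite expr0 mul1r.
move=> s us; have := @sqb_schrodinger R D _ _ 1 tau ih s us.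
rewrite expr1n [in X in _ -> X]exprS -[in X in _ -> X]mulrA => hh; apply: le_trans hh.
by rewrite /euler iterS; apply: nq_le => n _; rewrite rmorph1 mul1r.
Qed.

Let gap N c t (s : seq T) : 0 <= t -> sqb (v 0) c -> uniq s ->
  nq s (v t) <= c + (c * (t ^+ 2 * D%:R ^+ 2 * expR (t ^+ 2 * D%:R ^+ 2)) +
     (size s)%:R * (2 * M * (D%:R ^+ 2 * M * t ^+ 2 * expR (t * D%:R)))) / N.+1%:R.
Proof.
move=> t0 h us; have c0 := sqb_ge0 h.
set y := t ^+ 2 * D%:R ^+ 2; have y0 : 0 <= y by rewrite mulr_ge0 ?sqr_ge0.
set K := D%:R ^+ 2 * M * t ^+ 2 * expR (t * D%:R).
have N0 : 0 < N.+1%:R :> R by rewrite ltr0n.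
have Nn : N.+1%:R != 0 :> R by rewrite gt_eqF.
have N1 : 1 <= N.+1%:R :> R by rewrite ler1n.
set tau := t / N.+1%:R; have tau0 : 0 <= tau by rewrite divr_ge0// ltW.
have eN : N.+1%:R * tau = t by rewrite /tau mulrC divfK.
have powle (x : R) : 0 <= x -> (1 + x / N.+1%:R) ^+ N.+1 <= expR x.
  move=> x0; have -> : expR x = expR (x / N.+1%:R) ^+ N.+1.
    by rewrite -expRM_natl mulrC divfK.
  rewrite ler_pXn2r ?nnegrE ?expR_ge0 ?addr_ge0 ?divr_ge0 ?(ltW N0)//.
  exact: expR_ge1Dx.
have e1 n : normc (euler tau N.+1 n - v t n) <= K / N.+1%:R.
  have := euler_err N.+1 tau0 n; rewrite eN => /le_trans; apply.
  have -> : 1 + tau * D%:R = 1 + (t * D%:R) / N.+1%:R by rewrite /tau; field.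
  rewrite /K [leRHS]mulrAC -[X in X * _ <= _](_ : D%:R ^+ 2 * M * t ^+ 2 / N.+1%:R = _); last first.
    by rewrite /tau; field.
  by rewrite ler_wpM2l ?powle ?mulr_ge0 ?divr_ge0 ?sqr_ge0 ?(ltW N0) ?invr_ge0.
have e2 : nq s (euler tau N.+1) <= c + c * (y * expR y) / N.+1%:R.
  apply: (le_trans (euler_sqb tau N.+1 h us)).
  have z0 : 0 <= y / N.+1%:R by rewrite divr_ge0// ltW.
  have -> : 1 + tau ^+ 2 * D%:R ^+ 2 = 1 + y / N.+1%:R / N.+1%:R by rewrite /tau /y; field.
  rewrite mulrC [leRHS](_ : _ = c * (1 + y * expR y / N.+1%:R)); last first.
    by rewrite mulrDr mulr1 !mulrA.
  rewrite ler_wpM2l//.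
  apply: (le_trans (powle _ z0)).
  (* [exp u <= 1 + u exp u] is [exp (- u) >= 1 - u]. *)
  have ez : expR (y / N.+1%:R) <= 1 + y / N.+1%:R * expR (y / N.+1%:R).
    have := expR_ge1Dx (- (y / N.+1%:R)); rewrite expRN.
    rewrite -(ler_pM2l (expR_gt0 (y / N.+1%:R))) divff ?gt_eqF ?expR_gt0//.
    set E := expR (y / N.+1%:R); set u := y / N.+1%:R; lra.
  apply: (le_trans ez); rewrite lerD2l mulrAC ler_wpM2r ?invr_ge0 ?(ltW N0)//.
  rewrite ler_wpM2l// ler_expR ler_pdivrMr// ler_peMr//.
have pw n : normc (v t n) ^+ 2 <= normc (euler tau N.+1 n) ^+ 2 + 2 * M * (K / N.+1%:R).
  have := e1 n; set f := euler _ _ n; set u := v t n => le.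
  have tri : normc u <= normc f + K / N.+1%:R.
    have -> : u = f - (f - u) by rewrite subKr.
    by apply: (le_trans (le_normcD _ _)); rewrite normcN lerD2l.
  have := v_bound t n; rewrite -/u; have := normc_ge0 u; have := normc_ge0 f.
  have := normc_ge0 (f - u).
  move: (normc u) (normc f) (K / _) (normc (f - u)) tri le => a b k g tri gk g0 b0 a0 aM.
  have k0 := le_trans g0 gk; have [ab|/ltW ba] := leP a b.
    have : a ^+ 2 <= b ^+ 2 by rewrite ler_pXn2r ?nnegrE.
    have : 0 <= M * k by rewrite mulr_ge0// (le_trans a0).
    lra.
  have h1 : (a - b) * (a + b) <= k * (2 * M).
    apply: ler_pM; rewrite ?subr_ge0 ?addr_ge0//; lra.
  lra.
apply: (@le_trans _ _ (nq s (euler tau N.+1) + (size s)%:R * (2 * M * (K / N.+1%:R)))).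
  have -> : (size s)%:R * (2 * M * (K / N.+1%:R)) = \sum_(n <- s) (2 * M * (K / N.+1%:R)).
    by rewrite big_const_seq count_predT iter_addr addr0 mulr_natl.
  by rewrite /nq -big_split/=; apply: ler_sum => n _; exact: pw.
rewrite [leRHS](_ : _ = c + c * (y * expR y) / N.+1%:R +
  (size s)%:R * (2 * M * (K / N.+1%:R))); last by field.
exact: lerD.
Qed.

(** The Euler polygon [(1 + i (t / N) L)^N] has norm at most
    [(1 + t^2 D^2 / N^2)^(N / 2)] by [sqb_schrodinger], which tends to [1], and it
    converges pointwise to the solution because the solution is bounded.  So the
    bound passes to the limit on each finite set. *)
Lemma evolution_contraction c t : 0 <= t -> sqb (v 0) c -> sqb (v t) c.
Proof.
move=> t0 h s us; apply/ler_addgt0Pr => e e0.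
set K := c * (t ^+ 2 * D%:R ^+ 2 * expR (t ^+ 2 * D%:R ^+ 2)) +
     (size s)%:R * (2 * M * (D%:R ^+ 2 * M * t ^+ 2 * expR (t * D%:R))).
have := @gap (Num.Def.trunc (K / e)) c t s t0 h us; rewrite -/K => /le_trans; apply.
rewrite lerD2l ler_pdivrMr ?ltr0n// -ler_pdivrMl// mulrC.
exact: ltW (truncnS_gt _).
Qed.

End unitarity.

(** * Finite sections of the evolution and product sets *)

Section kernel_bounds.
Context {R : realType}.

(** [exp (i t L)] applied to the restriction of [phi] to [s]. *)
Definition evolve D (s : seq 'rV[int]_D) (phi : 'rV[int]_D -> R[i]) (t : R) n : R[i] :=
  \sum_(m <- s) propagator t (n - m) * phi m.

Lemma evolve_deriv D (s : seq 'rV[int]_D) phi (t : R) n :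
  cder (fun t => evolve s phi t n) t ('i * Lap (evolve s phi t) n).
Proof.
have h : cder (fun t => evolve s phi t n) t
    (\sum_(m <- s) phi m * ('i * Lap (propagator t) (n - m))).
  have -> : (fun t => evolve s phi t n) = (fun t => \sum_(m <- s) phi m * propagator t (n - m)).
    by apply/funext => x; apply: eq_bigr => m _; rewrite mulrC.
  apply: cder_sum => m; apply: cderZ; exact: propagator_deriv.
apply: (cder_eq h); rewrite /evolve Lap_sum mulr_sumr; apply: eq_bigr => m _.
rewrite mulrCA; congr ('i * _).
rewrite -Lap_translate -LapZ; congr Lap; apply/funext => k; exact: mulrC.
Qed.

Lemma evolve_0 D (s : seq 'rV[int]_D) phi n : uniq s ->
  evolve s phi 0 n = if n \in s then phi n else 0.
Proof.
move=> us; rewrite /evolve; case: ifPn => ns; last first.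
  rewrite big_seq big1// => m ms; rewrite propagator_0 subr_eq0.
  by case: eqP => [e|_]; rewrite ?mul0r//; rewrite e ms in ns.
rewrite (bigD1_seq n)//= subrr propagator_0 eqxx mul1r big1 ?addr0// => m mn.
by rewrite propagator_0 subr_eq0 eq_sym (negbTE mn) mul0r.
Qed.

Lemma evolve_contraction D (s s' : seq 'rV[int]_D) phi (t : R) : 0 <= t ->
  uniq s -> uniq s' -> nrm s' (evolve s phi t) <= nrm s phi.
Proof.
move=> t0 us us'; rewrite /nrm ler_wsqrtr//.
have b t' n : normc (evolve s phi t' n) <= \sum_(m <- s) normc (phi m).
  apply: (le_trans (normc_sum _ _)); apply: ler_sum => m _.
  by rewrite normcM ler_piMl ?normc_ge0// propagator_le1.
apply: (evolution_contraction (evolve_deriv s phi) b t0) => // s'' us''.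
rewrite /nq; under eq_bigr do rewrite evolve_0//.
rewrite [leLHS](_ : _ = \sum_(x <- [seq x <- s'' | x \in s]) normc (phi x) ^+ 2).
  apply: sum_sub_le; rewrite ?filter_uniq// => x; first by rewrite mem_filter => /andP[].
  exact: sqr_ge0.
rewrite big_filter [RHS]big_mkcond/=; apply: eq_bigr => x _.
by case: ifP => // _; rewrite normc0 expr0n.
Qed.

(** The bilinear form of [exp (i t L)] between the restrictions of [F] and [G] to
    [S]. *)
Definition kform D (S : seq 'rV[int]_D) (t : R) (F G : 'rV[int]_D -> R[i]) : R[i] :=
  \sum_(n <- S) F n * evolve S G t n.

Lemma kform_le D (S : seq 'rV[int]_D) (t : R) F G : 0 <= t -> uniq S ->
  normc (kform S t F G) <= nrm S F * nrm S G.
Proof.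
move=> t0 us; apply: (le_trans (bilin_le _ _ _)).
by rewrite ler_wpM2l ?nrm_ge0// evolve_contraction.
Qed.

Lemma kformDl D (S : seq 'rV[int]_D) (t : R) F F' G :
  kform S t (fun n => F n + F' n) G = kform S t F G + kform S t F' G.
Proof. by rewrite /kform -big_split/=; apply: eq_bigr => n _; rewrite mulrDl. Qed.

Lemma kformDr D (S : seq 'rV[int]_D) (t : R) F G G' :
  kform S t F (fun n => G n + G' n) = kform S t F G + kform S t F G'.
Proof.
rewrite /kform -big_split/=; apply: eq_bigr => n _.
by rewrite -mulrDr /evolve -big_split/=; congr (_ * _); apply: eq_bigr => m _; rewrite mulrDr.
Qed.

Definition prodseq p q (s1 : seq 'rV[int]_p) (s2 : seq 'rV[int]_q) : seq 'rV[int]_(p + q) :=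
  [seq row_mx a b | a <- s1, b <- s2].

Lemma row_mx_inj p q (a a' : 'rV[int]_p) (b b' : 'rV[int]_q) :
  row_mx a b = row_mx a' b' -> a = a' /\ b = b'.
Proof. by move=> /eq_row_mx. Qed.

Lemma prodseq_uniq p q (s1 : seq 'rV[int]_p) (s2 : seq 'rV[int]_q) :
  uniq s1 -> uniq s2 -> uniq (prodseq s1 s2).
Proof.
by move=> u1 u2; apply: allpairs_uniq => // -[a b] [a' b'] _ _ /= /row_mx_inj[-> ->].
Qed.

Lemma mem_prodseq p q (s1 : seq 'rV[int]_p) (s2 : seq 'rV[int]_q) n :
  (n \in prodseq s1 s2) = (lsubmx n \in s1) && (rsubmx n \in s2).
Proof.
apply/allpairsP/andP => [[[a b] /= [as1 bs2 ->]]|[h1 h2]].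
  by rewrite row_mxKl row_mxKr.
by exists (lsubmx n, rsubmx n); rewrite /= hsubmxK.
Qed.

Lemma big_prodseq (V : nmodType) p q (s1 : seq 'rV[int]_p) (s2 : seq 'rV[int]_q)
  (F : 'rV[int]_(p + q) -> V) :
  \sum_(n <- prodseq s1 s2) F n = \sum_(a <- s1) \sum_(b <- s2) F (row_mx a b).
Proof. exact: big_allpairs_dep. Qed.

(** The kernel of the evolution is a product, so the form splits into blocks
    over the first group of coordinates. *)
Lemma kform_prodseq p q (s1 : seq 'rV[int]_p) (s2 : seq 'rV[int]_q) (t : R) F G :
  kform (prodseq s1 s2) t F G = \sum_(a <- s1) \sum_(a' <- s1)
    propagator t (a - a') * kform s2 t (fun b => F (row_mx a b)) (fun b => G (row_mx a' b)).
Proof.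
rewrite /kform big_prodseq; apply: eq_bigr => a _.
under [RHS]eq_bigr do rewrite mulr_sumr.
rewrite exchange_big/=; apply: eq_bigr => b _.
rewrite /evolve big_prodseq mulr_sumr; apply: eq_bigr => a' _.
rewrite [in RHS]mulrCA; congr (_ * _); rewrite mulr_sumr; apply: eq_bigr => b' _.
by rewrite opp_row_mx add_row_mx propagator_row_mx mulrA.
Qed.

Lemma nq_prodseq p q (s1 : seq 'rV[int]_p) (s2 : seq 'rV[int]_q) (F : _ -> R[i]) :
  nq (prodseq s1 s2) F = \sum_(a <- s1) nq s2 (fun b => F (row_mx a b)).
Proof. exact: big_prodseq. Qed.

Lemma nrm_prodseq p q (s1 : seq 'rV[int]_p) (s2 : seq 'rV[int]_q) (F : _ -> R[i]) :
  nrm (prodseq s1 s2) F =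
  Num.sqrt (\sum_(a <- s1) nrm s2 (fun b => F (row_mx a b)) ^+ 2).
Proof.
by rewrite /nrm nq_prodseq; congr Num.sqrt; apply: eq_bigr => a _; rewrite nrm_sqr.
Qed.

Lemma size_low (s : seq 'rV[int]_1) (N : nat) : uniq s ->
  (forall a, a \in s -> (`|a ord0 ord0| <= N)%N) -> (size s <= 2 * N + 1)%N.
Proof.
move=> us h; pose f (i : nat) : 'rV[int]_1 := const_mx (i%:Z - N%:Z).
rewrite -(size_iota 0 (2 * N + 1)) -(size_map f); apply: uniq_leq_size => // a /h aN.
have zP (z : int) : (absz z <= N)%N ->
    (absz (z + N%:Z)%R < 2 * N + 1)%N /\ z = (absz (z + N%:Z))%:Z - N%:Z by lia.
have [z1 z2] := zP _ aN.
apply/mapP; exists (absz (a ord0 ord0 + N%:Z)); first by rewrite mem_iota.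
by apply/rowP => j; rewrite mxE ord1.
Qed.

Definition rho1 (sg : R) (k : int) : R := (1 + k%:~R ^+ 2) `^ (- sg / 2).

Lemma rho1_le1 sg k : 0 <= sg -> rho1 sg k <= 1.
Proof.
move=> s0; rewrite -[leRHS](powRr0 (1 + k%:~R ^+ 2 : R)) /rho1 ler_powR ?lerDl ?sqr_ge0//.
by rewrite mulNr oppr_le0 divr_ge0.
Qed.

(** The weight is small at distance more than [N], which is measured by any
    [x <= N + 1] so that [N] can be the integer part of [x]. *)
Lemma rho1_high sg k (N : nat) (x : R) : 0 <= sg -> 0 < x -> x <= N.+1%:R ->
  (N < `|k|)%N -> rho1 sg k <= x `^ (- sg).
Proof.
move=> s0 x0 xN Nk; rewrite /rho1.
have -> : x `^ (- sg) = (x ^+ 2) `^ (- sg / 2).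
  by rewrite -powR_mulrn ?(ltW x0)// -powRrM; congr (_ `^ _); field.
rewrite !mulNr !powRN.
have kN : x ^+ 2 <= 1 + k%:~R ^+ 2.
  apply: (@le_trans _ _ (k%:~R ^+ 2)); last by rewrite lerDr.
  rewrite -[leRHS]real_normK ?num_real// ler_pXn2r ?nnegrE ?(ltW x0)//.
  by rewrite (le_trans xN)// -intr_norm -natr_absz ler_nat.
have p : 0 < 1 + k%:~R ^+ 2 :> R by rewrite ltr_wpDr ?sqr_ge0.
rewrite lef_pV2 ?posrE ?powR_gt0 ?exprn_gt0//.
by apply: ge0_ler_powR; rewrite ?nnegrE ?divr_ge0 ?exprn_ge0 ?(ltW p) ?(ltW x0).
Qed.

End kernel_bounds.

(** * Time decay between weights *)

Section weighted_decay.
Context {R : realType}.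

Lemma propagator_rV1_le (c : 'rV[int]_1) (t : R) : 0 <= t ->
  normc (propagator t c) <= 10 * (1 + t ^+ 2) `^ (- 12^-1).
Proof. by move=> t0; rewrite /propagator big_ord1 propagator1_norm besselJ_decay. Qed.

Lemma sum_support_le (I : eqType) (s : seq I) (p : pred I) (A : I -> R) (N : nat) :
  (forall i, ~~ p i -> A i = 0) -> (count p s <= N)%N ->
  \sum_(i <- s) A i <= Num.sqrt N%:R * Num.sqrt (\sum_(i <- s) A i ^+ 2).
Proof.
move=> A0 cN; rewrite (eq_bigr (fun i => (p i)%:R * A i)); last first.
  by move=> i _; case: (boolP (p i)) => [_|/A0 ->]; rewrite ?mul1r ?mulr0.
apply: (le_trans (sum_cauchy_schwarz _ _ _)).
rewrite ler_wpM2r ?sqrtr_ge0// ler_wsqrtr//.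
rewrite (eq_bigr (fun i => if p i then 1 else 0)); last first.
  by move=> i _; case: (p i); rewrite ?expr1n ?expr0n.
by rewrite -big_mkcond/= big_const_seq iter_addr addr0 ler_nat.
Qed.

(** Cut at height [N] in the first coordinate, with [N] the integer part of
    [x = (1 + t^2)^(1/24)].  As soon as one side is high, its weight gives
    [x^(-sg)] and the evolution is a contraction.  When both sides are low, the
    sum runs over at most [2 N + 1 <= 3 x] sites on each side, and the kernel in
    that coordinate is at most [10 (1 + t^2)^(-1/12) = 10 x^(-2)]: this gives
    [30 x^(-1)], which is at most [30 x^(-sg)]. *)
Lemma weighted_decay D (s1 : seq 'rV[int]_1) (s2 : seq 'rV[int]_D) (sg t : R)
    (F G f g : 'rV[int]_(1 + D) -> R[i]) :
  uniq s1 -> uniq s2 -> 0 <= sg -> sg <= 1 -> 0 <= t ->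
  (forall n, normc (F n) <= rho1 sg (lsubmx n ord0 ord0) * normc (f n)) ->
  (forall n, normc (G n) <= rho1 sg (lsubmx n ord0 ord0) * normc (g n)) ->
  normc (kform (prodseq s1 s2) t F G) <=
  32 * (1 + t ^+ 2) `^ (- (sg / 24)) * nrm (prodseq s1 s2) f * nrm (prodseq s1 s2) g.
Proof.
move=> u1 u2 sg0 sg1 t0 hF hG; set S := prodseq s1 s2.
have uS : uniq S by exact: prodseq_uniq.
have th1 : 1 <= 1 + t ^+ 2 by rewrite lerDl sqr_ge0.
have th0 : 0 < 1 + t ^+ 2 := lt_le_trans ltr01 th1.
set x := (1 + t ^+ 2) `^ (24^-1); have x0 : 0 < x by rewrite powR_gt0.
have x1 : 1 <= x by rewrite -(powRr0 (1 + t ^+ 2)) ler_powR// invr_ge0.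
set N := Num.Def.trunc x.
have xN : x <= N.+1%:R by exact: ltW (truncnS_gt _).
have Nx : N%:R <= x by rewrite truncn_le ltW.
have hx : (1 + t ^+ 2) `^ (- (sg / 24)) = x `^ (- sg).
  by rewrite (_ : - (sg / 24) = 24^-1 * - sg) ?powRrM//; field.
have x12 : (1 + t ^+ 2) `^ (- 12^-1) = x ^- 2.
  rewrite (_ : - 12^-1 = 24^-1 * - 2) ?powRrM; last by field.
  by rewrite powRN -/x powR_mulrn// ltW.
set h := x `^ (- sg); have h0 : 0 <= h by exact: powR_ge0.
pose low (n : 'rV[int]_(1 + D)) := (absz (lsubmx n ord0 ord0) <= N)%N.
pose lo (X : 'rV[int]_(1 + D) -> R[i]) n := if low n then X n else 0.
pose hi (X : 'rV[int]_(1 + D) -> R[i]) n := if low n then 0 else X n.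
have split_lohi X n : X n = lo X n + hi X n.
  by rewrite /lo /hi; case: (low n); rewrite ?addr0 ?add0r.
have nrm_full X y : (forall n, normc (X n) <= rho1 sg (lsubmx n ord0 ord0) * normc (y n)) ->
    nrm S X <= nrm S y.
  move=> hX; apply: nrm_le => n _; apply: (le_trans (hX n)).
  by rewrite ler_piMl ?normc_ge0// rho1_le1.
have nrm_lo X y : (forall n, normc (X n) <= rho1 sg (lsubmx n ord0 ord0) * normc (y n)) ->
    nrm S (lo X) <= nrm S y.
  move=> hX; apply: le_trans (nrm_full _ _ hX); apply: nrm_le => n _.
  by rewrite /lo; case: (low n); rewrite // normc0 normc_ge0.
have nrm_hi X y : (forall n, normc (X n) <= rho1 sg (lsubmx n ord0 ord0) * normc (y n)) ->
    nrm S (hi X) <= h * nrm S y.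
  move=> hX; have -> : h * nrm S y = nrm S (fun n => h%:C * y n).
    by rewrite nrmZ normcR ger0_norm.
  apply: nrm_le => n _; rewrite normcM normcR ger0_norm// /hi /low.
  case: leqP => nN; first by rewrite normc0 mulr_ge0 ?normc_ge0.
  apply: (le_trans (hX n)); rewrite ler_wpM2r ?normc_ge0//.
  exact: (rho1_high sg0 x0 xN).
(* Only the low-low term needs the decay of the kernel. *)
have -> : kform S t F G = kform S t (lo F) (lo G) + kform S t (lo F) (hi G) + kform S t (hi F) G.
  have eX X : (fun n => lo X n + hi X n) = X by apply/funext => n; rewrite -split_lohi.
  by rewrite -kformDr eX -kformDl eX.
have h1 : normc (kform S t (lo F) (hi G)) <= h * nrm S f * nrm S g.
  apply: (le_trans (kform_le _ _ t0 uS)).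
  rewrite [leRHS](_ : _ = nrm S f * (h * nrm S g)); last by ring.
  by apply: ler_pM; rewrite ?nrm_ge0 ?nrm_hi ?nrm_lo.
have h2 : normc (kform S t (hi F) G) <= h * nrm S f * nrm S g.
  by apply: (le_trans (kform_le _ _ t0 uS)); apply: ler_pM; rewrite ?nrm_ge0 ?nrm_hi ?nrm_full.
have h3 : normc (kform S t (lo F) (lo G)) <= 30 * h * nrm S f * nrm S g.
  pose A (X : 'rV[int]_(1 + D) -> R[i]) a := nrm s2 (fun b => lo X (row_mx a b)).
  have A_sum X y : (forall n, normc (X n) <= rho1 sg (lsubmx n ord0 ord0) * normc (y n)) ->
      \sum_(a <- s1) A X a <= Num.sqrt (3 * x) * nrm S y.
    move=> hX; pose p (a : 'rV[int]_1) := (absz (a ord0 ord0) <= N)%N.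
    have A0 a : ~~ p a -> A X a = 0.
      move=> pa; rewrite /A /nrm /nq big1 ?sqrtr0// => b _.
      by rewrite /lo /low row_mxKl -/(p a) (negbTE pa) normc0 expr0n.
    have cp : (count p s1 <= 2 * N + 1)%N.
      rewrite -size_filter; apply: size_low; first exact: filter_uniq.
      by move=> a; rewrite mem_filter => /andP[].
    apply: (le_trans (sum_support_le A0 cp)); apply: ler_pM; rewrite ?sqrtr_ge0//.
      by rewrite ler_wsqrtr// natrD natrM; lra.
    by rewrite -nrm_prodseq; exact: nrm_lo.
  rewrite kform_prodseq; apply: (le_trans (normc_sum _ _)).
  apply: (@le_trans _ _ (\sum_(a <- s1) \sum_(a' <- s1) 10 * x ^- 2 * (A F a * A G a'))).
    apply: ler_sum => a _; apply: (le_trans (normc_sum _ _)); apply: ler_sum => a' _.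
    rewrite normcM; apply: ler_pM; rewrite ?normc_ge0//.
      by rewrite -x12; exact: propagator_rV1_le.
    exact: kform_le.
  have -> : \sum_(a <- s1) \sum_(a' <- s1) 10 * x ^- 2 * (A F a * A G a') =
      10 * x ^- 2 * ((\sum_(a <- s1) A F a) * (\sum_(a <- s1) A G a)).
    rewrite mulr_suml mulr_sumr; apply: eq_bigr => a _.
    by rewrite !mulr_sumr.
  have sA0 X : 0 <= \sum_(a <- s1) A X a by apply: sumr_ge0 => a _; exact: nrm_ge0.
  apply: (@le_trans _ _ (10 * x ^- 2 * ((Num.sqrt (3 * x) * nrm S f) * (Num.sqrt (3 * x) * nrm S g)))).
    rewrite ler_wpM2l ?mulr_ge0 ?invr_ge0 ?exprn_ge0 ?(ltW x0)//.
    by apply: ler_pM => //; exact: A_sum.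
  have -> : 10 * x ^- 2 * ((Num.sqrt (3 * x) * nrm S f) * (Num.sqrt (3 * x) * nrm S g)) =
     30 * x^-1 * nrm S f * nrm S g.
    have sq3 : Num.sqrt (3 * x) * Num.sqrt (3 * x) = 3 * x.
      by rewrite -expr2 sqr_sqrtr// mulr_ge0// ltW.
    rewrite [LHS](_ : _ = 10 * x ^- 2 * (Num.sqrt (3 * x) * Num.sqrt (3 * x))
      * (nrm S f * nrm S g)); last by ring.
    by rewrite sq3; field; rewrite gt_eqF.
  rewrite !ler_wpM2r ?nrm_ge0// ler_wpM2l// /h -powR_inv1 ?(ltW x0)//.
  by rewrite ler_powR// lerN2.
apply: (le_trans (le_normcD _ _)); apply: (le_trans (lerD (le_normcD _ _) (lexx _))).
rewrite hx -/h.
apply: (le_trans (lerD (lerD h3 h1) h2)).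
by rewrite [leRHS](_ : _ = 30 * h * nrm S f * nrm S g + h * nrm S f * nrm S g + h * nrm S f * nrm S g)//; ring.
Qed.

End weighted_decay.

(** * Block bounds over the first two coordinates, and the exponential factor *)

Section outer_bound.
Context {R : realType}.
Local Notation J := (@besselJ R).
Variable D : nat.
Local Notation T := 'rV[int]_(2 + (1 + D)).

(** The only features of the weights that matter are a factor in the first two
    coordinates and a decay in the third. *)
Definition weight (sg : R) (q : 'rV[int]_2 -> R) (n : T) : R :=
  q (lsubmx n) * rho1 sg (lsubmx (rsubmx n) ord0 ord0).

Definition coord0 (a : 'rV[int]_2) : int := a ord0 ord0.
Definition coord1 (a : 'rV[int]_2) : int := a ord0 (@Ordinal 2 1 isT).

Lemma propagator_rV2 (a : 'rV[int]_2) (t : R) : normc (propagator t a) = `|J (coord0 a) t| * `|J (coord1 a) t|.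
Proof.
rewrite /propagator big_ord_recl big_ord1 normcM !propagator1_norm /coord0 /coord1.
by congr (`|J (a _ _) t| * `|J (a _ _) t|); apply: val_inj.
Qed.

Lemma kform_outer (s0 : seq 'rV[int]_2) (s1 : seq 'rV[int]_1) (s2 : seq 'rV[int]_D)
    (sg t : R) (q : 'rV[int]_2 -> R) (F G f g : T -> R[i]) :
  uniq s0 -> uniq s1 -> uniq s2 -> 0 <= sg -> sg <= 1 -> 0 <= t -> (forall a, 0 <= q a) ->
  (forall n, normc (F n) <= weight sg q n * normc (f n)) ->
  (forall n, normc (G n) <= weight sg q n * normc (g n)) ->
  normc (kform (prodseq s0 (prodseq s1 s2)) t F G) <=
  32 * (1 + t ^+ 2) `^ (- (sg / 24)) * \sum_(a <- s0) \sum_(a' <- s0)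
   `|J (coord0 (a - a')) t| * `|J (coord1 (a - a')) t| *
   ((q a * nrm (prodseq s1 s2) (fun b => f (row_mx a b))) *
    (q a' * nrm (prodseq s1 s2) (fun b => g (row_mx a' b)))).
Proof.
move=> u0 u1 u2 sg0 sg1 t0 q0 hF hG.
rewrite kform_prodseq mulr_sumr; apply: (le_trans (normc_sum _ _)).
apply: ler_sum => a _; rewrite mulr_sumr; apply: (le_trans (normc_sum _ _)).
apply: ler_sum => a' _; rewrite normcM propagator_rV2 [leRHS]mulrCA.
rewrite ler_wpM2l ?mulr_ge0//.
have hw (X x : T -> R[i]) c : (forall n, normc (X n) <= weight sg q n * normc (x n)) ->
   forall n, normc (X (row_mx c n)) <= rho1 sg (lsubmx n ord0 ord0) * normc ((q c)%:C * x (row_mx c n)).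
  move=> h n; apply: (le_trans (h _)); rewrite /weight row_mxKl row_mxKr.
  by rewrite normcM normcR ger0_norm// mulrCA mulrA.
have := weighted_decay (s1 := s1) (s2 := s2) u1 u2 sg0 sg1 t0
  (hw _ _ a hF) (hw _ _ a' hG).
by rewrite !nrmZ !normcR !ger0_norm// -[leRHS]mulrA.
Qed.

(** The decay [(1 + t^2)^(-sg/24)] of the inner coordinates is spent half on the
    growth of [E] and half on the weight of [Jmass]. *)
Lemma kform_mass_le (s0 : seq 'rV[int]_2) (s1 : seq 'rV[int]_1) (s2 : seq 'rV[int]_D)
    (sg ga M t : R) (E : R[i]) (q : 'rV[int]_2 -> R) (F G f g : T -> R[i]) :
  uniq s0 -> uniq s1 -> uniq s2 -> 0 <= sg -> sg <= 1 -> 0 <= t -> (forall a, 0 <= q a) ->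
  (forall n, normc (F n) <= weight sg q n * normc (f n)) ->
  (forall n, normc (G n) <= weight sg q n * normc (g n)) ->
  ga <= sg / 48 -> 0 <= M -> normc E <= M * (1 + t ^+ 2) `^ ga ->
  normc (E * kform (prodseq s0 (prodseq s1 s2)) t F G) <=
  \sum_(a <- s0) \sum_(a' <- s0) 16 * M *
   ((q a * nrm (prodseq s1 s2) (fun b => f (row_mx a b))) *
    (q a' * nrm (prodseq s1 s2) (fun b => g (row_mx a' b)))) *
   (Jmass (sg / 48) (coord0 (a - a')) t + Jmass (sg / 48) (coord1 (a - a')) t).
Proof.
move=> u0 u1 u2 sg0 sg1 t0 q0 hF hG gs M0 hE.
have th1 : 1 <= 1 + t ^+ 2 by rewrite lerDl sqr_ge0.
have th0 : 0 < 1 + t ^+ 2 := lt_le_trans ltr01 th1.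
rewrite normcM; apply: (le_trans (ler_pM (normc_ge0 _) (normc_ge0 _) hE
  (kform_outer u0 u1 u2 sg0 sg1 t0 q0 hF hG))).
rewrite mulrA mulr_sumr; apply: ler_sum => a _; rewrite mulr_sumr; apply: ler_sum => a' _.
set X := (q a * _) * _; set j0 := J _ t; set j1 := J _ t.
have X0 : 0 <= X by rewrite !mulr_ge0 ?nrm_ge0.
set W := (1 + t ^+ 2) `^ (- (sg / 48)).
have hW : (1 + t ^+ 2) `^ ga * (1 + t ^+ 2) `^ (- (sg / 24)) <= W.
  rewrite -powRD; last by rewrite (gt_eqF th0) implybT.
  by rewrite ler_powR//; lra.
have W0 : 0 <= W by exact: powR_ge0.
have jj : `|j0| * `|j1| <= (j0 ^+ 2 + j1 ^+ 2) / 2.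
  have := sqr_ge0 (`|j0| - `|j1|).
  by rewrite sqrrB !real_normK ?num_real//; lra.
rewrite /Jmass -/j0 -/j1 -/W -mulrDl.
rewrite [leRHS](_ : _ = (32 * M * W) * (((j0 ^+ 2 + j1 ^+ 2) / 2) * X)); last by field.
apply: ler_pM; [by rewrite !mulr_ge0 ?powR_ge0|by apply: mulr_ge0 => //; exact: mulr_ge0| |].
  rewrite [leLHS](_ : _ = 32 * M * ((1 + t ^+ 2) `^ ga * (1 + t ^+ 2) `^ (- (sg / 24)))); last by ring.
  by rewrite ler_wpM2l// mulr_ge0.
by rewrite ler_wpM2r.
Qed.

End outer_bound.

Section wave.
Context {R : realType}.

(** [exp (i t Z)]. *)
Definition wave (Z : R[i]) (t : R) : R[i] :=
  (expR (- (complex.Im Z * t)) * cos (complex.Re Z * t))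
  +i* (expR (- (complex.Im Z * t)) * sin (complex.Re Z * t)).

Lemma wave0 Z : wave Z 0 = 1.
Proof. by rewrite /wave !mulr0 oppr0 expR0 cos0 sin0 mulr1 mulr0. Qed.

Lemma wave_deriv Z t : cder (wave Z) t ('i * Z * wave Z t).
Proof.
have he : is_derive t 1 (fun t : R => expR (- (complex.Im Z * t)))
   (- complex.Im Z * expR (- (complex.Im Z * t))).
  have h1 : is_derive t 1 (fun t : R => - (complex.Im Z * t)) (- complex.Im Z).
    by apply: is_derive_eq; rewrite /GRing.scale/= mulr1.
  have := is_derive1_comp (is_derive_expR _) h1; rewrite mulrC; exact.
have hl : is_derive t 1 (fun t : R => complex.Re Z * t) (complex.Re Z).
  by apply: is_derive_eq; rewrite /GRing.scale/= mulr1.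
have hc := cos_deriv_comp hl; have hs := sin_deriv_comp hl.
rewrite /wave; case: Z he hl hc hs => X Y /= he hl hc hs.
split => /=; apply: is_derive_eq; rewrite /GRing.scale/=; ring.
Qed.

Lemma wave_norm Z t : normc (wave Z t) = expR (- (complex.Im Z * t)).
Proof.
rewrite /normc /wave !exprMn -mulrDr cos2Dsin2 mulr1 sqrtr_sqr.
by rewrite ger0_norm ?expR_ge0.
Qed.

Lemma expR_lip (a b : R) : 0 <= a -> 0 <= b -> `|expR (- a) - expR (- b)| <= `|a - b|.
Proof.
wlog ab : a b / a <= b.
  move=> h a0 b0; have [ab|/ltW ba] := leP a b; first exact: h.
  by rewrite distrC (distrC a); exact: h.
move=> a0 b0; rewrite ger0_norm ?subr_ge0 ?ler_expR ?lerN2//.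
rewrite ler0_norm ?subr_le0// opprB.
have e : expR (- b) = expR (- a) * expR (- (b - a)) by rewrite -expRD; congr expR; ring.
have h := expR_ge1Dx (- (b - a)).
have ea1 : expR (- a) <= 1 by rewrite -expR0 ler_expR oppr_le0.
have ea0 := expR_ge0 (- a).
have ba : 0 <= b - a by rewrite subr_ge0.
rewrite e; move: (expR (- a)) (expR (- (b - a))) h ea1 ea0 => u v *.
nra.
Qed.

Lemma cos_lower (x : R) : 1 - x ^+ 2 / 2 <= cos x.
Proof.
have sin_le (y : R) : 0 <= y -> sin y <= y.
  move=> y0.
  have d (z : R) : is_derive z 1 (fun x : R => x - sin x) (1 - cos z) by exact: is_deriveB.
  have p (z : R) : 0 <= 1 - cos z by rewrite subr_ge0 cos_le1.
  have := le_of_deriv_closed y0 (fun z _ => d z) (fun z _ => p z).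
  by rewrite sin0 subr0 subr_ge0.
wlog x0 : x / 0 <= x.
  move=> h; have [/h//|/ltW x0] := leP 0 x.
  by rewrite -sqrrN -cosN; apply: h; rewrite oppr_ge0.
have d (z : R) : is_derive z 1 (fun x : R => cos x - (1 - x ^+ 2 / 2)) (z - sin z).
  by apply: is_derive_eq; rewrite /GRing.scale/=; field.
have p (z : R) : 0 < z < x -> 0 <= z - sin z.
  by move=> /andP[z0 _]; rewrite subr_ge0 sin_le// ltW.
have := le_of_deriv_closed x0 (fun z _ => d z) p.
by rewrite cos0 expr0n mul0r subr0 subrr subr_ge0.
Qed.

Lemma wave_lip Z Z1 (t : R) : 0 <= t -> 0 <= complex.Im Z -> 0 <= complex.Im Z1 ->
  normc (wave Z t - wave Z1 t) <= t * normc (Z - Z1).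
Proof.
move=> t0 y0 y1; rewrite -(@ler_pXn2r _ 2)// ?nnegrE ?mulr_ge0 ?normc_ge0//.
rewrite exprMn !normc_sqr /wave.
case: Z y0 => X Y /= y0; case: Z1 y1 => X1 Y1 /= y1.
have h1 := expR_lip (mulr_ge0 y0 t0) (mulr_ge0 y1 t0).
have h2 := cos_lower (X * t - X1 * t).
set a := expR _ in h1 *; set b := expR _ in h1 *.
have a1 : a <= 1 by rewrite -expR0 ler_expR oppr_le0 mulr_ge0.
have b1 : b <= 1 by rewrite -expR0 ler_expR oppr_le0 mulr_ge0.
have a0 : 0 <= a by exact: expR_ge0.
have b0 : 0 <= b by exact: expR_ge0.
have h1' : (a - b) ^+ 2 <= (Y * t - Y1 * t) ^+ 2.
  by rewrite -[leLHS]real_normK ?num_real// -[leRHS]real_normK ?num_real// ler_pXn2r ?nnegrE.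
have e : (a * cos (X * t) - b * cos (X1 * t)) ^+ 2 + (a * sin (X * t) - b * sin (X1 * t)) ^+ 2 =
   (a - b) ^+ 2 + 2 * (a * b) * (1 - cos (X * t - X1 * t)).
  rewrite cosB; have := cos2Dsin2 (X * t); have := cos2Dsin2 (X1 * t).
  move: (cos (X * t)) (sin (X * t)) (cos (X1 * t)) (sin (X1 * t)) => c s k l h3 h4.
  rewrite [LHS](_ : _ = a ^+ 2 * (c ^+ 2 + s ^+ 2) + b ^+ 2 * (k ^+ 2 + l ^+ 2) - 2 * (a * b) * (c * k + s * l)); last by ring.
  by rewrite h3 h4; ring.
rewrite e.
have ab1 : a * b <= 1 by rewrite mulr_ile1.
have h3 : 2 * (a * b) * (1 - cos (X * t - X1 * t)) <= (X * t - X1 * t) ^+ 2.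
  have c1 : 0 <= 1 - cos (X * t - X1 * t) by rewrite subr_ge0 cos_le1.
  apply: (@le_trans _ _ (2 * (1 - cos (X * t - X1 * t)))); last by lra.
  by rewrite -mulrA ler_wpM2l// ler_piMl.
rewrite [leRHS](_ : _ = (Y * t - Y1 * t) ^+ 2 + (X * t - X1 * t) ^+ 2); last by ring.
exact: lerD.
Qed.

(** The difference is at most [2] and at most [t |Z - Z1|], hence at most twice
    [(t |Z - Z1|)^g]. *)
Lemma wave_holder Z Z1 (t g : R) : 0 <= t -> 0 <= complex.Im Z -> 0 <= complex.Im Z1 ->
  0 < g -> g <= 1 ->
  normc (wave Z t - wave Z1 t) <= 2 * normc (Z - Z1) `^ g * (1 + t ^+ 2) `^ (g / 2).
Proof.
move=> t0 y0 y1 g0 g1; set r := normc (Z - Z1); have r0 : 0 <= r by exact: normc_ge0.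
have th1 : 1 <= 1 + t ^+ 2 by rewrite lerDl sqr_ge0.
have th0 : 0 <= 1 + t ^+ 2 by rewrite (le_trans ler01).
have w1 Z' : 0 <= complex.Im Z' -> normc (wave Z' t) <= 1.
  by move=> y; rewrite wave_norm -expR0 ler_expR oppr_le0 mulr_ge0.
have tg : t `^ g <= (1 + t ^+ 2) `^ (g / 2).
  rewrite (_ : t `^ g = (t ^+ 2) `^ (g / 2)); last first.
    by rewrite -powR_mulrn// -powRrM; congr (_ `^ _); field.
  by apply: ge0_ler_powR; rewrite ?nnegrE ?sqr_ge0 ?divr_ge0 ?(ltW g0) ?lerDr.
rewrite -mulrA; apply: (@le_trans _ _ (2 * (r * t) `^ g)); last first.
  by rewrite powRM// ler_wpM2l// ler_wpM2l ?powR_ge0.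
have [rt1|rt1] := leP (r * t) 1; last first.
  apply: (@le_trans _ _ 2).
    by apply: (le_trans (le_normcD _ _)); rewrite normcN; have := w1 _ y0; have := w1 _ y1; lra.
  rewrite -[leLHS]mulr1 ler_wpM2l// -(powRr0 (r * t)) ler_powR//; exact: ltW.
apply: (le_trans (wave_lip t0 y0 y1)); rewrite mulrC -/r.
have rt0 : 0 <= r * t by rewrite mulr_ge0.
have [->|rtn] := eqVneq (r * t) 0; first by rewrite mulr_ge0 ?powR_ge0.
have rtp : 0 < r * t by rewrite lt_neqAle eq_sym rtn.
apply: (@le_trans _ _ ((r * t) `^ g)); last by have := powR_ge0 (r * t) g; lra.
rewrite -[leLHS](powRr1 rt0); apply: ger_powR => //.
by rewrite rtp rt1.
Qed.

End wave.

(** * A priori bound for finitely supported solutions *)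

Section apriori.
Context {R : realType}.

Lemma le_of_forall_div (X B K : R) : (forall t : R, 0 < t -> X <= B + K / t) -> X <= B.
Proof.
move=> h; apply/ler_addgt0Pr => e e0; have [K0|K0] := leP K 0.
  by apply: (le_trans (h 1 ltr01)); rewrite divr1 lerD2l (le_trans K0)// ltW.
by have := h (K / e) (divr_gt0 K0 e0); rewrite invf_div mulrC divfK// gt_eqF.
Qed.

Lemma sum_shift (V : nmodType) (T : zmodType) (S : seq T) (F : T -> V) e : uniq S ->
  (forall m, F m != 0 -> m \in S /\ m - e \in S) ->
  \sum_(m <- S) F m = \sum_(m <- S) F (m + e).
Proof.
move=> uS h.
have nz (G : T -> V) : \sum_(m <- S) G m = \sum_(m <- S | G m != 0) G m.
  by rewrite [RHS]big_mkcond; apply: eq_bigr => m _; case: eqP.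
rewrite (nz F) (nz (fun m => F (m + e))) -big_filter -[RHS]big_filter.
rewrite -(big_map (fun m => m + e) predT F); apply: perm_big; apply: uniq_perm.
- exact: filter_uniq.
- by rewrite map_inj_uniq ?filter_uniq//; exact: addIr.
- move=> m; apply/idP/mapP.
    rewrite mem_filter => /andP[Fm mS]; exists (m - e); last by rewrite subrK.
    by rewrite mem_filter subrK Fm; have [] := h m Fm.
  move=> [k]; rewrite mem_filter => /andP[Fk kS] ->; rewrite mem_filter Fk.
  by have [] := h _ Fk.
Qed.

(** Summation by parts, without boundary terms because [S] contains the
    neighbours of the support of [w]. *)
Lemma Lap_evolve D (S : seq 'rV[int]_D) (w : 'rV[int]_D -> R[i]) (t : R) n : uniq S ->
  (forall m, w m != 0 -> m \in S /\
     forall j, m + delta_mx 0 j \in S /\ m - delta_mx 0 j \in S) ->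
  Lap (evolve S w t) n = evolve S (Lap w) t n.
Proof.
move=> uS hw; rewrite /Lap /evolve.
transitivity (\sum_(j < D) 2^-1 * (\sum_(m <- S) propagator t (n - m) * (w (m + delta_mx 0 j) + w (m - delta_mx 0 j)))); last first.
  rewrite [RHS](eq_bigr (fun m => \sum_(j < D) 2^-1 * (propagator t (n - m) *
      (w (m + delta_mx 0 j) + w (m - delta_mx 0 j))))); last first.
    by move=> m _; rewrite mulrCA !mulr_sumr.
  by rewrite exchange_big/=; apply: eq_bigr => j _; rewrite mulr_sumr.
rewrite mulr_sumr; apply: eq_bigr => j _; congr (2^-1 * _).
under [in RHS]eq_bigr do rewrite mulrDr.
rewrite big_split/=; set e := delta_mx 0 j; congr (_ + _).
  rewrite (@sum_shift _ _ S (fun m => propagator t (n + e - m) * w m) e uS).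
    by apply: eq_bigr => m _; rewrite opprD addrACA subrr addr0.
  move=> m; rewrite mulf_eq0 negb_or => /andP[_ /hw[mS /(_ j)[_ me]]]; by split.
rewrite (@sum_shift _ _ S (fun m => propagator t (n - e - m) * w m) (- e) uS).
  by apply: eq_bigr => m _; rewrite opprD opprK addrACA addNr addr0.
move=> m; rewrite mulf_eq0 negb_or => /andP[_ /hw[mS /(_ j)[me _]]]; rewrite opprK; by split.
Qed.

Lemma evolveD D (S : seq 'rV[int]_D) (f g : _ -> R[i]) t n :
  evolve S (fun m => f m + g m) t n = evolve S f t n + evolve S g t n.
Proof. by rewrite /evolve -big_split/=; apply: eq_bigr => m _; rewrite mulrDr. Qed.

Lemma evolveZ D (S : seq 'rV[int]_D) c (f : _ -> R[i]) t n :
  evolve S (fun m => c * f m) t n = c * evolve S f t n.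
Proof. by rewrite /evolve mulr_sumr; apply: eq_bigr => m _; rewrite mulrCA. Qed.

Lemma eq_evolve D (S : seq 'rV[int]_D) (f g : _ -> R[i]) t n : {in S, f =1 g} ->
  evolve S f t n = evolve S g t n.
Proof.
by move=> h; rewrite /evolve big_seq [RHS]big_seq; apply: eq_bigr => m mS; rewrite h.
Qed.

Variable D : nat.
Local Notation T := 'rV[int]_(2 + (1 + D)).
Variables (s0 : seq 'rV[int]_2) (s1 : seq 'rV[int]_1) (s2 : seq 'rV[int]_D).
Hypotheses (u0 : uniq s0) (u1 : uniq s1) (u2 : uniq s2).
Let S2 := prodseq s1 s2.
Let S := prodseq s0 S2.

Definition supported (w : T -> R[i]) : Prop := forall m, w m != 0 -> m \in S /\
     forall j, m + delta_mx 0 j \in S /\ m - delta_mx 0 j \in S.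

Let uS : uniq S.
Proof. by apply: prodseq_uniq => //; exact: prodseq_uniq. Qed.

Lemma wave_evolve_deriv (Z : R[i]) (w h : T -> R[i]) (t : R) n : supported w ->
  {in S, forall m, Lap w m + Z * w m = h m} ->
  cder (fun t => wave Z t * evolve S w t n) t ('i * (wave Z t * evolve S h t n)).
Proof.
move=> hw eh.
apply: (cder_eq (cderM (wave_deriv Z t) (evolve_deriv S w t n))).
rewrite Lap_evolve//.
have -> : evolve S h t n = evolve S (Lap w) t n + Z * evolve S w t n.
  by rewrite -evolveZ -evolveD; apply: eq_evolve => m mS; rewrite eh.
ring.
Qed.

Lemma sum_sq_CS (q : 'rV[int]_2 -> R) (f : T -> R[i]) (A : R) : 0 <= A ->
  \sum_(a <- s0) q a ^+ 2 <= A ->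
  \sum_(a <- s0) q a * nrm S2 (fun b => f (row_mx a b)) <= Num.sqrt A * nrm S f.
Proof.
move=> A0 hA; apply: (le_trans (sum_cauchy_schwarz _ _ _)).
by rewrite -nrm_prodseq ler_wpM2r ?nrm_ge0// ler_wsqrtr.
Qed.

(** [F] and [G] are the weighted test function and source.  The case [c = 1] is
    used for the difference of two resolvents, the case [c = 0], [w1 = 0] for a
    single one: in both, the sources of the two evolutions combine into
    [(wave Z - c wave Z1) G], to which [kform_mass_le] applies, while [err] and
    [err1] contribute their norms divided by [Im Z] and [Im Z1], from the integrals
    of [|wave Z|] and [|wave Z1|]. *)
Lemma apriori_finite (sg ga M A : R) (q : 'rV[int]_2 -> R) (Z Z1 c : R[i])
    (F G f g w w1 err err1 : T -> R[i]) :
  0 < sg -> sg <= 1 -> ga <= sg / 48 -> 0 <= M -> 0 <= A -> (forall a, 0 <= q a) ->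
  \sum_(a <- s0) q a ^+ 2 <= A ->
  (forall n, normc (F n) <= weight sg q n * normc (f n)) ->
  (forall n, normc (G n) <= weight sg q n * normc (g n)) ->
  0 < complex.Im Z -> 0 < complex.Im Z1 ->
  (forall t, 0 <= t -> normc (wave Z t - c * wave Z1 t) <= M * (1 + t ^+ 2) `^ ga) ->
  supported w -> supported w1 ->
  {in S, forall m, Lap w m + Z * w m = G m + err m} ->
  {in S, forall m, Lap w1 m + Z1 * w1 m = c * G m + err1 m} ->
  normc (\sum_(n <- S) F n * (w n - w1 n)) <=
  32 * M * mass_bound (sg / 48) * A * nrm S f * nrm S g
  + nrm S F * (nrm S err / complex.Im Z + nrm S err1 / complex.Im Z1).
Proof.
move=> sg0 sg1 gs M0 A0 q0 hA hF hG Z0 Z10 hE sw sw1 hw hw1.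
have e0 : 0 < sg / 48 by rewrite divr_gt0.
have [I [dI mI]] := @Jmass_prim R _ e0.
pose ph (t : R) : R[i] := \sum_(n <- S) F n * (wave Z t * evolve S w t n - wave Z1 t * evolve S w1 t n).
pose dph (t : R) : R[i] := \sum_(n <- S) F n * ('i * (wave Z t * evolve S (fun m => G m + err m) t n)
  - 'i * (wave Z1 t * evolve S (fun m => c * G m + err1 m) t n)).
have dphE (t : R) : cder ph t (dph t).
  apply: cder_sum => n; apply: cderZ.
  have h1 := wave_evolve_deriv t n sw hw; have h2 := wave_evolve_deriv t n sw1 hw1.
  have -> : (fun x => wave Z x * evolve S w x n - wave Z1 x * evolve S w1 x n) =
    (fun x => wave Z x * evolve S w x n + -1 * (wave Z1 x * evolve S w1 x n)).
    by apply/funext => x; rewrite mulN1r.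
  by apply: (cder_eq (cderD h1 (cderZ (-1) h2))); rewrite mulN1r.
pose X a a' := (q a * nrm S2 (fun b => f (row_mx a b))) * (q a' * nrm S2 (fun b => g (row_mx a' b))).
have X0 a a' : 0 <= X a a' by apply: mulr_ge0; rewrite mulr_ge0 ?nrm_ge0.
pose dm (t : R) := \sum_(a <- s0) \sum_(a' <- s0) 16 * M * X a a' *
   (Jmass (sg / 48) (coord0 (a - a')) t + Jmass (sg / 48) (coord1 (a - a')) t).
pose m (t : R) := \sum_(a <- s0) \sum_(a' <- s0) 16 * M * X a a' *
   (I (coord0 (a - a')) t + I (coord1 (a - a')) t).
have dmE (t : R) : 0 <= t -> is_derive t 1 m (dm t).
  move=> t0; rewrite /m /dm.
  have sumD (K : Type) (r : seq K) (F1 : K -> R -> R) (F2 : K -> R) :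
     (forall k, is_derive t 1 (F1 k) (F2 k)) ->
     is_derive t 1 (fun t => \sum_(k <- r) F1 k t) (\sum_(k <- r) F2 k).
    move=> h; elim: r => [|k r ih].
      by rewrite big_nil; under eq_fun do rewrite big_nil; exact: is_derive_cst.
    by rewrite big_cons; under eq_fun do rewrite big_cons; exact: is_deriveD.
  apply: (@sumD _ _ _ _) => a; apply: (@sumD _ _ _ _) => a'.
  have h1 := dI (coord0 (a - a')) t t0; have h2 := dI (coord1 (a - a')) t t0.
  exact: is_deriveZ (is_deriveD h1 h2).
pose er (y k t : R) := - (k / y) * expR (- (y * t)).
have erE (y k t : R) : 0 < y -> is_derive t 1 (er y k) (k * expR (- (y * t))).
  move=> y0.
  have h1 : is_derive t 1 (fun t : R => - (y * t)) (- y).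
    by apply: is_derive_eq; rewrite /GRing.scale/= mulr1.
  have h2 := is_deriveZ (- (k / y)) (is_derive1_comp (is_derive_expR _) h1).
  by apply: (is_derive_eq h2); rewrite /GRing.scale/=; field; rewrite gt_eqF.
set Y := complex.Im Z; set Y1 := complex.Im Z1.
set k := nrm S F * nrm S err; set k1 := nrm S F * nrm S err1.
have k0 : 0 <= k by rewrite mulr_ge0 ?nrm_ge0.
have k10 : 0 <= k1 by rewrite mulr_ge0 ?nrm_ge0.
have bound (t : R) : 0 <= t ->
    normc (dph t) <= dm t + (k * expR (- (Y * t)) + k1 * expR (- (Y1 * t))).
  move=> t0.
  have -> : dph t = 'i * ((wave Z t - c * wave Z1 t) * kform S t F G
     + (wave Z t * kform S t F err - wave Z1 t * kform S t F err1)).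
    rewrite /dph /kform !mulr_sumr -sumrB -big_split/= mulr_sumr.
    apply: eq_bigr => n _; rewrite !evolveD evolveZ; ring.
  rewrite normc_iM.
  apply: (le_trans (le_normcD _ _)); apply: lerD.
    by apply: (kform_mass_le (ga := ga)) => //; [exact: ltW|exact: hE].
  apply: (le_trans (le_normcD _ _)); rewrite normcN !normcM !wave_norm.
  by apply: lerD; rewrite mulrC ler_wpM2r ?expR_ge0 ?kform_le.
have ph0 : ph 0 = \sum_(n <- S) F n * (w n - w1 n).
  rewrite /ph big_seq [RHS]big_seq; apply: eq_bigr => n nS.
  by rewrite !wave0 !mul1r !evolve_0// nS.
rewrite -ph0.
have mbound (t : R) : 0 <= t -> m t - m 0 <= 32 * M * mass_bound (sg / 48) * A * nrm S f * nrm S g.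
  move=> t0.
  have -> : m t - m 0 = \sum_(a <- s0) \sum_(a' <- s0) 16 * M * X a a' *
   ((I (coord0 (a - a')) t - I (coord0 (a - a')) 0) + (I (coord1 (a - a')) t - I (coord1 (a - a')) 0)).
    rewrite /m -sumrB; apply: eq_bigr => a _; rewrite -sumrB; apply: eq_bigr => a' _; ring.
  have mb0 : 0 <= mass_bound (sg / 48).
    by rewrite /mass_bound !addr_ge0 ?divr_ge0 ?C0_ge0// mulr_ge0 ?powR_ge0// divr_ge0 ?C0_ge0 ?mulr_ge0// ltW.
  apply: (@le_trans _ _ (\sum_(a <- s0) \sum_(a' <- s0) 32 * M * mass_bound (sg / 48) * X a a')).
    apply: ler_sum => a _; apply: ler_sum => a' _.
    rewrite [leRHS](_ : _ = 16 * M * X a a' * (mass_bound (sg / 48) + mass_bound (sg / 48))); last by ring.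
    apply: ler_wpM2l; first by apply: mulr_ge0; [exact: mulr_ge0|exact: X0].
    by apply: lerD; exact: mI.
  have -> : \sum_(a <- s0) \sum_(a' <- s0) 32 * M * mass_bound (sg / 48) * X a a' =
     32 * M * mass_bound (sg / 48) *
     ((\sum_(a <- s0) q a * nrm S2 (fun b => f (row_mx a b))) *
      (\sum_(a <- s0) q a * nrm S2 (fun b => g (row_mx a b)))).
    rewrite mulr_suml mulr_sumr; apply: eq_bigr => a _.
    by rewrite !mulr_sumr.
  have -> : 32 * M * mass_bound (sg / 48) * A * nrm S f * nrm S g =
     32 * M * mass_bound (sg / 48) * ((Num.sqrt A * nrm S f) * (Num.sqrt A * nrm S g)).
    by rewrite -[in LHS](sqr_sqrtr A0); ring.
  rewrite ler_wpM2l ?mulr_ge0//; apply: ler_pM; rewrite ?sum_sq_CS//.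
    by apply: sumr_ge0 => a _; rewrite mulr_ge0 ?nrm_ge0.
  by apply: sumr_ge0 => a _; rewrite mulr_ge0 ?nrm_ge0.
(* [ph 0] is the sum to be bounded, and [ph t] is [O (1 / t)] because
   [exp (- x) <= 1 / x]. *)
pose K := nrm S F * (nrm S w / Y + nrm S w1 / Y1).
apply: (@le_of_forall_div _ _ K) => t t0.
have phT : normc (ph t) <= K / t.
  have -> : ph t = wave Z t * kform S t F w - wave Z1 t * kform S t F w1.
    rewrite /ph /kform !mulr_sumr -sumrB; apply: eq_bigr => n _; ring.
  apply: (le_trans (le_normcD _ _)); rewrite normcN !normcM !wave_norm.
  have ew y : 0 < y -> expR (- (y * t)) <= y^-1 / t.
    move=> y0; rewrite expRN -invfM mulrC lef_pV2 ?posrE ?expR_gt0 ?mulr_gt0// [_ * y]mulrC.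
    by have := expR_ge1Dx (y * t); lra.
  rewrite [leRHS](_ : _ = (Y^-1 / t) * (nrm S F * nrm S w) + (Y1^-1 / t) * (nrm S F * nrm S w1)); last first.
    by rewrite /K; ring.
  by apply: lerD; apply: ler_pM; rewrite ?expR_ge0 ?normc_ge0 ?ew ?kform_le// ltW.
have := @cder_mvt R ph dph (fun t => m t + (er Y k t + er Y1 k1 t))
  (fun t => dm t + (k * expR (- (Y * t)) + k1 * expR (- (Y1 * t)))) 0 t (ltW t0)
  (fun x _ => dphE x).
move=> mvt.
have {mvt} diff : normc (ph t - ph 0) <= (m t + (er Y k t + er Y1 k1 t)) - (m 0 + (er Y k 0 + er Y1 k1 0)).
  apply: mvt => x /andP[x0 _]; last exact: bound.
  apply: is_deriveD; first exact: dmE.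
  by apply: is_deriveD; exact: erE.
have er_le y j : 0 < y -> 0 <= j -> er y j t - er y j 0 <= j / y.
  move=> y0 j0; rewrite /er mulr0 oppr0 expR0 mulr1 opprK mulNr gerDr oppr_le0.
  by rewrite mulr_ge0 ?expR_ge0// divr_ge0// ltW.
have := er_le Y k Z0 k0; have := er_le Y1 k1 Z10 k10; have := mbound t (ltW t0).
have -> : nrm S F * (nrm S err / Y + nrm S err1 / Y1) = k / Y + k1 / Y1.
  by rewrite /k /k1; ring.
have tri : normc (ph 0) <= normc (ph t - ph 0) + normc (ph t).
  rewrite -{1}(subKr (ph t) (ph 0)) addrC; apply: (le_trans (le_normcD _ _)).
  by rewrite normcN.
move: diff tri phT; lra.
Qed.

End apriori.

(** * A priori bound for square-summable solutions *)

Section apriori_l2.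
Context {R : realType}.

(** Take a finite set whose partial sum is [e]-close to the supremum of the
    partial sums. *)
Lemma sqb_tail (T : eqType) (u : T -> R[i]) (c e : R) : sqb u c -> 0 < e ->
  exists2 S0 : seq T, uniq S0 &
    sqb (fun n => if n \in S0 then 0 else u n) e.
Proof.
move=> uc e0; pose E := [set nq s u | s in [set s | uniq s]].
have E0 : E !=set0 by exists (nq [::] u), [::].
have Eub : has_ubound E by exists c => _ [s us <-]; exact: uc.
have [_ [S0 uS0 <-] hS] := sup_adherent e0 (conj E0 Eub).
exists S0 => // s us.
pose s' := [seq x <- s | x \notin S0].
have us' : uniq (S0 ++ s').
  rewrite cat_uniq uS0 filter_uniq// andbT /=; apply/hasPn => x.
  by rewrite mem_filter => /andP[].
have : nq (S0 ++ s') u <= sup E by apply: sup_upper_bound; [split|exists (S0 ++ s')].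
have -> : nq s (fun n => if n \in S0 then 0 else u n) = nq s' u.
  rewrite /nq big_filter [RHS]big_mkcond/=; apply: eq_bigr => x _.
  by case: (x \in S0); rewrite ?normc0 ?expr0n.
rewrite /nq big_cat/= -/(nq S0 u) -/(nq s' u); lra.
Qed.

Lemma nrm_restrict (T : eqType) (s S : seq T) (f : T -> R[i]) : uniq s -> uniq S ->
  nrm S (fun n => if n \in s then f n else 0) <= nrm s f.
Proof.
move=> us uS; rewrite ler_wsqrtr// /nq.
rewrite [leLHS](_ : _ = \sum_(x <- [seq x <- S | x \in s]) normc (f x) ^+ 2).
  apply: sum_sub_le; rewrite ?filter_uniq// => x; first by rewrite mem_filter => /andP[].
  exact: sqr_ge0.
rewrite big_filter [RHS]big_mkcond/=; apply: eq_bigr => x _.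
by case: ifP => // _; rewrite normc0 expr0n.
Qed.

Lemma sqb_Lap D (v : 'rV[int]_D -> R[i]) c : sqb v c -> sqb (Lap v) (D%:R ^+ 2 * c).
Proof.
move=> vc s us; have := @sqb_schrodinger R D v c 0 1 vc s us.
rewrite expr0n/= add0r expr1n mul1r; apply: le_trans; apply: nq_le => n _.
by rewrite rmorph0 mul0r add0r rmorph1 mulr1 normc_iM.
Qed.

(** The cutoff to [X] commutes with [L] except at edges across the boundary of
    [X], and these edges do not meet [S0]. *)
Lemma Lap_commutator D (u : 'rV[int]_D -> R[i]) (S0 X : seq 'rV[int]_D) m :
  {subset S0 <= X} ->
  (forall n, n \in S0 -> forall j, n + delta_mx 0 j \in X /\ n - delta_mx 0 j \in X) ->
  normc (Lap (fun n => if n \in X then u n else 0) m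
         - (if m \in X then Lap u m else 0)) <=
  normc (Lap (fun n => (normc (if n \in S0 then 0 else u n))%:C) m).
Proof.
move=> SX nX.
pose chi n : R[i] := if n \in X then 1 else 0.
pose v n := if n \in S0 then 0 else u n.
have -> : Lap (fun n => if n \in X then u n else 0) m - (if m \in X then Lap u m else 0)
   = 2^-1 * \sum_(j < D) ((chi (m + delta_mx 0 j) - chi m) * u (m + delta_mx 0 j)
                      + (chi (m - delta_mx 0 j) - chi m) * u (m - delta_mx 0 j)).
  have -> : (if m \in X then Lap u m else 0) = chi m * Lap u m.
    by rewrite /chi; case: ifP; rewrite ?mul1r ?mul0r.
  rewrite /Lap [chi m * _]mulrCA -mulrBr; congr (2^-1 * _).
  rewrite mulr_sumr -sumrB; apply: eq_bigr => j _.
  have e n : (if n \in X then u n else 0) = chi n * u n.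
    by rewrite /chi; case: ifP; rewrite ?mul1r ?mul0r.
  by rewrite !e; ring.
have half : (2^-1 : R[i]) = (2^-1 : R)%:C by rewrite fmorphV rmorph_nat.
have chi_le n : (n \in S0 -> m \in X) -> normc ((chi n - chi m) * u n) <= normc (v n).
  move=> h; rewrite /v; case: ifP => nS.
    by rewrite /chi (SX _ nS) (h nS) subrr mul0r.
  rewrite normcM ler_piMl ?normc_ge0// /chi.
  by case: ifP => _; case: ifP => _; rewrite ?subrr ?subr0 ?sub0r ?normcN ?normc0 ?normc1.
have -> : Lap (fun n => (normc (v n))%:C) m =
   (2^-1 * \sum_(j < D) (normc (v (m + delta_mx 0 j)) + normc (v (m - delta_mx 0 j))))%:C.
  rewrite /Lap half rmorphM; congr (_ * _); rewrite rmorph_sum; apply: eq_bigr => j _.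
  by rewrite rmorphD.
rewrite normcR [leRHS]ger0_norm; last first.
  by rewrite mulr_ge0 ?invr_ge0// sumr_ge0// => j _; rewrite addr_ge0 ?normc_ge0.
rewrite half normcM normcR ger0_norm ?invr_ge0// ler_wpM2l ?invr_ge0//.
apply: (le_trans (normc_sum _ _)); apply: ler_sum => j _.
apply: (le_trans (le_normcD _ _)); apply: lerD; apply: chi_le => /nX /(_ j)[].
  by rewrite addrK.
by rewrite subrK.
Qed.

Definition nbrs D (s : seq 'rV[int]_D) : seq 'rV[int]_D :=
  s ++ [seq n + delta_mx 0 j | n <- s, j <- enum 'I_D]
    ++ [seq n - delta_mx 0 j | n <- s, j <- enum 'I_D].

Lemma mem_nbrs D (s : seq 'rV[int]_D) n : n \in s -> n \in nbrs s /\
  forall j, n + delta_mx 0 j \in nbrs s /\ n - delta_mx 0 j \in nbrs s.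
Proof.
move=> ns; split=> [|j]; first by rewrite mem_cat ns.
split; rewrite !mem_cat; apply/orP; right; apply/orP; [left|right].
  by apply/allpairsP; exists (n, j); rewrite /= mem_enum.
by apply/allpairsP; exists (n, j); rewrite /= mem_enum.
Qed.

Variable D : nat.
Local Notation T := 'rV[int]_(2 + (1 + D)).

(** For each [t], cut [u] and [u1] to the neighbours of a finite set outside of
    which their squared norm is at most [t^(-2)]; the commutator errors then have
    norm at most [Dm / t], and [t] tends to infinity. *)
Lemma apriori_form (sg ga M A : R) (q : 'rV[int]_2 -> R) (Z Z1 c : R[i])
    (Q phi u u1 psi : T -> R[i]) (cp cu cu1 : R) (s : seq T) :
  0 < sg -> sg <= 1 -> ga <= sg / 48 -> 0 <= M -> 0 <= A -> (forall a, 0 <= q a) ->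
  (forall s0, uniq s0 -> \sum_(a <- s0) q a ^+ 2 <= A) ->
  (forall n, normc (Q n) <= weight sg q n) ->
  0 < complex.Im Z -> 0 < complex.Im Z1 ->
  (forall t, 0 <= t -> normc (wave Z t - c * wave Z1 t) <= M * (1 + t ^+ 2) `^ ga) ->
  sqb phi cp -> sqb u cu -> sqb u1 cu1 ->
  (forall n, Lap u n + Z * u n = - 2 * (Q n * phi n)) ->
  (forall n, Lap u1 n + Z1 * u1 n = c * (- 2 * (Q n * phi n))) ->
  uniq s ->
  normc (\sum_(n <- s) psi n * (Q n * (u n - u1 n))) <=
  64 * M * mass_bound (sg / 48) * A * Num.sqrt cp * nrm s psi.
Proof.
move=> sg0 sg1 gs M0 A0 q0 hA hQ Z0 Z10 hE hp hu hu1 eu eu1 us.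
pose Dm : R := (2 + (1 + D))%:R.
set Y := complex.Im Z in Z0 *; set Y1 := complex.Im Z1 in Z10 *.
apply: (@le_of_forall_div R _ _ (nrm s (fun n => psi n * Q n) * (Dm / Y + Dm / Y1))) => t t0.
have eta0 : 0 < t ^- 2 by rewrite invr_gt0 exprn_gt0.
have [S1 uS1 tl] := sqb_tail hu eta0.
have [S2 uS2 tl1] := sqb_tail hu1 eta0.
pose S0 := S1 ++ S2.
(* The cutoff is to [X], which contains [s] so that the tested values are
   unchanged; [XX] contains the neighbours of the support of the cut functions,
   and [S] is a product set around it. *)
pose X := nbrs S0 ++ s.
pose XX := nbrs X.
pose s0 := undup [seq lsubmx n | n : T <- XX].
pose s1 := undup [seq lsubmx (rsubmx n) | n : T <- XX].
pose s2 := undup [seq rsubmx (rsubmx n) | n : T <- XX].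
pose S := prodseq s0 (prodseq s1 s2).
have us0 : uniq s0 by exact: undup_uniq.
have us1 : uniq s1 by exact: undup_uniq.
have us2 : uniq s2 by exact: undup_uniq.
have uS : uniq S by rewrite !prodseq_uniq.
have XS n : n \in XX -> n \in S.
  move=> nX; rewrite !mem_prodseq !mem_undup; apply/and3P; split.
  - exact: (map_f (fun n : T => lsubmx n)).
  - exact: (map_f (fun n : T => lsubmx (rsubmx n))).
  - exact: (map_f (fun n : T => rsubmx (rsubmx n))).
have S0X : {subset S0 <= X} by move=> n nS; rewrite mem_cat (mem_nbrs nS).1.
have S0n n : n \in S0 -> forall j, n + delta_mx 0 j \in X /\ n - delta_mx 0 j \in X.
  by move=> nS j; have [_ /(_ j)[h1 h2]] := mem_nbrs nS; split; rewrite mem_cat ?h1 ?h2.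
pose cut (v : T -> R[i]) n := if n \in X then v n else 0.
have cut_supp v : supported s0 s1 s2 (cut v).
  move=> m; rewrite /cut; case: ifP => [mX _|]; last by rewrite eqxx.
  have [h1 h2] := mem_nbrs mX; split; first exact: XS.
  by move=> j; have [h3 h4] := h2 j; split; exact: XS.
pose G n := cut (fun n => - 2 * (Q n * phi n)) n.
pose err (v : T -> R[i]) n := Lap (cut v) n - cut (Lap v) n.
have errE (v : T -> R[i]) (W k : R[i]) :
    (forall n, Lap v n + W * v n = k * (- 2 * (Q n * phi n))) ->
    {in S, forall m, Lap (cut v) m + W * cut v m = k * G m + err v m}.
  move=> h m _; rewrite /err /G /cut; have := h m.
  by case: ifP => _ hm; rewrite ?mulr0 ?addr0 ?add0r ?subr0// -hm; ring.
have err_le (v : T -> R[i]) Sv : {subset Sv <= S0} ->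
    sqb (fun n => if n \in Sv then 0 else v n) (t ^- 2) -> nrm S (err v) <= Dm / t.
  move=> SvS hv.
  have hv' : sqb (fun n => (normc (if n \in S0 then 0 else v n))%:C) (t ^- 2).
    move=> s' us'; apply: le_trans (hv s' us'); apply: nq_le => n _.
    rewrite normcR ger0_norm ?normc_ge0//.
    case: (boolP (n \in S0)) => nS; first by rewrite normc0 normc_ge0.
    by rewrite ifN//; apply: contra nS; exact: SvS.
  have := sqb_nrm (sqb_Lap hv') uS.
  rewrite sqrtrM ?sqr_ge0// sqrtr_sqr ger0_norm// -exprVn sqrtr_sqr ger0_norm ?invr_ge0 ?(ltW t0)//.
  by apply: le_trans; apply: nrm_le => n _; exact: Lap_commutator.
pose F n := if n \in s then psi n * Q n else 0.
pose f n := if n \in s then psi n else 0.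
have hF n : normc (F n) <= weight sg q n * normc (f n).
  rewrite /F /f; case: ifP => _; last by rewrite normc0 mulr0.
  by rewrite normcM mulrC ler_wpM2r ?normc_ge0.
have hG n : normc (G n) <= weight sg q n * normc (2 * phi n).
  rewrite /G /cut; case: ifP => _; last first.
    by rewrite normc0 mulr_ge0 ?normc_ge0// (le_trans _ (hQ n)) ?normc_ge0.
  rewrite mulNr normcN mulrCA normcM ler_wpM2r ?normc_ge0//.
have hw1 := errE u Z 1 (fun n => etrans (eu n) (esym (mul1r _))).
have {}hw1 : {in S, forall m, Lap (cut u) m + Z * cut u m = G m + err u m}.
  by move=> m mS; rewrite hw1// mul1r.
have := apriori_finite us0 us1 us2 sg0 sg1 gs M0 A0 q0 (hA _ us0) hF hG Z0 Z10 hE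
  (cut_supp u) (cut_supp u1) hw1 (errE u1 Z1 c eu1).
rewrite -/S -/Y -/Y1.
have -> : \sum_(n <- S) F n * (cut u n - cut u1 n) = \sum_(n <- s) psi n * (Q n * (u n - u1 n)).
  have pe : perm_eq [seq n <- S | n \in s] s.
    apply: uniq_perm => //; first exact: filter_uniq.
    move=> n; rewrite mem_filter; case: (boolP (n \in s)) => //= ns.
    apply: XS; rewrite /XX; apply: (mem_nbrs _).1; by rewrite mem_cat ns orbT.
  rewrite -(perm_big _ pe)/= big_filter [RHS]big_mkcond/=; apply: eq_bigr => n _.
  rewrite /F /cut; case: ifP => ns; last by rewrite mul0r.
  by rewrite mem_cat ns orbT mulrA.
have f_le : nrm S f <= nrm s psi by exact: nrm_restrict.
have F_le : nrm S F <= nrm s (fun n => psi n * Q n) by exact: nrm_restrict.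
have g_le : nrm S (fun n => 2 * phi n) <= 2 * Num.sqrt cp.
  rewrite nrmZ -(rmorph_nat (real_complex R)) normcR ger0_norm//.
  by rewrite ler_wpM2l//; exact: sqb_nrm.
have e_le : nrm S (err u) <= Dm / t.
  by apply: err_le tl => n nS; rewrite mem_cat nS.
have e1_le : nrm S (err u1) <= Dm / t.
  by apply: err_le tl1 => n nS; rewrite mem_cat nS orbT.
move=> h; apply: (le_trans h); apply: lerD.
  have mb0 : 0 <= mass_bound (sg / 48).
    by rewrite mass_bound_ge0// divr_ge0// ltW.
  rewrite [leRHS](_ : _ = 32 * M * mass_bound (sg / 48) * A * nrm s psi * (2 * Num.sqrt cp)); last by ring.
  apply: ler_pM; rewrite ?mulr_ge0 ?nrm_ge0//.
  by rewrite ler_wpM2l// !mulr_ge0.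
rewrite [leRHS](_ : _ = nrm s (fun n => psi n * Q n) * ((Dm / t) / Y + (Dm / t) / Y1)); last by ring.
have Yi : 0 <= Y^-1 by rewrite invr_ge0 ltW.
have Yi1 : 0 <= Y1^-1 by rewrite invr_ge0 ltW.
apply: ler_pM; rewrite ?nrm_ge0//.
  by rewrite addr_ge0 ?mulr_ge0 ?nrm_ge0.
by apply: lerD; rewrite ler_wpM2r.
Qed.

Lemma conj_form (T' : eqType) (s : seq T') (v : T' -> R[i]) :
  \sum_(n <- s) (v n)^*%C * v n = (nq s v)%:C.
Proof.
rewrite /nq rmorph_sum; apply: eq_bigr => n _; rewrite normc_sqr.
by case: (v n) => x y; apply/eqP; rewrite eq_complex/=; apply/andP; split; apply/eqP; ring.
Qed.

Lemma normc_conj (z : R[i]) : normc (z^*%C) = normc z.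
Proof. by case: z => x y; rewrite /normc /= sqrrN. Qed.

(** Test [apriori_form] with the conjugate of the function to be bounded. *)
Lemma apriori (sg ga M A : R) (q : 'rV[int]_2 -> R) (Z Z1 c : R[i])
    (Q phi u u1 : T -> R[i]) (cp cu cu1 : R) :
  0 < sg -> sg <= 1 -> ga <= sg / 48 -> 0 <= M -> 0 <= A -> (forall a, 0 <= q a) ->
  (forall s0, uniq s0 -> \sum_(a <- s0) q a ^+ 2 <= A) ->
  (forall n, normc (Q n) <= weight sg q n) ->
  0 < complex.Im Z -> 0 < complex.Im Z1 ->
  (forall t, 0 <= t -> normc (wave Z t - c * wave Z1 t) <= M * (1 + t ^+ 2) `^ ga) ->
  sqb phi cp -> sqb u cu -> sqb u1 cu1 ->
  (forall n, Lap u n + Z * u n = - 2 * (Q n * phi n)) ->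
  (forall n, Lap u1 n + Z1 * u1 n = c * (- 2 * (Q n * phi n))) ->
  forall s, uniq s -> nrm s (fun n => Q n * (u n - u1 n)) <=
    64 * M * mass_bound (sg / 48) * A * Num.sqrt cp.
Proof.
move=> sg0 sg1 gs M0 A0 q0 hA hQ Z0 Z10 hE hp hu hu1 eu eu1 s us.
set v := fun n => _; have := @apriori_form _ _ _ _ _ _ _ _ _ _ _ _
  (fun n => (v n)^*%C) _ _ _ s sg0 sg1 gs M0 A0 q0 hA hQ Z0 Z10 hE hp hu hu1 eu eu1 us.
rewrite conj_form normcR ger0_norm ?nq_ge0// -nrm_sqr.
have -> : nrm s (fun n => (v n)^*%C) = nrm s v.
  by rewrite /nrm /nq; congr Num.sqrt; apply: eq_bigr => n _; rewrite normc_conj.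
have [->|vn] := eqVneq (nrm s v) 0.
  move=> _; rewrite !mulr_ge0 ?sqrtr_ge0//.
  by rewrite mass_bound_ge0// divr_ge0// ltW.
by rewrite expr2 ler_pM2r// lt_neqAle eq_sym vn nrm_ge0.
Qed.

End apriori_l2.

(** * Existence of solutions and a bound away from the spectrum *)

Section existence.
Context {R : realType}.

Lemma le_of_forall_pow (r X B K : R) : 0 <= r -> r < 1 ->
  (forall N, X <= B + K * r ^+ N) -> X <= B.
Proof.
move=> r0 r1 h.
have c : (B + K * r ^+ N) @[N --> \oo] --> B + K * 0.
  apply: cvgD; first exact: cvg_cst.
  by apply: cvgM; [exact: cvg_cst|apply: cvg_expr; rewrite ger0_norm].
rewrite mulr0 addr0 in c; apply: (cvgr_to_ge c).
by apply: nearW.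
Qed.

Lemma real_geom_limit (a : nat -> R) (C r : R) : 0 <= C -> 0 <= r -> r < 1 ->
  (forall N, `|a N.+1 - a N| <= C * r ^+ N) ->
  exists l, forall N, `|a N - l| <= C / (1 - r) * r ^+ N.
Proof.
move=> C0 r0 r1 h; have r1' : 0 < 1 - r by rewrite subr_gt0.
pose K := C / (1 - r).
have K0 : 0 <= K by rewrite divr_ge0// ltW.
have KE : K * (1 - r) = C by rewrite divfK// gt_eqF.
have step N : a N - K * r ^+ N <= a N.+1 - K * r ^+ N.+1 /\
   a N.+1 + K * r ^+ N.+1 <= a N + K * r ^+ N.
  have := h N; rewrite ler_norml -KE exprS => /andP[]; set p := r ^+ N; split; lra.
have lo N M : (N <= M)%N -> a N - K * r ^+ N <= a M - K * r ^+ M.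
  elim: M => [|M ih]; first by rewrite leqn0 => /eqP ->.
  by rewrite leq_eqVlt => /predU1P[->//|/ih /le_trans]; apply; exact: (step M).1.
have up N M : (N <= M)%N -> a M + K * r ^+ M <= a N + K * r ^+ N.
  elim: M => [|M ih]; first by rewrite leqn0 => /eqP ->.
  by rewrite leq_eqVlt => /predU1P[->//|/ih]; apply: le_trans; exact: (step M).2.
have cross N M : a N - K * r ^+ N <= a M + K * r ^+ M.
  have p k : 0 <= K * r ^+ k by rewrite mulr_ge0 ?exprn_ge0.
  have := lo N (maxn N M) (leq_maxl _ _); have := up M (maxn N M) (leq_maxr _ _).
  have := p (maxn N M); lra.
(* The intervals [a N - K r^N, a N + K r^N] are nested; the limit is their
   common point. *)
pose E := [set a N - K * r ^+ N | N in [set: nat]].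
have E0 : E !=set0 by exists (a 0%N - K * r ^+ 0), 0%N.
have Eub M : ubound E (a M + K * r ^+ M) by move=> _ [N _ <-]; exact: cross.
exists (sup E) => N; rewrite -/K ler_norml; apply/andP; split.
  have := ge_sup E0 (Eub N); lra.
have : a N - K * r ^+ N <= sup E.
  by apply: sup_upper_bound; [split => //; exists (a 0%N + K * r ^+ 0) | exists N].
lra.
Qed.

Lemma normc_Re (z : R[i]) : `|complex.Re z| <= normc z.
Proof.
rewrite -(@ler_pXn2r _ 2)// ?nnegrE ?normc_ge0// normc_sqr real_normK ?num_real//.
by rewrite lerDl sqr_ge0.
Qed.

Lemma normc_Im (z : R[i]) : `|complex.Im z| <= normc z.
Proof.
rewrite -(@ler_pXn2r _ 2)// ?nnegrE ?normc_ge0// normc_sqr real_normK ?num_real//.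
by rewrite lerDr sqr_ge0.
Qed.

Lemma normc_le_ReIm (z : R[i]) : normc z <= `|complex.Re z| + `|complex.Im z|.
Proof.
rewrite -(@ler_pXn2r _ 2)// ?nnegrE ?normc_ge0 ?addr_ge0// normc_sqr sqrrD.
rewrite !real_normK ?num_real//.
have : 0 <= `|complex.Re z| * `|complex.Im z| by rewrite mulr_ge0.
lra.
Qed.

Lemma ReB (x y : R[i]) : complex.Re (x - y) = complex.Re x - complex.Re y.
Proof. by case: x y => [? ?] [? ?]. Qed.

Lemma ImB (x y : R[i]) : complex.Im (x - y) = complex.Im x - complex.Im y.
Proof. by case: x y => [? ?] [? ?]. Qed.

Lemma geom_limit (a : nat -> R[i]) (C r : R) : 0 <= C -> 0 <= r -> r < 1 ->
  (forall N, normc (a N.+1 - a N) <= C * r ^+ N) ->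
  exists l, forall N, normc (a N - l) <= 2 * C / (1 - r) * r ^+ N.
Proof.
move=> C0 r0 r1 h.
have hRe N : `|complex.Re (a N.+1) - complex.Re (a N)| <= C * r ^+ N.
  by rewrite -ReB; exact: le_trans (normc_Re _) (h N).
have hIm N : `|complex.Im (a N.+1) - complex.Im (a N)| <= C * r ^+ N.
  by rewrite -ImB; exact: le_trans (normc_Im _) (h N).
have [x hx] := real_geom_limit C0 r0 r1 hRe.
have [y hy] := real_geom_limit C0 r0 r1 hIm.
exists (x +i* y) => N; apply: (le_trans (normc_le_ReIm _)); rewrite ReB ImB/=.
rewrite -!mulrA mulr_natl mulr2n !mulrA.
exact: lerD.
Qed.

Lemma sqb_point (T : eqType) (f : T -> R[i]) (c : R) n : 0 <= c -> sqb f (c ^+ 2) -> normc (f n) <= c.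
Proof.
move=> c0 /(_ [:: n] isT); rewrite /nq big_seq1 ler_pXn2r ?nnegrE ?normc_ge0//.
Qed.

Lemma sqb_scale (T : eqType) (f : T -> R[i]) (c : R) k : sqb f c -> sqb (fun n => k * f n) (normc k ^+ 2 * c).
Proof.
move=> h s us; rewrite -nrm_sqr nrmZ exprMn nrm_sqr ler_wpM2l ?sqr_ge0//; exact: h.
Qed.

Lemma nrm_cst (T : eqType) (s : seq T) (z : R[i]) :
  nrm s (fun=> z) = Num.sqrt (size s)%:R * normc z.
Proof.
rewrite /nrm /nq big_const_seq count_predT iter_addr addr0.
rewrite -[_ ^+ 2 *+ _]mulr_natl sqrtrM ?ler0n// sqrtr_sqr ger0_norm//.
exact: normc_ge0.
Qed.

(** [Z] itself may lie within distance [||L||] of the origin, where the Neumann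
    series in [L / Z] diverges.  Write [L + Z = (L - i K) + (Z + i K)] with [K] real:
    [||L - i K||^2 <= D^2 + K^2], whereas [|Z + i K|^2 >= (Im Z)^2 + 2 K Im Z + K^2].
    With [K = D^2 / Im Z] the second one exceeds the first and the series
    converges. *)
Lemma resolvent_exists D (Z : R[i]) (h : 'rV[int]_D -> R[i]) c : (0 < D)%N ->
  complex.Im Z != 0 -> sqb h c ->
  exists u cu, sqb u cu /\ forall n, Lap u n + Z * u n = h n.
Proof.
move=> D0 Y0 hc; have c0 := sqb_ge0 hc.
have Dp : 0 < D%:R :> R by rewrite ltr0n.
pose Y := complex.Im Z; pose K := D%:R ^+ 2 / Y.
pose ze : R[i] := Z + 'i * K%:C.
have ze2 : normc ze ^+ 2 = complex.Re Z ^+ 2 + Y ^+ 2 + 2 * D%:R ^+ 2 + K ^+ 2.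
  rewrite normc_sqr /ze /K /Y; case: (Z) Y0 => x y /= y0.
  by field.
pose b := D%:R ^+ 2 + K ^+ 2.
have b0 : 0 <= b by rewrite addr_ge0 ?sqr_ge0.
have bz : b < normc ze ^+ 2.
  rewrite ze2 /b; have : 0 < (D%:R : R) ^+ 2 by rewrite exprn_gt0.
  have := sqr_ge0 (complex.Re Z); have := sqr_ge0 Y.
  by move: (_ ^+ 2) (K ^+ 2) => p k; lra.
have zn0 : 0 < normc ze.
  rewrite lt_neqAle normc_ge0 andbT; apply: contraTneq (le_lt_trans b0 bz) => <-.
  by rewrite expr0n ltxx.
have ze0 : ze != 0 by apply: contraTneq zn0 => ->; rewrite normc0 ltxx.
pose r := Num.sqrt b / normc ze.
have r0 : 0 <= r by rewrite divr_ge0 ?sqrtr_ge0// ltW.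
have r2 : r ^+ 2 = b / normc ze ^+ 2 by rewrite exprMn exprVn sqr_sqrtr.
have r1 : r < 1.
  by rewrite -(@ltr_pXn2r _ 2)// ?nnegrE// expr1n r2 ltr_pdivrMr ?mul1r// exprn_gt0.
pose A (f : 'rV[int]_D -> R[i]) n := Lap f n - 'i * K%:C * f n.
have A_bound f e : sqb f e -> sqb (A f) (b * e).
  move=> fe s us; have := @sqb_schrodinger R D f e K 1 fe s us.
  rewrite expr1n mul1r addrC -/b; apply: le_trans; apply: nq_le => n _.
  rewrite -[leLHS]normc_iM /A rmorph1 mulr1.
  have -> : 'i * (Lap f n - 'i * K%:C * f n) = K%:C * f n + 'i * Lap f n.
    have i2 := @i_sqr R; rewrite [LHS](_ : _ = 'i * Lap f n - ('i * 'i) * (K%:C * f n)); last by ring.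
    by rewrite i2; ring.
  by [].
pose u := fix u N := if N is N'.+1 then fun n => ze^-1 * (h n - A (u N') n) else fun=> 0.
have AB f g n : A f n - A g n = A (fun m => f m - g m) n.
  rewrite /A.
  have -> : Lap (fun m => f m - g m) n = Lap f n - Lap g n.
    by under eq_fun do rewrite -mulN1r; rewrite LapD LapZ mulN1r.
  by ring.
pose B := Num.sqrt c / normc ze.
have B0 : 0 <= B by rewrite divr_ge0 ?sqrtr_ge0// ltW.
have diff N : sqb (fun n => u N.+1 n - u N n) ((B * r ^+ N) ^+ 2).
  elim: N => [|N ih].
    have -> : (fun n => u 1%N n - u 0%N n) = (fun n => ze^-1 * h n).
      apply/funext => n /=; have -> : A (fun=> 0) n = 0.
        by rewrite /A /Lap big1 ?mulr0 ?subr0// => j _; rewrite addr0.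
      by rewrite !subr0.
    have := sqb_scale ze^-1 hc; rewrite expr0 mulr1 normcV /B exprMn sqr_sqrtr// mulrC; exact.
  have -> : (fun n => u N.+2 n - u N.+1 n) = (fun n => - ze^-1 * A (fun m => u N.+1 m - u N m) n).
    by apply/funext => n; rewrite -AB /=; ring.
  have := sqb_scale (- ze^-1) (A_bound _ _ ih); rewrite normcN normcV.
  have bE : b = r ^+ 2 * normc ze ^+ 2 by rewrite r2 divfK// gt_eqF// exprn_gt0.
  suff -> : (normc ze)^-1 ^+ 2 * (b * (B * r ^+ N) ^+ 2) = (B * r ^+ N.+1) ^+ 2 by [].
  rewrite bE (exprS r N); move: (r ^+ N) => p; field.
  by rewrite gt_eqF.
have /choice[v hv] : forall n, exists l, forall N, normc (u N n - l) <= 2 * B / (1 - r) * r ^+ N.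
  move=> n; apply: geom_limit => // N.
  by apply: (sqb_point (c := B * r ^+ N)) (diff N); rewrite mulr_ge0 ?exprn_ge0.
have r1' : 0 < 1 - r by rewrite subr_gt0.
pose C := 2 * B / (1 - r).
have C0 : 0 <= C by apply: divr_ge0; [apply: mulr_ge0|exact: ltW].
have Cr N : 0 <= C * r ^+ N by apply: mulr_ge0 => //; exact: exprn_ge0.
exists v, ((B / (1 - r)) ^+ 2); split.
  apply: sqb_of_nrm => [|s us]; first by rewrite divr_ge0// ltW.
  have uN N : nrm s (u N) <= B / (1 - r) * (1 - r ^+ N).
    elim: N => [|N ih].
      by rewrite expr0 subrr mulr0 /nrm /nq big1 ?sqrtr0// => n _; rewrite normc0 expr0n.
    have -> : u N.+1 = (fun n => u N n + (u N.+1 n - u N n)).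
      by apply/funext => n; rewrite addrC subrK.
    apply: (le_trans (nrmD _ _ _)).
    have e : B / (1 - r) * (1 - r ^+ N.+1) = B / (1 - r) * (1 - r ^+ N) + B * r ^+ N.
      by rewrite exprS; field; rewrite gt_eqF.
    rewrite e; apply: lerD => //.
    have := sqb_nrm (diff N) us; rewrite sqrtr_sqr ger0_norm// mulr_ge0 ?exprn_ge0//.
  apply: (@le_of_forall_pow r _ _ (Num.sqrt (size s)%:R * C) r0 r1) => N.
  have -> : v = (fun n => u N n + - (u N n - v n)).
    by apply/funext => n; rewrite opprB addrC subrK.
  apply: (le_trans (nrmD _ _ _)); apply: lerD.
    have q0 : 0 <= B / (1 - r) by apply: divr_ge0 => //; exact: ltW.
    apply: (le_trans (uN N)); rewrite ler_piMr//.
    by rewrite gerBl exprn_ge0.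
  apply: (@le_trans _ _ (nrm s (fun=> (C * r ^+ N)%:C))).
    by apply: nrm_le => n _; rewrite normcN normcR (ger0_norm (Cr N)); exact: hv.
  by rewrite nrm_cst normcR (ger0_norm (Cr N)) mulrA.
move=> n; apply/eqP; rewrite -subr_eq0; apply/eqP; apply: eq0_normc.
apply/eqP; rewrite eq_le normc_ge0 andbT.
apply: (@le_of_forall_pow r _ _ ((D%:R + `|K|) * C + normc ze * C * r) r0 r1) => N.
pose w m := v m - u N m.
have wb m : normc (w m) <= C * r ^+ N by rewrite -normcN opprB; exact: hv.
have -> : Lap v n + Z * v n - h n = A w n + ze * (v n - u N.+1 n).
  rewrite /= mulrBr mulrA mulfV// mul1r /w -AB /A /ze; ring.
rewrite add0r [leRHS]mulrDl; apply: (le_trans (le_normcD _ _)); apply: lerD.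
  apply: (le_trans (le_normcD _ _)); rewrite normcN -mulrA normc_iM (normcM K%:C) normcR.
  rewrite [leRHS](_ : _ = D%:R * (C * r ^+ N) + `|K| * (C * r ^+ N)); last by ring.
  by apply: lerD; [exact: Lap_bound|rewrite ler_wpM2l].
rewrite normcM [leRHS](_ : _ = normc ze * (C * r ^+ N.+1)); last by rewrite exprS; ring.
by rewrite ler_wpM2l ?normc_ge0// -normcN opprB; exact: hv.
Qed.

(** [||L w + ze w|| >= (|ze| - ||L||) ||w||]. *)
Lemma resolvent_lower D (w u : 'rV[int]_D -> R[i]) (ze : R[i]) (La cw cu : R) (k : R[i]) :
  La <= normc ze -> D%:R < La -> sqb w cw -> sqb u cu ->
  (forall n, Lap w n + ze * w n = k * u n) ->
  forall s, uniq s -> nrm s w <= normc k * Num.sqrt cu / (La - D%:R).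
Proof.
move=> zL DL hw hu e.
have La0 : 0 < La - D%:R by rewrite subr_gt0.
pose E := [set nrm s w | s in [set s | uniq s]].
have E0 : E !=set0 by exists (nrm [::] w), [::].
have Eub : has_ubound E by exists (Num.sqrt cw) => _ [s us <-]; exact: sqb_nrm.
have W_ub s : uniq s -> nrm s w <= sup E.
  by move=> us; apply: sup_upper_bound; [split|exists s].
have W0 : 0 <= sup E by rewrite (le_trans (nrm_ge0 [::] w))// W_ub.
have wW : sqb w (sup E ^+ 2) by exact: sqb_of_nrm.
suff : sup E <= normc k * Num.sqrt cu / (La - D%:R).
  by move=> h s us; apply: le_trans h; exact: W_ub.
rewrite ler_pdivlMr//.
have key : sup E <= (normc k * Num.sqrt cu + D%:R * sup E) / La.
  have La1 : 0 < La by rewrite (le_lt_trans _ DL).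
  apply: ge_sup E0 _ => _ [s us <-]; rewrite ler_pdivlMr// mulrC.
  apply: (@le_trans _ _ (normc ze * nrm s w)); first by rewrite ler_wpM2r ?nrm_ge0.
  rewrite -nrmZ.
  have -> : (fun n => ze * w n) = (fun n => k * u n + -1 * Lap w n).
    by apply/funext => n; rewrite -e mulN1r addrAC subrr add0r.
  apply: (le_trans (nrmD _ _ _)); rewrite (nrmZ s k) (nrmZ s (-1) (Lap w)) normcN normc1 mul1r.
  apply: lerD.
    by rewrite ler_wpM2l ?normc_ge0// sqb_nrm.
  have := sqb_nrm (sqb_Lap wW) us.
  by rewrite -exprMn sqrtr_sqr (ger0_norm (mulr_ge0 (ler0n _ _) W0)).
have La1 : 0 < La by rewrite (le_lt_trans _ DL).
by move: key; rewrite ler_pdivlMr//; lra.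
Qed.

Lemma Lap_conj D (u : 'rV[int]_D -> R[i]) n : Lap (fun m => (u m)^*%C) n = (Lap u n)^*%C.
Proof.
have half : (2^-1 : R[i]) = (2^-1 : R)%:C by rewrite fmorphV rmorph_nat.
rewrite /Lap rmorphM half; congr (_ * _); first by apply/eqP; rewrite eq_complex/= oppr0 !eqxx.
by rewrite rmorph_sum; apply: eq_bigr => j _; rewrite rmorphD.
Qed.

Lemma sqb_conj (T : eqType) (f : T -> R[i]) c : sqb f c -> sqb (fun n => (f n)^*%C) c.
Proof.
by move=> h s us; rewrite /nq; under eq_bigr do rewrite normc_conj; exact: h.
Qed.

End existence.

(** * Sandwiched bounds in the closed upper half-plane *)

Section l2norm_finite.
Context {R : realType} {T : choiceType}.
Implicit Types f : T -> R[i].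

Lemma sum_fset_seq (A : set T) (F : T -> R) : finite_set A ->
  exists2 s : seq T, uniq s & \sum_(x \in A) (F x)%:E = (\sum_(x <- s) F x)%:E.
Proof.
move=> fA; exists (finmap.enum_fset (fset_set A)); first exact: finmap.fset_uniq.
by rewrite fsbig_finite//= sumEFin.
Qed.

Lemma l2norm_le f (c : R) : 0 <= c -> sqb f (c ^+ 2) -> (l2norm f <= c%:E)%E.
Proof.
move=> c0 h; have -> : c%:E = sqrte (c ^+ 2)%:E by rewrite /= sqrtr_sqr ger0_norm.
rewrite /l2norm lee_sqrt ?lee_fin ?sqr_ge0//.
apply: ge_ereal_sup => _ [A [fA _] <-].
have [s us ->] := sum_fset_seq (fun x => normc (f x) ^+ 2) fA.
by rewrite lee_fin; exact: h.
Qed.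

Lemma l2norm_sqb f (c : R) : 0 <= c -> (l2norm f <= c%:E)%E -> sqb f (c ^+ 2).
Proof.
move=> c0 h s us; rewrite -lee_fin.
have e : c%:E = sqrte (c ^+ 2)%:E by rewrite /= sqrtr_sqr ger0_norm.
have c2 : (0 <= (c ^+ 2)%:E)%E by rewrite lee_fin sqr_ge0.
move: h; rewrite e /l2norm (lee_sqrt _ c2); apply: le_trans.
apply: ereal_sup_ubound; exists [set` s]; first by split => //; exact: finite_seq.
by rewrite /nq -sumEFin [RHS](fsbig_seq _ _ us).
Qed.

Lemma l2P f : l2 f -> exists2 c, 0 <= c & l2norm f = c%:E.
Proof.
rewrite /l2/=; have : (0 <= l2norm f)%E by exact: sqrte_ge0.
by case: (l2norm f) => [c| |]//; rewrite lee_fin => c0 _; exists c.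
Qed.

Lemma l2_sqb f : l2 f -> exists c, sqb f c.
Proof.
by move=> /l2P[c c0 e]; exists (c ^+ 2); apply: l2norm_sqb => //; rewrite e.
Qed.

Lemma sqb_l2 f c : sqb f c -> l2 f.
Proof.
move=> h; have c0 := sqb_ge0 h; rewrite /l2/=.
apply: (@le_lt_trans _ _ (Num.sqrt c)%:E); last exact: ltry.
by apply: l2norm_le; rewrite ?sqrtr_ge0 ?sqr_sqrtr.
Qed.

End l2norm_finite.

Section core.
Context {R : realType}.
Variable D : nat.
Local Notation T := 'rV[int]_(2 + (1 + D)).
Let dim : nat := 2 + (1 + D).

Definition shiftZ (z : R[i]) : R[i] := 2 * z - dim%:R.

Lemma H0hatE (u : T -> R[i]) z n :
  Lap u n + shiftZ z * u n = - 2 * (H0hat u n - z * u n).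
Proof.
rewrite /H0hat /Lap /shiftZ -/dim; set S := \sum_(_ < _) _.
have h2 : (2 : R[i]) != 0 by rewrite pnatr_eq0.
have h4 : (4 : R[i]) != 0 by rewrite pnatr_eq0.
have -> : (4%:R^-1 : R[i]) = 2^-1 * 2^-1 by rewrite -invfM; congr (_^-1); rewrite -natrM.
have hh : (2 : R[i]) * 2^-1 = 1 by rewrite mulfV.
rewrite [RHS](_ : _ = - (2 * 2^-1) * dim%:R * u n + (2 * 2^-1) * (2^-1 * S) + 2 * z * u n); last by ring.
by rewrite hh; ring.
Qed.

Lemma Im_shiftZ z : complex.Im (shiftZ z) = 2 * complex.Im z.
Proof.
rewrite /shiftZ ImB ImM -!(rmorph_nat (real_complex R))/=; ring.
Qed.

Lemma Re_shiftZ z : complex.Re (shiftZ z) = 2 * complex.Re z - dim%:R.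
Proof.
rewrite /shiftZ ReB ReM -!(rmorph_nat (real_complex R))/=; ring.
Qed.

Variables (sg A : R) (q : 'rV[int]_2 -> R) (Q : T -> R[i]).
Hypotheses (sg0 : 0 < sg) (sg1 : sg <= 1) (A0 : 0 <= A) (q0 : forall a, 0 <= q a).
Hypothesis qA : forall s0, uniq s0 -> \sum_(a <- s0) q a ^+ 2 <= A.
Hypothesis hQ : forall n, normc (Q n) <= weight sg q n.

Let B : R := 64 * mass_bound (sg / 48).

Lemma Q_bound n : normc (Q n) <= Num.sqrt A.
Proof.
apply: (le_trans (hQ n)); rewrite /weight.
apply: (@le_trans _ _ (q (lsubmx n))); first by rewrite ler_piMr ?rho1_le1// ltW.
have := qA (s0 := [:: lsubmx n]) isT; rewrite big_seq1 => h.
by rewrite -(ger0_norm (q0 _)) -sqrtr_sqr ler_wsqrtr.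
Qed.

Lemma Qphi_sqb phi cp : sqb phi cp -> sqb (fun n => Q n * phi n) (A * cp).
Proof.
move=> h s us; apply: (@le_trans _ _ (A * nq s phi)); last by rewrite ler_wpM2l ?h.
rewrite /nq mulr_sumr; apply: ler_sum => n _; rewrite normcM exprMn ler_wpM2r ?sqr_ge0//.
by rewrite -[leRHS]sqr_sqrtr// ler_pXn2r ?nnegrE ?normc_ge0 ?sqrtr_ge0// Q_bound.
Qed.

Let solves (Z : R[i]) (phi u : T -> R[i]) : Prop :=
  forall n, Lap u n + Z * u n = - 2 * (Q n * phi n).

Lemma upper_bound Z phi u cp cu : 0 < complex.Im Z -> sqb phi cp -> sqb u cu ->
  solves Z phi u -> forall s, uniq s -> nrm s (fun n => Q n * u n) <= B * A * Num.sqrt cp.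
Proof.
move=> Z0 hp hu e s us.
have h0 : sqb (fun _ : T => 0 : R[i]) 0.
  by move=> s' _; rewrite /nq big1// => x _; rewrite normc0 expr0n.
have ga : (0 : R) <= sg / 48 by rewrite divr_ge0// ltW.
have w t : 0 <= t -> normc (wave Z t - 0 * wave Z t) <= 1 * (1 + t ^+ 2) `^ (0 : R).
  move=> t0; rewrite mul0r subr0 powRr0 mul1r wave_norm -expR0 ler_expR oppr_le0.
  by rewrite mulr_ge0// ltW.
have z0 n : Lap (fun _ : T => 0) n + Z * 0 = 0 * (- 2 * (Q n * phi n)).
  by rewrite mulr0 mul0r addr0 /Lap big1 ?mulr0// => j _; rewrite addr0.
have := apriori sg0 sg1 ga ler01 A0 q0 qA hQ Z0 Z0 w hp hu h0 e z0 us.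
by under eq_fun do rewrite subr0; rewrite mulr1.
Qed.

Lemma upper_difference Z Z1 g phi u u1 cp cu cu1 :
  0 < g -> g <= sg / 24 ->
  0 < complex.Im Z -> 0 < complex.Im Z1 -> sqb phi cp -> sqb u cu -> sqb u1 cu1 ->
  solves Z phi u -> solves Z1 phi u1 ->
  forall s, uniq s -> nrm s (fun n => Q n * (u n - u1 n)) <=
    B * (2 * normc (Z - Z1) `^ g) * A * Num.sqrt cp.
Proof.
move=> g0 gs Z0 Z10 hp hu hu1 e e1 s us.
have ga : g / 2 <= sg / 48 by lra.
have g1 : g <= 1 by move: gs sg1; lra.
have M0 : 0 <= 2 * normc (Z - Z1) `^ g by rewrite mulr_ge0 ?powR_ge0.
have w t : 0 <= t -> normc (wave Z t - 1 * wave Z1 t) <=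
    2 * normc (Z - Z1) `^ g * (1 + t ^+ 2) `^ (g / 2).
  by move=> t0; rewrite mul1r; apply: wave_holder => //; exact: ltW.
have e1' n : Lap u1 n + Z1 * u1 n = 1 * (- 2 * (Q n * phi n)) by rewrite mul1r e1.
have := apriori sg0 sg1 ga M0 A0 q0 qA hQ Z0 Z10 w hp hu hu1 e e1' us.
by rewrite /B [64 * _ * mass_bound _]mulrAC.
Qed.

(** Approach [Z] by [Z + i / t].  The solution at [Z + i / t] obeys [upper_bound],
    and by [resolvent_lower] it differs from [u] by [O(1 / t)], because [Z] is at
    positive distance from the spectrum of [- L]. *)
Lemma real_bound Z phi u cp cu : complex.Im Z = 0 -> dim%:R < `|complex.Re Z| ->
  sqb phi cp -> sqb u cu -> solves Z phi u ->
  forall s, uniq s -> nrm s (fun n => Q n * u n) <= B * A * Num.sqrt cp.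
Proof.
move=> Z0 Zd hp hu e s us.
set La := `|complex.Re Z| in Zd.
have La0 : 0 < La - dim%:R by rewrite subr_gt0.
apply: (@le_of_forall_div R _ _ (Num.sqrt A * (Num.sqrt cu / (La - dim%:R)))) => t t0.
have ti : 0 < t^-1 by rewrite invr_gt0.
pose Zt := Z + 'i * (t^-1)%:C.
have ImZt : complex.Im Zt = t^-1 by rewrite /Zt ImD ImM/= Z0; ring.
have ReZt : complex.Re Zt = complex.Re Z by rewrite /Zt ReD ReM/=; ring.
have hphi : sqb (fun n => - 2 * (Q n * phi n)) (normc (- 2) ^+ 2 * (A * cp)).
  by apply: sqb_scale; exact: Qphi_sqb.
have Zt0 : complex.Im Zt != 0 by rewrite ImZt gt_eqF.
have [v [cv [hv ev]]] := resolvent_exists (D := dim) isT Zt0 hphi.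
have ub : nrm s (fun n => Q n * v n) <= B * A * Num.sqrt cp.
  by apply: (upper_bound (Z := Zt) _ hp hv ev us); rewrite ImZt.
have hw : sqb (fun n => u n + -1 * v n) ((Num.sqrt cu + Num.sqrt cv) ^+ 2).
  apply: sqb_of_nrm => [|s' us']; first by rewrite addr_ge0 ?sqrtr_ge0.
  apply: (le_trans (nrmD _ _ _)); rewrite (nrmZ s' (-1) v) normcN normc1 mul1r.
  by apply: lerD; exact: sqb_nrm.
have ew n : Lap (fun n => u n + -1 * v n) n + Zt * (u n + -1 * v n) = ('i * (t^-1)%:C) * u n.
  rewrite LapD LapZ; have := e n; have := ev n; rewrite /Zt => <-.
  set a := Lap u n; set b := Lap v n => h.
  rewrite [LHS](_ : _ = (a + Z * u n) - (b + (Z + 'i * (t^-1)%:C) * v n) + 'i * (t^-1)%:C * u n); last by ring.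
  by rewrite h subrr add0r.
have LZ : La <= normc Zt by rewrite /La -ReZt normc_Re.
have low := resolvent_lower LZ Zd hw hu ew us.
have -> : (fun n => Q n * u n) = (fun n => Q n * v n + Q n * (u n + -1 * v n)).
  by apply/funext => n; ring.
apply: (le_trans (nrmD _ _ _)); apply: lerD => //.
apply: (@le_trans _ _ (Num.sqrt A * nrm s (fun n => u n + -1 * v n))).
  have -> : Num.sqrt A * nrm s (fun n => u n + -1 * v n) =
     nrm s (fun n => (Num.sqrt A)%:C * (u n + -1 * v n)).
    by rewrite nrmZ normcR ger0_norm ?sqrtr_ge0.
  apply: nrm_le => n _; rewrite !normcM normcR ger0_norm ?sqrtr_ge0//.
  by rewrite ler_wpM2r ?mulr_ge0 ?normc_ge0 ?Q_bound.
rewrite -mulrA ler_wpM2l ?sqrtr_ge0//; apply: (le_trans low).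
rewrite normc_iM normcR ger0_norm ?(ltW ti)//.
by rewrite [leLHS]mulrC mulrA mulrAC mulrC mulrA [X in X <= _](_ : _ = Num.sqrt cu / (La - dim%:R) / t)//; ring.
Qed.

End core.

(** * From solutions to the resolvent *)

Section resolvent_bounds.
Context {R : realType}.
Variable D : nat.
Local Notation T := 'rV[int]_(2 + (1 + D)).
Local Notation dim := (2 + (1 + D))%N.

Lemma conj_mul (x y : R[i]) : (x * y)^*%C = x^*%C * y^*%C.
Proof. exact: rmorphM. Qed.

Lemma conj_add (x y : R[i]) : (x + y)^*%C = x^*%C + y^*%C.
Proof. exact: rmorphD. Qed.

Lemma conj_sub (x y : R[i]) : (x - y)^*%C = x^*%C - y^*%C.
Proof. exact: rmorphB. Qed.

Lemma conj_opp (x : R[i]) : (- x)^*%C = - x^*%C.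
Proof. exact: rmorphN. Qed.

Lemma conj_natr (n : nat) : (n%:R : R[i])^*%C = n%:R.
Proof. by rewrite -(rmorph_nat (real_complex R)); apply/eqP; rewrite eq_complex/= oppr0 !eqxx. Qed.

Lemma solves_conj (Z : R[i]) (Q phi u : T -> R[i]) :
  (forall n, Lap u n + Z * u n = - 2 * (Q n * phi n)) ->
  forall n, Lap (fun m => (u m)^*%C) n + Z^*%C * (u n)^*%C
    = - 2 * ((Q n)^*%C * (phi n)^*%C).
Proof.
by move=> h n; rewrite Lap_conj -(conj_mul Z) -conj_add h !conj_mul conj_opp conj_natr.
Qed.

Lemma solvesP (z : R[i]) (Q phi u : T -> R[i]) :
  (fun n => H0hat u n - z * u n) = (fun n => Q n * phi n) ->
  forall n, Lap u n + shiftZ D z * u n = - 2 * (Q n * phi n).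
Proof. by move=> h n; rewrite H0hatE -[Q n * phi n]/((fun n => Q n * phi n) n) -h. Qed.

Lemma nrm_conj (s : seq T) (f g : T -> R[i]) : (forall n, g n = (f n)^*%C) -> nrm s g = nrm s f.
Proof.
by move=> h; rewrite /nrm /nq; congr Num.sqrt; apply: eq_bigr => n _; rewrite h normc_conj.
Qed.

Lemma Im_conj (z : R[i]) : complex.Im (z^*%C) = - complex.Im z.
Proof. by case: z. Qed.

Variables (sg A : R) (q : 'rV[int]_2 -> R) (Q : T -> R[i]).
Hypotheses (sg0 : 0 < sg) (sg1 : sg <= 1) (A0 : 0 <= A) (q0 : forall a, 0 <= q a).
Hypothesis qA : forall s0, uniq s0 -> \sum_(a <- s0) q a ^+ 2 <= A.
Hypothesis hQ : forall n, normc (Q n) <= weight sg q n.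

Let hQc n : normc ((Q n)^*%C) <= weight sg q n.
Proof. by rewrite normc_conj. Qed.

(** The lower half-plane is reduced to the upper one by conjugating the
    equation. *)
Lemma sandwiched_bound z phi u cp cu :
  ~ [set t%:C | t in `[0 : R, dim%:R]%classic] z -> sqb phi cp -> sqb u cu ->
  (fun n => H0hat u n - z * u n) = (fun n => Q n * phi n) ->
  forall s, uniq s -> nrm s (fun n => Q n * u n) <=
    64 * mass_bound (sg / 48) * A * Num.sqrt cp.
Proof.
move=> zN hp hu /solvesP e s us.
have [z0|z0|z0] := ltgtP (complex.Im z) 0.
- have Z0 : 0 < complex.Im ((shiftZ D z)^*%C) by rewrite Im_conj Im_shiftZ; lra.
  have := upper_bound sg0 sg1 A0 q0 qA hQc Z0 (sqb_conj hp) (sqb_conj hu) (solves_conj e) us.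
  suff -> : nrm s (fun n => (Q n)^*%C * (u n)^*%C) = nrm s (fun n => Q n * u n) by [].
  by apply: nrm_conj => n; rewrite conj_mul.
- have Z0 : 0 < complex.Im (shiftZ D z) by rewrite Im_shiftZ; lra.
  exact: (upper_bound sg0 sg1 A0 q0 qA hQ Z0 hp hu e us).
have Z0 : complex.Im (shiftZ D z) = 0 by rewrite Im_shiftZ z0 mulr0.
have Zd : dim%:R < `|complex.Re (shiftZ D z)|.
  rewrite Re_shiftZ ltNge; apply/negP; rewrite ler_norml => /andP[h1 h2].
  apply: zN; exists (complex.Re z); first by rewrite /= in_itv/=; apply/andP; split; lra.
  by case: (z) z0 => x y /= ->.
exact: (real_bound sg0 sg1 A0 q0 qA hQ Z0 Zd hp hu e us).
Qed.

Lemma sandwiched_difference z z1 g phi u u1 cp cu cu1 :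
  0 < g -> g <= sg / 24 ->
  (0 < complex.Im z /\ 0 < complex.Im z1) \/ (complex.Im z < 0 /\ complex.Im z1 < 0) ->
  sqb phi cp -> sqb u cu -> sqb u1 cu1 ->
  (fun n => H0hat u n - z * u n) = (fun n => Q n * phi n) ->
  (fun n => H0hat u1 n - z1 * u1 n) = (fun n => Q n * phi n) ->
  forall s, uniq s -> nrm s (fun n => Q n * (u n - u1 n)) <=
    normc (z - z1) `^ g * (256 * mass_bound (sg / 48) * A * Num.sqrt cp).
Proof.
move=> g0 gs im hp hu hu1 /solvesP e /solvesP e1 s us.
have g1 : g <= 1 by move: gs sg1; lra.
set N := normc (z - z1); have N0 : 0 <= N by exact: normc_ge0.
have eZ : normc (shiftZ D z - shiftZ D z1) = 2 * N.
  rewrite /shiftZ opprB addrA subrK -mulrBr normcM -(rmorph_nat (real_complex R)) normcR.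
  by rewrite ger0_norm.
suff h : nrm s (fun n => Q n * (u n - u1 n)) <=
    64 * mass_bound (sg / 48) * (2 * (2 * N) `^ g) * A * Num.sqrt cp.
  apply: (le_trans h).
  have mb0 : 0 <= mass_bound (sg / 48) by rewrite mass_bound_ge0// divr_ge0// ltW.
  have p2 : (2 * N) `^ g <= 2 * N `^ g.
    rewrite powRM// ler_wpM2r ?powR_ge0//.
    by rewrite -[leRHS](powRr1 (ler0n R 2)) ler_powR// ler1n.
  rewrite [leLHS](_ : _ = 128 * mass_bound (sg / 48) * A * Num.sqrt cp * (2 * N) `^ g); last by ring.
  rewrite [leRHS](_ : _ = 128 * mass_bound (sg / 48) * A * Num.sqrt cp * (2 * N `^ g)); last by ring.
  by rewrite ler_wpM2l// !mulr_ge0 ?sqrtr_ge0.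
rewrite -eZ; case: im => -[y0 y1].
  have Z0 : 0 < complex.Im (shiftZ D z) by rewrite Im_shiftZ; lra.
  have Z10 : 0 < complex.Im (shiftZ D z1) by rewrite Im_shiftZ; lra.
  exact: (upper_difference sg0 sg1 A0 q0 qA hQ g0 gs Z0 Z10 hp hu hu1 e e1 us).
have Z0 : 0 < complex.Im ((shiftZ D z)^*%C) by rewrite Im_conj Im_shiftZ; lra.
have Z10 : 0 < complex.Im ((shiftZ D z1)^*%C) by rewrite Im_conj Im_shiftZ; lra.
have := upper_difference sg0 sg1 A0 q0 qA hQc g0 gs Z0 Z10 (sqb_conj hp) (sqb_conj hu)
  (sqb_conj hu1) (solves_conj e) (solves_conj e1) us.
rewrite -conj_sub normc_conj.
suff -> : nrm s (fun n => (Q n)^*%C * ((u n)^*%C - (u1 n)^*%C)) =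
    nrm s (fun n => Q n * (u n - u1 n)) by [].
by apply: nrm_conj => n; rewrite conj_mul conj_sub.
Qed.

End resolvent_bounds.

Section resolvent_operator.
Context {R : realType}.
Variable D : nat.
Local Notation T := 'rV[int]_(2 + (1 + D)).

(** When there is no preimage the resolvent is [0], for which any bound holds. *)
Lemma R0hat_cases (z : R[i]) (f : T -> R[i]) :
  (exists2 c, sqb (R0hat z f) c & (fun n => H0hat (R0hat z f) n - z * R0hat z f n) = f)
  \/ R0hat z f = fun=> 0.
Proof.
rewrite /R0hat /resolvent; case: xgetP => [u _ [/l2_sqb[c hc] e]|_]; last by right.
by left; exists c.
Qed.

(** Off the real axis both resolvents must be genuine: the difference of a
    solution and of [0] would not obey the Hoelder bound. *)
Lemma R0hat_solves (z : R[i]) (f : T -> R[i]) c : complex.Im z != 0 -> sqb f c ->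
  exists2 c', sqb (R0hat z f) c' & (fun n => H0hat (R0hat z f) n - z * R0hat z f n) = f.
Proof.
move=> z0 hf; rewrite /R0hat /resolvent; case: xgetP => [u _ [/l2_sqb[c' hc] e]|no].
  by exists c'.
exfalso.
have Z0 : complex.Im (shiftZ D z) != 0 by rewrite Im_shiftZ mulf_neq0// pnatr_eq0.
have [u [cu [hu eu]]] := resolvent_exists (D := 2 + (1 + D)) isT Z0 (sqb_scale (- 2) hf).
apply: (no u); split; first exact: sqb_l2 hu.
apply/funext => n; have := eu n; rewrite H0hatE => h.
have n2 : (- 2 : R[i]) != 0 by rewrite oppr_eq0 pnatr_eq0.
exact: (mulfI n2).
Qed.

End resolvent_operator.

Section weights.
Context {R : realType}.

Definition plane_weight (q1 q2 : int -> R[i]) (a : 'rV[int]_2) : R := normc (q1 (coord0 a)) * normc (q2 (coord1 a)).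

Lemma plane_weight_ge0 q1 q2 a : 0 <= plane_weight q1 q2 a.
Proof. by rewrite mulr_ge0 ?normc_ge0. Qed.

(** Enlarge [s0] to a product set. *)
Lemma plane_weight_sum q1 q2 A1 A2 (s0 : seq 'rV[int]_2) : sqb q1 A1 -> sqb q2 A2 -> uniq s0 ->
  \sum_(a <- s0) plane_weight q1 q2 a ^+ 2 <= A1 * A2.
Proof.
move=> h1 h2 us; pose t1 := undup (map coord0 s0); pose t2 := undup (map coord1 s0).
pose F (p : int * int) : R := normc (q1 p.1) ^+ 2 * normc (q2 p.2) ^+ 2.
have -> : \sum_(a <- s0) plane_weight q1 q2 a ^+ 2 = \sum_(p <- [seq (coord0 a, coord1 a) | a <- s0]) F p.
  by rewrite big_map; apply: eq_bigr => a _; rewrite /plane_weight exprMn.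
apply: (@le_trans _ _ (\sum_(p <- [seq (x, y) | x <- t1, y <- t2]) F p)).
  apply: sum_sub_le.
  - rewrite map_inj_uniq// => a b [e0 e1]; apply/rowP => j.
    have [->|->] : j = ord0 \/ j = @Ordinal 2 1 isT; [|exact: e0|exact: e1].
    by case: j => -[|[|m]] jm; [left|right|]; first [exact: val_inj|by []].
  - by apply: allpairs_uniq => [||[a b] [a' b'] _ _ /= [-> ->]]; rewrite ?undup_uniq.
  - move=> p /mapP[a as0 ->]; apply/allpairsP; exists (coord0 a, coord1 a).
    by split; rewrite //= mem_undup map_f.
  - by move=> p; rewrite mulr_ge0 ?sqr_ge0.
rewrite big_allpairs_dep/= /F/=; under eq_bigr do rewrite -mulr_sumr.
rewrite -mulr_suml; apply: ler_pM.
- by apply: sumr_ge0 => x _; exact: sqr_ge0.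
- by apply: sumr_ge0 => x _; exact: sqr_ge0.
- by apply: h1; exact: undup_uniq.
- by apply: h2; exact: undup_uniq.
Qed.

Variable D : nat.
Local Notation T := 'rV[int]_(2 + (1 + D)).
Variable hd : (3 <= D.+3)%N.

Lemma split_ordE (i : 'I_(2 + (D.+3 - 2))) (j : 'I_D.+3) : i = j :> nat -> split_ord hd i = j.
Proof. by move=> e; apply: val_inj. Qed.

Lemma fst_coordE (n : T) : fst_coord hd n = coord0 (lsubmx n).
Proof. by rewrite /fst_coord /coord0 mxE; congr (n _ _); exact: split_ordE. Qed.

Lemma snd_coordE (n : T) : snd_coord hd n = coord1 (lsubmx n).
Proof. by rewrite /snd_coord /coord1 mxE; congr (n _ _); exact: split_ordE. Qed.

(** In [rho_s] the coordinates after the third only make the weight smaller. *)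
Lemma rhov_tail_le (s s' : R) (n : T) : 0 <= s -> s <= s' ->
  rhov s' (tail hd n) <= rho1 s (lsubmx (rsubmx n) ord0 ord0).
Proof.
move=> s0 ss'; rewrite /rhov /rho1.
set S := \sum_(_ < _) _; set k := lsubmx _ _ _.
have kS : k%:~R ^+ 2 <= S.
  have lt0 : (0 < D.+3 - 2)%N by [].
  have kE : tail hd n 0 (Ordinal lt0) = k.
    by rewrite /tail /k !mxE; congr (n _ _); exact: split_ordE.
  rewrite /S (bigD1 (Ordinal lt0))//= kE lerDl sumr_ge0// => j _; exact: sqr_ge0.
have k1 : 1 <= 1 + k%:~R ^+ 2 :> R by rewrite lerDl sqr_ge0.
have S1 : 1 <= 1 + S by apply: (le_trans k1); rewrite lerD2l.
apply: (@le_trans _ _ ((1 + S) `^ (- s / 2%:R))).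
  by rewrite ler_powR// !mulNr lerN2 ler_wpM2r.
have kp := lt_le_trans ltr01 k1; have Sp := lt_le_trans ltr01 S1.
rewrite !mulNr !powRN lef_pV2 ?posrE ?powR_gt0//.
by apply: ge0_ler_powR; rewrite ?nnegrE ?divr_ge0 ?(ltW kp) ?(ltW Sp) ?lerD2l.
Qed.

Lemma Qs_le q1 q2 (s s' : R) n : 0 <= s -> s <= s' ->
  normc (Qs hd q1 q2 s' n) <= weight s (plane_weight q1 q2) n.
Proof.
move=> s0 ss'; rewrite /Qs /weight /plane_weight !normcM fst_coordE snd_coordE normcR ger0_norm ?powR_ge0//.
by rewrite ler_wpM2l ?mulr_ge0 ?normc_ge0// rhov_tail_le.
Qed.

(** Here [rho_g <= 1] and [rho_(s + 2 g) <= rho_s]. *)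
Lemma Qsg_le q1 q2 (s g : R) n : 0 <= s -> 0 <= g ->
  normc (Qsg hd q1 q2 s g n) <= weight s (plane_weight q1 q2) n.
Proof.
move=> s0 g0; rewrite /Qsg normcM normcR ger0_norm ?powR_ge0//.
have r1 : rho g (fst_coord hd n) <= 1 :> R.
  rewrite /rho -[leRHS](powRr0 (1 + (`|fst_coord hd n|%:~R : R) ^+ 2)).
  by rewrite ler_powR ?lerDl ?sqr_ge0// mulNr oppr_le0 divr_ge0.
apply: (@le_trans _ _ (normc (Qs hd q1 q2 (s + 2%:R * g) n))).
  by rewrite ler_piMl ?normc_ge0.
by apply: Qs_le; rewrite ?lerDl ?mulr_ge0.
Qed.

End weights.

Lemma opnorm_le (R : realType) (T : choiceType) (A : (T -> R[i]) -> T -> R[i]) (c : R) :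
  0 <= c -> (forall f, sqb f 1 -> forall s, uniq s -> nrm s (A f) <= c) ->
  (opnorm A <= c%:E)%E.
Proof.
move=> c0 h; apply: ge_ereal_sup => _ [f /= f1 <-].
apply: l2norm_le => //; apply: sqb_of_nrm => //; apply: h.
by rewrite -(expr1n R 2); apply: l2norm_sqb.
Qed.

Theorem lemma5p5 (R : realType) (d : nat) (hd : (3 <= d)%N)
    (s : R) (s_gt0 : 0 < s) (s_le1 : s <= 1) :
  (exists2 C : R, 0 < C &
    forall q1 q2 : int -> R[i], l2 q1 -> l2 q2 ->
    forall z : R[i],
      ~ [set t%:C | t in `[0 : R, d%:R]%classic] z ->
      normc z < 2%:R * d%:R ->
      (opnorm (mulop (Qs hd q1 q2 s) \o R0hat z \o mulop (Qs hd q1 q2 s))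
       <= C%:E * l2norm q1 ^+ 2 * l2norm q2 ^+ 2)%E)
  /\
  (exists2 g0 : R, 0 < g0 &
    forall g : R, 0 < g -> g < g0 ->
    exists2 C : R, 0 < C &
      forall q1 q2 : int -> R[i], l2 q1 -> l2 q2 ->
      forall z z1 : R[i],
        (0 < complex.Im z /\ 0 < complex.Im z1) \/
        (complex.Im z < 0 /\ complex.Im z1 < 0) ->
        normc z < 2%:R * d%:R -> normc z1 < 2%:R * d%:R ->
        (opnorm (mulop (Qsg hd q1 q2 s g) \o
                 (fun f n => (R0hat z f n - R0hat z1 f n)%R) \o
                 mulop (Qsg hd q1 q2 s g))
         <= (normc (z - z1)%R `^ g)%:E * C%:E
            * l2norm q1 ^+ 2 * l2norm q2 ^+ 2)%E).
Proof.
(* [d = 2 + 1 + D]: the plane of [q1] and [q2], the coordinate whose decay is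
   used, and the others. *)
case: d hd => [|[|[|D]]] // hd.
have mb0 : 0 <= mass_bound (s / 48) by rewrite mass_bound_ge0// divr_ge0// ltW.
have s0 := ltW s_gt0.
have sqb_q (q : int -> R[i]) c : 0 <= c -> l2norm q = c%:E -> sqb q (c ^+ 2).
  by move=> c0 e; apply: l2norm_sqb => //; rewrite e.
split.
  exists (64 * mass_bound (s / 48) + 1); first by rewrite ltr_wpDl// mulr_ge0.
  move=> q1 q2 /l2P[a1 a10 e1] /l2P[a2 a20 e2] z zN _.
  have h1 := sqb_q _ _ a10 e1; have h2 := sqb_q _ _ a20 e2.
  rewrite e1 e2 -!EFin_expe -!EFinM.
  set A := a1 ^+ 2 * a2 ^+ 2; have A0 : 0 <= A by rewrite mulr_ge0 ?sqr_ge0.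
  have B0 : 0 <= 64 * mass_bound (s / 48) by rewrite mulr_ge0.
  apply: (@le_trans _ _ (64 * mass_bound (s / 48) * A)%:E); last first.
    by rewrite lee_fin -[leRHS]mulrA -/A ler_wpM2r// lerDl.
  apply: opnorm_le => [|f f1 t ut]; first exact: mulr_ge0.
  have [[c hc e]|e] := R0hat_cases z (mulop (Qs hd q1 q2 s) f); last first.
    rewrite /= e /nrm /nq big1 ?sqrtr0 ?mulr_ge0// => n _.
    by rewrite /mulop mulr0 normc0 expr0n.
  have hQ n : normc (Qs hd q1 q2 s n) <= weight s (plane_weight q1 q2) n by exact: Qs_le.
  have := sandwiched_bound s_gt0 s_le1 A0 (plane_weight_ge0 q1 q2) (fun s0 => plane_weight_sum h1 h2)
    hQ zN f1 hc e ut.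
  by rewrite sqrtr1 mulr1.
(* The exponent [g / 2] of the growth must be at most [s / 48]. *)
exists (s / 24); first by rewrite divr_gt0.
move=> g g0 gs; exists (256 * mass_bound (s / 48) + 1); first by rewrite ltr_wpDl// mulr_ge0.
move=> q1 q2 /l2P[a1 a10 e1] /l2P[a2 a20 e2] z z1 im _ _.
have h1 := sqb_q _ _ a10 e1; have h2 := sqb_q _ _ a20 e2.
rewrite e1 e2 -!EFin_expe -!EFinM.
set A := a1 ^+ 2 * a2 ^+ 2; have A0 : 0 <= A by rewrite mulr_ge0 ?sqr_ge0.
have B0 : 0 <= 256 * mass_bound (s / 48) by rewrite mulr_ge0.
set N := normc (z - z1) `^ g; have N0 : 0 <= N by exact: powR_ge0.
have im0 : complex.Im z != 0 /\ complex.Im z1 != 0.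
  by case: im => -[y y1]; rewrite ?(gt_eqF y) ?(gt_eqF y1) ?(lt_eqF y) ?(lt_eqF y1).
apply: (@le_trans _ _ (N * (256 * mass_bound (s / 48) * A))%:E); last first.
  rewrite lee_fin [leRHS](_ : _ = N * ((256 * mass_bound (s / 48) + 1) * A)); last by rewrite /A; ring.
  by rewrite ler_wpM2l// ler_wpM2r// lerDl.
apply: opnorm_le => [|f f1 t ut]; first by rewrite mulr_ge0// mulr_ge0.
have hQ n : normc (Qsg hd q1 q2 s g n) <= weight s (plane_weight q1 q2) n.
  by apply: Qsg_le => //; exact: ltW.
have hQf := Qphi_sqb s_gt0 A0 (plane_weight_ge0 q1 q2) (fun s0 => plane_weight_sum h1 h2) hQ f1.
have [c hc e] := R0hat_solves im0.1 hQf.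
have [c' hc' e'] := R0hat_solves im0.2 hQf.
have := sandwiched_difference s_gt0 s_le1 A0 (plane_weight_ge0 q1 q2) (fun s0 => plane_weight_sum h1 h2)
    hQ g0 (ltW gs) im f1 hc hc' e e' ut.
by rewrite sqrtr1 mulr1.
Qed.
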